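(* Let $d\geq 1$, $0<s<1$ and $1\le q\le p<\infty$. Assume that $\alpha,\beta\in\mathbb{R}$ satisfy $$\alpha<sq-\Big(1-\tfrac{q}{p}\Big)d,\qquad \beta<sp,\qquad \alpha>-d,\qquad \beta>-d,\qquad \alpha+\tfrac{q\beta}{p}>-d,$$ and that $sq-\alpha-\tfrac{q\beta}{p}\neq d$. Let $u\in C_c^1(\mathbb{R}^d)$ if $sq-\alpha-\tfrac{q\beta}{p}<d$, and $u\in C_c^1(\mathbb{R}^d\setminus\{0\})$ if $sq-\alpha-\tfrac{q\beta}{p}>d$. Then $$\int_{\mathbb{R}^d}\left(\int_{\mathbb{R}^d}\frac{|u(x)-u(y)|^p}{|x-y|^{d+sp}}|y|^{\beta}\,dy\right)^{\frac{q}{p}}|x|^{\alpha}\,dx\geq \mathcal{C}^{p,q}_{d,s,\alpha,\beta}\int_{\mathbb{R}^d}\frac{|u(x)|^q}{|x|^{sq-\alpha-\frac{q\beta}{p}}}\,dx,$$ where $$\mathcal{C}^{p,q}_{d,s,\alpha,\beta}=\left(\int_{0}^{1}t^{sp-1}\left(t^{-\left(\frac{p}{q}-1\right)d-\frac{p\alpha}{q}}+t^{-\beta}\right)\left|1-t^{\left(d+\alpha+\frac{q\beta}{p}-sq\right)/q}\right|^p\Phi_{d,s,p}(t)\,dt\right)^{\frac{q}{p}}.$$ Moreover, the constant $\mathcal{C}^{p,q}_{d,s,\alpha,\beta}$ is finite and sharp, i.e. it is the largest constant for which the inequality holds for all admissible $u$.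
   Context: For $d\ge 2$, $\omega_{d-2}=|\mathbb{S}^{d-2}|=\frac{2\pi^{(d-1)/2}}{\Gamma((d-1)/2)}$ denotes the surface measure of the unit sphere in $\mathbb{R}^{d-1}$. For $0\le t<1$ the function $\Phi_{d,s,p}$ is defined by $$\Phi_{d,s,p}(t)=\omega_{d-2}\int_{-1}^{1}\frac{(1-r^{2})^{\frac{d-3}{2}}}{(1-2tr+t^2)^{\frac{d+sp}{2}}}\,dr\quad (d\ge 2),\qquad \Phi_{1,s,p}(t)=(1-t)^{-1-sp}+(1+t)^{-1-sp}.$$ Equivalently, $\Phi_{d,s,p}(t)=\int_{\mathbb{S}^{d-1}}|\omega-t\sigma|^{-d-sp}\,d\sigma$ for any $\omega\in\mathbb{S}^{d-1}$ (with counting measure on $\mathbb{S}^0=\{\pm1\}$ when $d=1$). $C_c^1(U)$ denotes continuously differentiable functions with compact support in $U$. *)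

(* Defs.v *)
From HB Require Import structures.
From mathcomp Require Import all_boot all_order all_algebra.
From mathcomp Require Import all_classical all_reals all_analysis.
Set Implicit Arguments. Unset Strict Implicit. Unset Printing Implicit Defensive.
Import Order.TTheory GRing.Theory Num.Theory.
Import numFieldNormedType.Exports.
Local Open Scope classical_set_scope.
Local Open Scope ring_scope.

Section Defs.
Context {R : realType}.
Local Notation mu := (@lebesgue_measure R).

(** Euclidean norm on R^n = 'rV[R]_n (the library norm on matrices is the
    max-norm, so we define the Euclidean one explicitly). *)
Definition enorm n (x : 'rV[R]_n) : R := Num.sqrt (\sum_(i < n) x 0 i ^+ 2).

Definition rcons_row n (t : R) (v : 'rV[R]_n) : 'rV[R]_n.+1 :=
  \row_(i < n.+1) match unlift ord0 i with Some j => v 0 j | None => t end.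

(** Lebesgue integral over R^n of a NONNEGATIVE function, as the iterated
    integral over the coordinates (equal to the integral w.r.t. the
    n-dimensional Lebesgue measure by Tonelli). For n = 0, R^0 is a point. *)
Fixpoint Rn_integral (n : nat) : ('rV[R]_n -> \bar R) -> \bar R :=
  match n with
  | 0 => fun f => f 0
  | m.+1 => fun f =>
      (\int[mu]_(t in [set: R]) Rn_integral (fun v : 'rV[R]_m => f (rcons_row t v)))%E
  end.

Definition Gamma (x : R) : R :=
  fine (\int[mu]_(t in [set t : R | (0 < t)%R]) ((t `^ (x - 1)) * expR (- t))%R%:E)%E.

(** omega_{d-2} = |S^{d-2}| = 2 pi^((d-1)/2) / Gamma((d-1)/2), for d >= 2. *)
Definition omega (d : nat) : R :=
  2 * pi `^ ((d%:R - 1) / 2) / Gamma ((d%:R - 1) / 2).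

Definition Phi (d : nat) (s p t : R) : \bar R :=
  match d with
  | 1%N => ((1 - t) `^ (-1 - s * p) + (1 + t) `^ (-1 - s * p))%R%:E
  | _ => ((omega d)%:E *
          \int[mu]_(r in `[(-1)%R, 1%R]%classic)
            ((1 - r ^+ 2) `^ ((d%:R - 3) / 2)
              / (1 - 2 * t * r + t ^+ 2) `^ ((d%:R + s * p) / 2))%R%:E)%E
  end.

Definition Cconst (d : nat) (s p q al be : R) : \bar R :=
  ((\int[mu]_(t in `]0%R, 1%R[%classic)
     ((t `^ (s * p - 1)
        * (t `^ (- (p / q - 1) * d%:R - p * al / q) + t `^ (- be))
        * `| 1 - t `^ ((d%:R + al + q * be / p - s * q) / q) | `^ p)%R%:E
      * Phi d s p t)) `^ (q / p))%E.

Definition Lhs (d : nat) (s p q al be : R) (u : 'rV[R]_d -> R) : \bar R :=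
  Rn_integral (fun x : 'rV[R]_d =>
    ((Rn_integral (fun y : 'rV[R]_d =>
         (`| u x - u y | `^ p / enorm (x - y) `^ (d%:R + s * p)
            * enorm y `^ be)%R%:E)) `^ (q / p)
     * (enorm x `^ al)%R%:E)%E).

Definition Rhs (d : nat) (s p q al be : R) (u : 'rV[R]_d -> R) : \bar R :=
  Rn_integral (fun x : 'rV[R]_d =>
    (`| u x | `^ q / enorm x `^ (s * q - al - q * be / p))%R%:E).

(** u in C_c^1(U) for an open set U of R^n (u extended by 0 outside U):
    all partial derivatives exist and are continuous on U, and the support
    of u is contained in a compact subset of U. *)
Definition C1c_on n (U : set 'rV[R]_n) (u : 'rV[R]_n -> R) : Prop :=
  [/\ (forall x, U x -> forall i : 'I_n, derivable u x (delta_mx 0 i)),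
      (forall (i : 'I_n) x, U x ->
         (fun y => derive u y (delta_mx 0 i)) @ x --> derive u x (delta_mx 0 i))
    & exists K : set 'rV[R]_n,
        [/\ compact K, K `<=` U & forall x, ~ K x -> u x = 0]].

End Defs.

Arguments Lhs {R} d s p q al be u.
Arguments Rhs {R} d s p q al be u.

(* Main.v *)
Require Import Defs.
From HB Require Import structures.
From mathcomp Require Import all_boot all_order all_algebra.
From mathcomp Require Import all_classical all_reals all_analysis.
From mathcomp Require Import measurable_realfun ring lra.
Set Implicit Arguments. Unset Strict Implicit. Unset Printing Implicit Defensive.
Import Order.TTheory GRing.Theory Num.Theory.
Import numFieldNormedType.Exports.
Local Open Scope classical_set_scope.
Local Open Scope ring_scope.

(** In the variables x = e^a w, the kernel |x - y|^(-d-sp), integrated over spheres, becomes a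
    convolution kernel k(tau) on the line, and the constant is D^(q/p) with
    D = int e^((d+be) tau) |1 - e^(-kap tau)|^p k(tau) dtau, kap = (d - gam)/q,
    gam = sq - al - q be/p. The function |x|^-kap formally attains equality.

    Inequality: with E = e^(-kap tau), tau = ln(|y|/|x|), the convexity of t |-> t^q gives
    |a - b|^q >= sgn(1 - E) |1 - E|^(q-1) (|a|^q - E^(1-q) |b|^q). Multiplied by |1 - E|^(p-q) and by
    the kernel, and integrated over |1 - E| > eps, the right side is the truncated D times
    int |u|^q |x|^-gam, while the left side is bounded with Hoelder by D^(1-q/p) times the double
    integral of the theorem. This only needs the right-hand integral to be finite, which is
    reached by truncating the values of u.

    Sharpness: for u(x) = |x|^-kap phi(e ln|x|), replacing phi(e (a + tau)) by phi(e a) costs an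
    error that is small compared to 1/e, the order of both sides, and leaves D^(q/p). *)

(** * Lebesgue measure on row vectors *)

(** Why the cutoff |1 - E| > eps: the integrals of |1 - E|^(p-1) against the kernel, one carrying
    |a|^q and one carrying |b|^q, may diverge at tau = 0, where k behaves like |tau|^(-1-sp); only
    their difference is controlled. The cutoff and the finiteness of int |u|^q |x|^-gam make it
    possible to cancel finite terms before eps tends to 0.

    Where the hypotheses enter: the bounds on al amount to 0 < d + be - p kap < d + sp, those on be
    to 0 < d + be < d + sp. For every exponent a in ]0, d + sp[ the function |tau|^p e^(a tau) is
    integrable against k. This one fact gives both the finiteness of D and the error bounds for
    sharpness. It is proved by returning from the line to R^d, where k unfolds into |u0 - y|^(-d-sp)
    with a unit vector u0 and an explicit singularity.

    In the sharpness part the cutoff phi couples a and tau. Its increments are dominated by a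
    product of exponentials in |a| and |tau|, so that the tau-integral is again such a moment and
    the a-integral is elementary. *)

Definition measure_rV_display : measure_display -> measure_display.
Proof. exact. Qed.

Section measurable_rV.
Context {R : realType}.
Variable n : nat.
Let coors : 'I_n -> 'rV[R]_n -> measurableTypeR R := fun i x => x 0 i.

Let rV_set0 : g_sigma_preimage coors set0.
Proof. exact: sigma_algebra0. Qed.

Let rV_setC A : g_sigma_preimage coors A -> g_sigma_preimage coors (~` A).
Proof. exact: sigma_algebraC. Qed.

Let rV_bigcup (F : _^nat) : (forall i, g_sigma_preimage coors (F i)) ->
  g_sigma_preimage coors (\bigcup_i (F i)).
Proof. exact: sigma_algebra_bigcup. Qed.

HB.instance Definition _ := @isMeasurable.Build (measure_rV_display default_measure_display)
  'rV[R]_n (g_sigma_preimage coors) rV_set0 rV_setC rV_bigcup.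

End measurable_rV.

Section measurable_rV_lemmas.
Context {R : realType}.

Lemma measurable_coord n (i : 'I_n) :
  measurable_fun [set: 'rV[R]_n] (fun x : 'rV[R]_n => x 0 i).
Proof.
move=> _ Y mY; rewrite setTI; apply: sub_sigma_algebra => /=.
rewrite -bigcup_seq/=; exists i => /=; first by rewrite mem_index_enum.
by exists Y => //; rewrite setTI.
Qed.

Lemma measurable_fun_coordP d (T : measurableType d) n (f : T -> 'rV[R]_n) :
  (forall i, measurable_fun setT (fun x => f x 0 i)) ->
  measurable_fun setT f.
Proof.
move=> mf _ /= A mA; rewrite setTI.
suff: g_sigma_preimage (fun i x => f x 0 i : measurableTypeR R) `<=` measurable.
  apply; rewrite (_ : (fun i x => _) = (fun i => (fun x : 'rV_n => x 0 i) \o f))//.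
  by rewrite g_sigma_preimage_comp; exists A => //; rewrite setTI.
apply: smallest_sub; first exact: sigma_algebra_measurable.
case: n => [|n] in f mf A mA *; first by rewrite big_ord0.
rewrite -bigcup_mkord_ord; apply: bigcup_sub => i Ii.
by move=> B [C mC <-]; exact: mf.
Qed.

Lemma measurable_rcons_row d (T : measurableType d) n (f : T -> R) (g : T -> 'rV[R]_n) :
  measurable_fun setT f -> measurable_fun setT g ->
  measurable_fun setT (fun x => rcons_row (f x) (g x)).
Proof.
move=> mf mg; apply: measurable_fun_coordP => i.
case: (unliftP ord0 i) => [j ->|->].
  rewrite (_ : (fun x => _) = (fun x => g x 0 j)); last first.
    by apply/funext => x; rewrite mxE liftK.
  exact: (measurableT_comp (measurable_coord j)).
rewrite (_ : (fun x => _) = f)//.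
by apply/funext => x; rewrite mxE unlift_none.
Qed.

Definition head_row n (x : 'rV[R]_n.+1) : R := x 0 ord0.
Definition tail_row n (x : 'rV[R]_n.+1) : 'rV[R]_n := \row_(i < n) x 0 (lift ord0 i).

Lemma rcons_rowK n (x : 'rV[R]_n.+1) : rcons_row (head_row x) (tail_row x) = x.
Proof.
apply/rowP => i; rewrite mxE; case: unliftP => [j ->|->//].
by rewrite mxE.
Qed.

Lemma rcons_row0 n t (v : 'rV[R]_n) : rcons_row t v 0 ord0 = t.
Proof. by rewrite mxE unlift_none. Qed.

Lemma rcons_rowS n t (v : 'rV[R]_n) j : rcons_row t v 0 (lift ord0 j) = v 0 j.
Proof. by rewrite mxE liftK. Qed.

Lemma head_rcons n t (v : 'rV[R]_n) : head_row (rcons_row t v) = t.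
Proof. exact: rcons_row0. Qed.

Lemma tail_rcons n t (v : 'rV[R]_n) : tail_row (rcons_row t v) = v.
Proof. by apply/rowP => i; rewrite mxE rcons_rowS. Qed.

Lemma measurable_head_row n : measurable_fun setT (@head_row n).
Proof. exact: measurable_coord. Qed.

Lemma measurable_tail_row n : measurable_fun setT (@tail_row n).
Proof.
apply: measurable_fun_coordP => i.
rewrite (_ : (fun x => _) = (fun x : 'rV_n.+1 => x 0 (lift ord0 i))).
  exact: measurable_coord.
by apply/funext => x; rewrite mxE.
Qed.

End measurable_rV_lemmas.

Section measure_step.
Context {R : realType} (n : nat).
Variable m : {sigma_finite_measure set 'rV[R]_n -> \bar R}.
Local Open Scope ereal_scope.

Let rc (p : measurableTypeR R * 'rV[R]_n) : 'rV[R]_n.+1 := rcons_row p.1 p.2.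

Lemma measurable_rc : measurable_fun setT rc.
Proof. exact: measurable_rcons_row. Qed.

(** Peeling off the first coordinate is the recursion of [Rn_integral], so integrals against this
    measure unfold in the same way. *)
Definition rV_step := pushforward (@lebesgue_measure R \x m) rc.

Let rV_step0 : rV_step set0 = 0.
Proof. by rewrite /rV_step /pushforward preimage_set0 measure0. Qed.

Let rV_step_ge0 A : 0 <= rV_step A.
Proof. by rewrite /rV_step /pushforward measure_ge0. Qed.

Let rV_step_sigma_additive : semi_sigma_additive rV_step.
Proof.
exact: (@measure_semi_sigma_additive _ _ _
  (measure_function_pushforward__canonical__measure_function_Measure _ measurable_rc)).
Qed.

HB.instance Definition _ := isMeasure.Build _ _ _ rV_step
  rV_step0 rV_step_ge0 rV_step_sigma_additive.

Let sf : sigma_finite setT rV_step.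
Proof.
have /sigma_finiteP[F [TF ndF Foo]] := sigma_finiteT (@lebesgue_measure R).
have /sigma_finiteP[G [TG ndG Goo]] := sigma_finiteT m.
exists (fun k => (fun x => (head_row x : measurableTypeR R, tail_row x)) @^-1`
                 (F k `*` G k)).
  rewrite -preimage_bigcup; apply/esym; rewrite -subTset => x _.
  have [i _ Fi] : (\bigcup_k F k) (head_row x) by rewrite -TF.
  have [j _ Gj] : (\bigcup_k G k) (tail_row x) by rewrite -TG.
  exists (maxn i j) => //; split=> /=.
    by apply: (subsetPset _ _ (ndF _ _ (leq_maxl i j))).
  by apply: (subsetPset _ _ (ndG _ _ (leq_maxr i j))).
move=> k; have [mF oF] := Foo k; have [mG oG] := Goo k; split.
  have mp : measurable_fun setT
      (fun x : 'rV[R]_n.+1 => (head_row x : measurableTypeR R, tail_row x)).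
    by apply: measurable_fun_pair;
      [exact: measurable_head_row|exact: measurable_tail_row].
  by rewrite -[X in measurable X]setTI; apply: mp => //; exact: measurableX.
rewrite /rV_step /pushforward.
rewrite (_ : rc @^-1` _ = F k `*` G k); last first.
  by apply/funext => -[a b]; rewrite /preimage/= /rc/= head_rcons tail_rcons.
by rewrite product_measure1E// lte_mul_pinfty// ge0_fin_numE.
Qed.

HB.instance Definition _ := @Measure_isSigmaFinite.Build _ _ _ rV_step sf.

Definition rV_step_measure : {sigma_finite_measure set 'rV[R]_n.+1 -> \bar R} := rV_step.

Lemma integral_rV_step (f : 'rV[R]_n.+1 -> \bar R) : measurable_fun setT f ->
  (forall x, 0 <= f x) ->
  \int[rV_step_measure]_x f x =
  \int[@lebesgue_measure R]_t \int[m]_v f (rcons_row t v).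
Proof.
move=> mf f0; rewrite ge0_integral_pushforward//=; last exact: measurable_rc.
rewrite preimage_setT fubini_tonelli1//.
by apply: measurableT_comp => //; exact: measurable_rc.
Qed.

End measure_step.

Section rV_measure.
Context {R : realType}.
Local Open Scope ereal_scope.

(** A genuine measure behind the iterated integral [Rn_integral]. Its sigma-finiteness gives
    Tonelli's theorem for pairs of points of R^n. *)
Fixpoint mun n : {sigma_finite_measure set 'rV[R]_n -> \bar R} :=
  match n with
  | 0 => [the {sigma_finite_measure set _ -> \bar R} of dirac (0%R : 'rV[R]_0)]
  | k.+1 => rV_step_measure (mun k)
  end.

Lemma integral_mun0 (f : 'rV[R]_0 -> \bar R) : \int[mun 0]_v f v = f 0%R.
Proof.
rewrite (_ : f = cst (f 0%R)); last by apply/funext => v; rewrite /= (thinmx0 v).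
by rewrite integral_dirac// diracT mul1e.
Qed.

Lemma Rn_integralE n (f : 'rV[R]_n -> \bar R) : measurable_fun setT f ->
  (forall x, 0 <= f x) -> Rn_integral f = \int[mun n]_x f x.
Proof.
elim: n f => [|n ih] f mf f0 /=.
  by rewrite integral_mun0.
rewrite integral_rV_step//; apply: eq_integral => t _.
by rewrite ih//; apply: measurableT_comp => //; exact: measurable_rcons_row.
Qed.

Lemma integral_munS n (f : 'rV[R]_n.+1 -> \bar R) : measurable_fun setT f ->
  (forall x, 0 <= f x) ->
  \int[mun n.+1]_x f x = \int[@lebesgue_measure R]_t \int[mun n]_v f (rcons_row t v).
Proof. exact: integral_rV_step. Qed.

End rV_measure.

(** * Measurability and positivity by syntax; integrals over whole spaces *)

Section measurability.
Context {R : realType} d (T : measurableType d).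

Lemma measurable_bool_natr (b : T -> bool) : measurable_fun setT b ->
  measurable_fun setT (fun x => (b x)%:R : R).
Proof.
move=> mb.
rewrite (_ : (fun x => _) = (fun x => if b x then 1 else 0 : R)).
  by apply: measurable_fun_ifT => //; exact: measurable_cst.
by apply/funext => x; case: (b x).
Qed.

(** 1/z = z |z|^-2 reduces the inverse to [powR]; at z = 0 both sides are 0 by convention. *)
Lemma measurable_funV (f : T -> R) : measurable_fun setT f ->
  measurable_fun setT (fun x => (f x)^-1).
Proof.
move=> mf; rewrite (_ : (fun x => _) = (fun x => f x * (`|f x| `^ (-2)))).
  apply: measurable_funM => //.
  apply: (@measurableT_comp _ _ _ _ _ _ (fun y => y `^ (-2)) _ (fun x => `|f x|)).
    exact: measurable_powR.
  exact: measurableT_comp.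
apply/funext => x; have [->|f0] := eqVneq (f x) 0; first by rewrite invr0 mul0r.
by rewrite powRN powR_mulrn// real_normK ?num_real// expr2 invfM mulrA divff// mul1r.
Qed.

End measurability.

Lemma measurable_sqrtr {R : realType} : measurable_fun setT (@Num.sqrt R).
Proof. by apply: continuous_measurable_fun; exact: sqrt_continuous. Qed.

Lemma measurable_fun2 d1 d2 d3 d4 (T : measurableType d1) (U : measurableType d2)
    (V : measurableType d3) (W : measurableType d4) (F : U -> V -> W) (u : T -> U) (v : T -> V) :
  measurable_fun setT (fun p => F p.1 p.2) -> measurable_fun setT u ->
  measurable_fun setT v -> measurable_fun setT (fun x => F (u x) (v x)).
Proof.
move=> mF mu mv.
apply: (@measurableT_comp _ _ _ _ _ _ (fun p => F p.1 p.2) _ (fun x => (u x, v x))) => //.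
exact: measurable_fun_pair.
Qed.

Ltac meas1 := match goal with
 | |- measurable_fun _ (fun x => x) => exact: measurable_id
 | |- measurable_fun _ (fun _ => ?c) => exact: measurable_cst
 | H : measurable_fun _ ?f |- measurable_fun _ ?f => exact: H
 | |- measurable_fun _ fst => exact: measurable_fst
 | |- measurable_fun _ snd => exact: measurable_snd
 | |- measurable_fun _ (fun x => (@?f x).1) => apply: (@measurableT_comp _ _ _ _ _ _ fst _ f measurable_fst)
 | |- measurable_fun _ (fun x => (@?f x).2) => apply: (@measurableT_comp _ _ _ _ _ _ snd _ f measurable_snd)
 | H : measurable_fun _ ?f |- measurable_fun _ (fun x => ?f (@?g x)) =>
     apply: (@measurableT_comp _ _ _ _ _ _ f _ g H)
 | H : measurable_fun _ (fun p => ?F (fst p) (snd p)) |- measurable_fun _ (fun x => ?F (@?u x) (@?v x)) =>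
     apply: (@measurable_fun2 _ _ _ _ _ _ _ _ F u v H)
 | |- measurable_fun _ (fun x => (@?f x, @?g x)) => apply: measurable_fun_pair
 | |- measurable_fun _ (fun x => EFin (@?f x)) => apply/measurable_EFinP
 | |- measurable_fun _ (fun x => GRing.opp (@?f x)) => apply: measurable_funN
 | |- measurable_fun _ (fun x => GRing.add (@?f x) (@?g x)) =>
     first [apply: measurable_funD | apply: emeasurable_funD]
 | |- measurable_fun _ (fun x => GRing.mul (@?f x) (@?g x)) => apply: measurable_funM
 | |- measurable_fun _ (fun x => GRing.inv (@?f x)) => apply: measurable_funV
 | |- measurable_fun _ (fun x => GRing.exp (@?f x) ?n) => apply: measurable_funX
 | |- measurable_fun _ (fun x => expR (@?f x)) => apply: (@measurableT_comp _ _ _ _ _ _ expR _ f (@measurable_expR _))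
 | |- measurable_fun _ (fun x => @Num.sqrt ?A (@?f x)) => apply: (@measurableT_comp _ _ _ _ _ _ (@Num.sqrt A) _ f measurable_sqrtr)
 | |- measurable_fun _ (fun x => ln (@?f x)) => apply: (@measurableT_comp _ _ _ _ _ _ (@ln _) _ f (@measurable_ln _))
 | |- measurable_fun _ (fun x => powR (@?f x) ?a) => apply: (@measurableT_comp _ _ _ _ _ _ (fun y => powR y a) _ f (@measurable_powR _ a))
 | |- measurable_fun _ (fun x => poweR (@?f x) ?a) => apply: (@measurableT_comp _ _ _ _ _ _ (fun y => poweR y a) _ f (@measurable_poweR _ a))
 | |- measurable_fun _ (fun x => @Num.norm ?A ?B (@?f x)) => apply: (@measurableT_comp _ _ _ _ _ _ (@Num.norm A B) _ f (@normr_measurable _ _))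
 | |- measurable_fun _ (fun x => (nat_of_bool (@?b x))%:R) => apply: measurable_bool_natr
 | |- measurable_fun _ (fun x => (@?f x < @?g x)%R) => apply: measurable_fun_ltr
 | |- measurable_fun _ (fun x => (@?f x <= @?g x)%R) => apply: measurable_fun_ler
 | |- measurable_fun _ (fun x => @?f x && @?g x) => apply: measurable_and
 | |- measurable_fun _ (fun x => mule (@?f x) (@?g x)) => apply: emeasurable_funM
 | |- measurable_fun ?D (?g ?a) => change (measurable_fun D (fun x => g a x))
 end.
Ltac meas := repeat meas1.

Ltac pos1 := cbv beta; match goal with
 | H : is_true ?P |- is_true ?P => exact: H
 | H : is_true (@Order.lt _ _ _ ?x) |- is_true (@Order.le _ _ _ ?x) => exact: ltW
 | |- forall _, _ => intro
 | H : forall x, is_true (@Order.le _ _ _ (?f x)) |- is_true (@Order.le _ _ _ (?f _)) => exact: H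
 | H : forall x y, is_true (@Order.le _ _ _ (?f x y)) |- is_true (@Order.le _ _ _ (?f _ _)) => exact: H
 | |- is_true (@Order.le _ _ _ (@mule _ _ _)) => apply: mule_ge0
 | |- is_true (@Order.le _ _ _ (EFin _)) => rewrite lee_fin
 | |- is_true (@Order.le _ _ _ (@poweR _ _ _)) => exact: poweR_ge0
 | |- is_true (@Order.le _ _ _ (@integral _ _ _ _ _ _)) => apply: integral_ge0
 | |- is_true (@Order.le _ _ _ (@GRing.add _ _ _)) => first [apply: addr_ge0 | apply: adde_ge0]
 | |- is_true (@Order.le _ _ _ (@GRing.mul _ _ _)) => apply: mulr_ge0
 | |- is_true (@Order.le _ _ _ (@expR _ _)) => exact: expR_ge0
 | |- is_true (@Order.le _ _ _ (@powR _ _ _)) => exact: powR_ge0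
 | |- is_true (@Order.le _ _ _ (@GRing.natmul _ _ _)) => exact: ler0n
 | |- is_true (@Order.le _ _ _ (@Num.norm _ _ _)) => exact: normr_ge0
 | |- is_true (@Order.le _ _ _ (@GRing.inv _ _)) => rewrite invr_ge0
 | |- is_true (@Order.le _ _ _ _) => done
 | |- is_true true => exact: isT
 | |- measurable _ => done
 end.
Ltac pos := repeat pos1.
Ltac side_rec := match goal with
 | |- measurable_fun _ _ => solve [meas]
 | |- is_true _ => solve [pos]
 | |- measurable _ => done
 | |- forall _, _ => solve [pos | intro; side_rec]
 end.
Ltac side := try side_rec.

Section integral_setT.
Context d d' (T : measurableType d) (T' : measurableType d') {R : realType}.
Local Open Scope ereal_scope.

Lemma integralTZl (mu : {measure set T -> \bar R}) (c : \bar R) (f : T -> \bar R) :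
  measurable_fun setT f -> (forall x, 0 <= f x) -> 0 <= c ->
  \int[mu]_x (c * f x) = c * \int[mu]_x f x.
Proof. by move=> mf f0 c0; exact: ge0_integralZl. Qed.

Lemma integralTZr (mu : {measure set T -> \bar R}) (c : \bar R) (f : T -> \bar R) :
  measurable_fun setT f -> (forall x, 0 <= f x) -> 0 <= c ->
  \int[mu]_x (f x * c) = \int[mu]_x f x * c.
Proof. by move=> mf f0 c0; exact: ge0_integralZr. Qed.

Lemma integralTD (mu : {measure set T -> \bar R}) (f g : T -> \bar R) :
  measurable_fun setT f -> (forall x, 0 <= f x) ->
  measurable_fun setT g -> (forall x, 0 <= g x) ->
  \int[mu]_x (f x + g x) = \int[mu]_x f x + \int[mu]_x g x.
Proof. by move=> mf f0 mg g0; exact: ge0_integralD. Qed.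

Lemma integralT_le (mu : {measure set T -> \bar R}) (f g : T -> \bar R) :
  (forall x, 0 <= f x) -> measurable_fun setT f -> measurable_fun setT g ->
  (forall x, f x <= g x) -> \int[mu]_x f x <= \int[mu]_x g x.
Proof. by move=> f0 mf mg fg; apply: ge0_le_integral. Qed.

Lemma integralT_swap (mu : {sigma_finite_measure set T -> \bar R})
    (mu' : {sigma_finite_measure set T' -> \bar R}) (f : T -> T' -> \bar R) :
  measurable_fun setT (fun p => f p.1 p.2) -> (forall x y, 0 <= f x y) ->
  \int[mu]_x \int[mu']_y f x y = \int[mu']_y \int[mu]_x f x y.
Proof.
move=> mf f0; apply: (fubini_tonelli (fun p => f p.1 p.2)) => //.
Qed.

Lemma measurable_integral_snd (mu' : {sigma_finite_measure set T' -> \bar R})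
    (f : T -> T' -> \bar R) :
  measurable_fun setT (fun p => f p.1 p.2) -> (forall x y, 0 <= f x y) ->
  measurable_fun setT (fun x => \int[mu']_y f x y).
Proof.
move=> mf f0; apply: (measurable_fun_fubini_tonelli_F (fun p => f p.1 p.2)) => //.
Qed.

End integral_setT.

(** * Changes of variables *)

Section one_dimensional_substitutions.
Context {R : realType}.
Local Notation mu := (@lebesgue_measure R).
Local Open Scope ereal_scope.
Implicit Types f : R -> \bar R.

(** The image measure gives half-open intervals their length, hence is Lebesgue measure by
    uniqueness. [integral_pscale] follows the same pattern. *)
Lemma integral_shift f (a : R) : measurable_fun setT f -> (forall x, 0 <= f x) ->
  \int[mu]_x f (x + a)%R = \int[mu]_x f x.
Proof.
move=> mf f0.
have ms : measurable_fun setT (fun x : measurableTypeR R => (x + a)%R : measurableTypeR R).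
  by meas.
rewrite -[LHS]/(\int[mu]_(x in (fun x => (x + a)%R) @^-1` setT) (f \o (fun x => (x + a)%R)) x).
rewrite -(ge0_integral_pushforward ms mu)//.
apply: eq_measure_integral => A mA _; apply/esym.
apply: (@lebesgue_measure_unique _ (measure_function_pushforward__canonical__measure_function_Measure mu ms)) => //.
move=> _ [[b c]] _ <-; rewrite /= /pushforward.
rewrite (_ : _ @^-1` _ = `](b - a)%R, (c - a)%R]%classic); last first.
  by apply/seteqP; split=> x; rewrite /preimage/= !in_itv/=; lra.
rewrite !lebesgue_measure_itv/= !lte_fin ltrD2r.
by case: ifP => // _; rewrite -!EFinB opprB addrA subrK.
Qed.

Lemma integral_oppr f : measurable_fun setT f -> (forall x, 0 <= f x) ->
  \int[mu]_x f (- x)%R = \int[mu]_x f x.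
Proof.
move=> mf f0.
have ms : measurable_fun setT (fun x : measurableTypeR R => (- x)%R : measurableTypeR R).
  by meas.
rewrite -[LHS]/(\int[mu]_(x in -%R @^-1` setT) (f \o -%R) x).
rewrite -(ge0_integral_pushforward ms mu)//.
by apply: eq_measure_integral => A mA _; exact: lebesgue_measureN.
Qed.

Lemma integral_pscale f (c : R) : (0 < c)%R -> measurable_fun setT f -> (forall x, 0 <= f x) ->
  \int[mu]_x f (c * x)%R = (c^-1)%:E * \int[mu]_x f x.
Proof.
move=> c0 mf f0.
have ci : (0 <= c)%R by exact: ltW.
have ms : measurable_fun setT (fun x : measurableTypeR R => (c * x)%R : measurableTypeR R).
  by meas.
suff -> : \int[mu]_x f x = c%:E * \int[mu]_x f (c * x)%R.
  by rewrite muleA -EFinM mulVf ?gt_eqF// mul1e.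
pose nu := measure_function_pushforward__canonical__measure_function_Measure mu ms.
have -> : \int[mu]_x f (c * x)%R = \int[nu]_x f x.
  rewrite -[LHS]/(\int[mu]_(x in (fun x => (c * x)%R) @^-1` setT) (f \o (fun x => (c * x)%R)) x).
  by rewrite -(ge0_integral_pushforward ms mu).
rewrite -[c%:E]/((NngNum ci)%:num%:E) -ge0_integral_mscale//.
apply: eq_measure_integral => A mA _.
apply: (@lebesgue_measure_unique _ (mscale (NngNum ci) nu)) => //.
move=> _ [[a b]] _ <-; rewrite /= /mscale/= /pushforward.
rewrite (_ : _ @^-1` _ = `](a / c)%R, (b / c)%R]%classic); last first.
  by apply/seteqP; split=> x; rewrite /preimage/= !in_itv/= ltr_pdivrMr// ler_pdivlMr// mulrC.
rewrite !lebesgue_measure_itv/= !lte_fin ltr_pM2r ?invr_gt0//.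
case: ifP => // _; last by rewrite mule0.
by rewrite -!EFinB -EFinM -mulrBl mulrCA divff ?gt_eqF// mulr1.
Qed.

Lemma integral_scale f (c : R) : (c != 0)%R -> measurable_fun setT f -> (forall x, 0 <= f x) ->
  \int[mu]_x f (c * x)%R = (`|c|^-1)%:E * \int[mu]_x f x.
Proof.
move=> c0 mf f0; have [cp|cn|/eqP] := ltgtP c 0%R; last by rewrite (negbTE c0).
- rewrite ltr0_norm// -(integral_oppr mf f0) -integral_pscale ?oppr_gt0//; last by meas.
  by apply: eq_integral => x _; rewrite mulNr opprK.
- by rewrite gtr0_norm// integral_pscale.
Qed.

End one_dimensional_substitutions.

Section exponential_substitution.
Context {R : realType}.
Local Notation mu := (@lebesgue_measure R).
Local Open Scope ereal_scope.

Lemma integral_expR01 :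
  \int[mu]_t (expR t * ((0 <= t) && (t <= 1))%:R)%:E = (expR 1 - 1)%:E :> \bar R.
Proof.
transitivity (\int[mu]_(t in `[0%R, 1%R]) (expR t)%:E).
  rewrite [RHS]integral_mkcond; apply: eq_integral => t _.
  rewrite patchE mem_setE in_itv/=; case: ifP => _; first by rewrite mulr1.
  by rewrite mulr0.
rewrite (@continuous_FTC2 _ _ expR)//.
- by rewrite expR0 EFinB.
- by apply: continuous_subspaceT => x; exact: continuous_expR.
- split; first by move=> x _; exact: derivable_expR.
  + by apply: cvg_at_right_filter; exact: continuous_expR.
  + by apply: cvg_at_left_filter; exact: continuous_expR.
- by move=> x _; rewrite derive1E derive_val.
Qed.

(* Integrating f(t e^s) t over s in R and t in [1, e] in both orders gives, up to the
   factor e - 1, the two sides: no differentiable change of variables is needed. *)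
Lemma integral_expR (f : R -> \bar R) : measurable_fun setT f -> (forall x, 0 <= f x) ->
  \int[mu]_t (f t * (0 < t)%R%:R%:E) = \int[mu]_t (f (expR t) * (expR t)%:E).
Proof.
move=> mf f0.
pose k (p : R * R) : \bar R := f (p.1 * expR p.2)%R * (p.1 * expR p.2)%:E
  * ((1 <= p.1) && (p.1 <= expR 1))%R%:R%:E.
pose l (p : R * R) : \bar R :=
  f p.2 * (expR (- p.1) * `|p.2| * ((1 <= expR (- p.1) * p.2) && (expR (- p.1) * p.2 <= expR 1))%R%:R)%:E.
have e1 : (0 < expR 1 - 1 :> R)%R by rewrite subr_gt0 expR_gt1.
have mk : measurable_fun setT k. rewrite /k; meas.
have ml : measurable_fun setT l. rewrite /l; meas.
have k0 p : 0 <= k p.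
  rewrite /k; case: (boolP (_ && _)) => [/andP[h _]|_]; last by rewrite mule0.
  rewrite mule1 mule_ge0// lee_fin mulr_ge0 ?expR_ge0//.
  exact: le_trans h.
have l0 p : 0 <= l p by rewrite /l mule_ge0// lee_fin !mulr_ge0 ?expR_ge0.
have mB : measurable_fun setT (fun t => f (expR t) * (expR t)%:E) by meas.
have B0 t : 0 <= f (expR t) * (expR t)%:E by rewrite mule_ge0// lee_fin expR_ge0.
(* For fixed t in [1, e] the shift of s by ln t removes t from the integrand; the integral over t is
   then the length e - 1. *)
have E1 : \int[mu]_t \int[mu]_s k (t, s) =
    (expR 1 - 1)%:E * \int[mu]_t (f (expR t) * (expR t)%:E).
  transitivity (\int[mu]_t ((\int[mu]_t (f (expR t) * (expR t)%:E)) *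
      ((1 <= t) && (t <= expR 1))%R%:R%:E)).
    apply: eq_integral => t _; rewrite /k/=.
    case: (boolP (_ && _)) => [/andP[h _]|_]; last first.
      by rewrite mule0; under eq_integral do rewrite mule0; rewrite integral0.
    have t0 : (0 < t)%R by exact: lt_le_trans h.
    rewrite mule1 -(integral_shift (ln t) mB B0); apply: eq_integral => s _.
    by rewrite expRD lnK ?posrE// mule1 mulrC.
  rewrite integralTZl; side.
  rewrite muleC; congr (_ * _).
  transitivity (\int[mu]_(t in `[1%R, expR 1]) (1%:E : \bar R)).
    rewrite [RHS]integral_mkcond; apply: eq_integral => t _.
    by rewrite patchE mem_setE in_itv/=; case: ifP.
  rewrite integral_cst//= mul1e lebesgue_measure_itv/= lte_fin.
  by rewrite expR_gt1 ltr01.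
have E2 : \int[mu]_t \int[mu]_s k (t, s) = \int[mu]_s \int[mu]_t l (s, t).
  transitivity (\int[mu]_s \int[mu]_t k (t, s)); first by apply: integralT_swap; side.
  apply: eq_integral => s _.
  have es : (0 < expR s)%R by exact: expR_gt0.
  pose g t := l (s, t) * (expR s)%:E.
  have mg : measurable_fun setT g by rewrite /g /l /=; meas.
  have g0 t : 0 <= g t by rewrite /g mule_ge0// lee_fin expR_ge0.
  transitivity (\int[mu]_t g (expR s * t)%R).
    apply: eq_integral => t _; rewrite /g /k /l /= mulrA.
    rewrite -expRD addNr expR0 mul1r.
    case: (boolP (_ && _)) => [/andP[h _]|_]; last by rewrite !(mulr0,mule0) mul0e.
    rewrite !mule1 mulr1 -muleA -EFinM ger0_norm; last first.
      by rewrite mulr_ge0 ?expR_ge0// (le_trans _ h).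
    rewrite mulrAC mulrA -expRD addNr expR0 mul1r.
    by rewrite [(t * _)%R]mulrC.
  rewrite (integral_pscale es mg g0) /g integralTZr; side.
  by rewrite muleCA -EFinM mulVf ?mule1// gt_eqF.
(* For fixed t > 0 the reflection s -> ln t - s turns the inner integral into that of e^s over
   [0, 1], which is again e - 1. *)
have E3 : \int[mu]_s \int[mu]_t l (s, t) =
   (expR 1 - 1)%:E * \int[mu]_t (f t * (0 < t)%R%:R%:E).
  transitivity (\int[mu]_t \int[mu]_s l (s, t)); first by apply: integralT_swap; side.
  rewrite -integralTZl; side.
  apply: eq_integral => t _; rewrite /l/=.
  have [t0|t0] := ltP 0%R t; last first.
    rewrite mule0 mule0; under eq_integral => s _.
      rewrite (_ : (1 <= _)%R = false) ?mulr0 ?mule0; first over.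
      apply/negbTE; rewrite -ltNge (le_lt_trans _ ltr01)//.
      by rewrite mulr_ge0_le0 ?expR_ge0.
    by rewrite integral0.
  rewrite mule1 integralTZl; side; rewrite muleC.
  congr (_ * _).
  pose h s : \bar R := (expR s * ((0 <= s) && (s <= 1))%:R)%:E.
  have mh : measurable_fun setT h by rewrite /h; meas.
  have h0 s : 0 <= h s by rewrite lee_fin mulr_ge0 ?expR_ge0.
  rewrite -integral_expR01 -[RHS](integral_shift (ln t) mh h0) -[RHS]integral_oppr//; last first.
    by rewrite /h; meas.
  apply: eq_integral => s _; rewrite /h expRD lnK ?posrE// gtr0_norm//.
  congr ((_ * _%:R)%:E).
  have -> : (expR (- s) * t = expR (- s + ln t))%R by rewrite expRD lnK ?posrE.
  by rewrite -{1}expR0 !ler_expR.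
have : (expR 1 - 1)%:E * \int[mu]_t (f t * (0 < t)%R%:R%:E) =
  (expR 1 - 1)%:E * \int[mu]_t (f (expR t) * (expR t)%:E) by rewrite -E3 -E2.
move/(congr1 (fun z => ((expR 1 - 1)^-1)%:E * z)).
by rewrite !muleA -EFinM mulVf ?gt_eqF// !mul1e.
Qed.

End exponential_substitution.

Section affine_substitutions.
Context {R : realType}.
Local Notation mu := (@lebesgue_measure R).
Local Open Scope ereal_scope.

Lemma integral_affine (f : R -> \bar R) (c a : R) : (c != 0)%R ->
  measurable_fun setT f -> (forall x, 0 <= f x) ->
  \int[mu]_x f (c * x + a)%R = (`|c|^-1)%:E * \int[mu]_x f x.
Proof.
move=> c0 mf f0; rewrite (@integral_scale _ (fun y => f (y + a)%R)); side => //.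
by rewrite integral_shift.
Qed.

(** The rotation (z, t) -> (c z + s t, c t - s z) with (c, s) = (a, b) / rho is factored into two
    affine changes of a single variable, one at fixed t and one at fixed z, whose factors |c|^-1 and
    |c| cancel. This divides by c, so a = 0 is treated apart, by exchanging the two coordinates. *)
Lemma integral_plane_rotation (G : R -> R -> \bar R) (a b : R) :
  measurable_fun setT (fun p => G p.1 p.2) -> (forall w z, 0 <= G w z) ->
  \int[mu]_s \int[mu]_t G (s ^+ 2 + t ^+ 2)%R (a * s + b * t)%R =
  \int[mu]_s \int[mu]_t G (s ^+ 2 + t ^+ 2)%R (Num.sqrt (a ^+ 2 + b ^+ 2) * s)%R.
Proof.
move=> mG G0.
have mI (u : R -> R) : measurable_fun setT u -> measurable_fun setT
    (fun s : R => \int[mu]_t G (s ^+ 2 + t ^+ 2)%R (u s)).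
  move=> mu'; apply: (@measurable_integral_snd _ _ _ _ _ mu (fun s t : R => G (s ^+ 2 + t ^+ 2)%R (u s))); side.
have I0 (u : R -> R) s : 0 <= \int[mu]_t G (s ^+ 2 + t ^+ 2)%R (u s).
  by pos.
have flip (c : R) : \int[mu]_s \int[mu]_t G (s ^+ 2 + t ^+ 2)%R (c * s)%R =
    \int[mu]_s \int[mu]_t G (s ^+ 2 + t ^+ 2)%R (`|c| * s)%R.
  case: (ger0P c) => [_|c0]; first by [].
  rewrite -[RHS]integral_oppr; [|by apply: mI; meas|by move=> ?; exact: I0].
  by apply: eq_integral => s _; apply: eq_integral => t _; rewrite sqrrN mulrNN.
have [->|a0] := eqVneq a 0%R.
  rewrite expr0n/= add0r sqrtr_sqr -flip.
  transitivity (\int[mu]_t \int[mu]_s G (s ^+ 2 + t ^+ 2)%R (0 * s + b * t)%R).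
    by apply: integralT_swap; side.
  by apply: eq_integral => s _; apply: eq_integral => t _; rewrite mul0r add0r addrC.
set rho := Num.sqrt _.
have rho2 : (rho ^+ 2 = a ^+ 2 + b ^+ 2)%R by rewrite sqr_sqrtr// addr_ge0 ?sqr_ge0.
have rho0 : (0 < rho)%R.
  by rewrite sqrtr_gt0 ltr_pwDl ?sqr_ge0// exprn_even_gt0.
have rhoN : (rho != 0)%R by rewrite gt_eqF.
pose c := (a / rho)%R; pose s := (b / rho)%R.
have c0 : (c != 0)%R by rewrite mulf_neq0// invr_neq0.
have cs : (c ^+ 2 + s ^+ 2 = 1)%R.
  by rewrite /c /s !expr_div_n -mulrDl -rho2 divff// expf_neq0.
pose K t z := G (z ^+ 2 + (c^-1 * t + (- s * z / c)) ^+ 2)%R (rho * z)%R.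
transitivity (\int[mu]_t \int[mu]_z G (z ^+ 2 + t ^+ 2)%R (a * z + b * t)%R).
  by apply: integralT_swap; side.
transitivity (\int[mu]_t ((`|c|^-1)%:E * \int[mu]_z K t z)).
  apply: eq_integral => t _; rewrite -(@integral_affine (K t) c (s * t)%R)//.
  - apply: eq_integral => z _; rewrite /K; congr G; last first.
      by rewrite /c /s; field.
    apply/eqP; rewrite -subr_eq0; apply/eqP.
    have -> : (c^-1 * t + - s * (c * z + s * t) / c = (1 - s ^+ 2) / c * t - s * z)%R by field.
    have -> : (1 - s ^+ 2 = c ^+ 2)%R by rewrite -cs addrK.
    have -> : (c ^+ 2 / c * t - s * z = c * t - s * z)%R by field.
    have -> : (z ^+ 2 + t ^+ 2 - ((c * z + s * t) ^+ 2 + (c * t - s * z) ^+ 2) =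
      (1 - (c ^+ 2 + s ^+ 2)) * (z ^+ 2 + t ^+ 2))%R by ring.
    by rewrite cs subrr mul0r.
  - by rewrite /K; meas.
  - by rewrite /K; pos.
rewrite integralTZl; last 3 first.
- by apply: (@measurable_integral_snd _ _ _ _ _ mu K); rewrite /K; side.
- by rewrite /K; pos.
- by pos.
transitivity ((`|c|^-1)%:E * \int[mu]_z \int[mu]_t K t z).
  congr (_ * _); by rewrite /K; apply: integralT_swap; side.
rewrite -integralTZl; last 3 first.
- apply: (@measurable_integral_snd _ _ _ _ _ mu (fun z t => K t z)).
    by rewrite /K; meas.
  by rewrite /K; pos.
- by rewrite /K; pos.
- by pos.
apply: eq_integral => z _; rewrite /K.
rewrite (@integral_affine (fun y => G (z ^+ 2 + y ^+ 2)%R (rho * z)%R)) ?invr_neq0//.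
- by rewrite muleA -EFinM normfV invrK mulVf ?mul1e// normr_eq0.
- by meas.
Qed.

End affine_substitutions.

(** * Polar and bipolar coordinates *)

Section euclidean.
Context {R : realType}.
Local Notation mu := (@lebesgue_measure R).
Local Open Scope ereal_scope.

Definition sqn n (x : 'rV[R]_n) : R := \sum_(i < n) x 0 i ^+ 2.
Definition dotp n (x y : 'rV[R]_n) : R := \sum_(i < n) x 0 i * y 0 i.

Lemma sqn_rcons n t (v : 'rV[R]_n) : sqn (rcons_row t v) = (t ^+ 2 + sqn v)%R.
Proof.
rewrite /sqn big_ord_recl rcons_row0; congr (_ + _)%R.
by apply: eq_bigr => i _; rewrite rcons_rowS.
Qed.

Lemma dotp_rcons n t (v : 'rV[R]_n) s w :
  dotp (rcons_row t v) (rcons_row s w) = (t * s + dotp v w)%R.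
Proof.
rewrite /dotp big_ord_recl !rcons_row0; congr (_ + _)%R.
by apply: eq_bigr => i _; rewrite !rcons_rowS.
Qed.

Lemma sqn_ge0 n (x : 'rV[R]_n) : (0 <= sqn x)%R.
Proof. by apply: sumr_ge0 => i _; exact: sqr_ge0. Qed.

Lemma measurable_sqn n : measurable_fun setT (@sqn n).
Proof.
apply: measurable_sum => i.
by apply: measurable_funX; exact: measurable_coord.
Qed.

Lemma measurable_dotp n (x : 'rV[R]_n) : measurable_fun setT (dotp x).
Proof.
apply: measurable_sum => i.
by apply: measurable_funM => //; exact: measurable_coord.
Qed.

(* A function of |y| and x.y may be integrated as if x pointed along the first axis. By
   induction on the dimension: the tail of x is first aligned, then a plane rotation is used. *)
Lemma integral_mun_rotation n (x : 'rV[R]_n.+1) (F : R -> R -> \bar R) :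
  measurable_fun setT (fun p => F p.1 p.2) -> (forall w z, 0 <= F w z) ->
  \int[mun n.+1]_y F (sqn y) (dotp x y) =
  \int[mun n.+1]_y F (sqn y) (Num.sqrt (sqn x) * y 0%R ord0)%R.
Proof.
elim: n x F => [|n ih] x F mF F0.
  have m1 (c : R) : measurable_fun setT (fun y : 'rV[R]_1 => F (sqn y) (c * y 0%R ord0)%R).
    apply: (measurable_fun2 mF); first exact: measurable_sqn.
    by apply: measurable_funM => //; exact: measurable_coord.
  have sx : sqn x = (x 0 ord0 ^+ 2)%R by rewrite /sqn big_ord1.
  have E (y : 'rV[R]_1) : dotp x y = (x 0 ord0 * y 0 ord0)%R by rewrite /dotp big_ord1.
  under eq_integral do rewrite E.
  rewrite sx sqrtr_sqr; case: (ger0P (x 0%R ord0)) => [//|x0].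
  rewrite (integral_munS (m1 (x 0%R ord0)) (fun y => F0 _ _)) (integral_munS (m1 (- x 0%R ord0)%R) (fun y => F0 _ _)).
  pose g t := \int[mun 0]_v F (sqn (rcons_row t v)) (- x 0%R ord0 * rcons_row t v 0%R ord0)%R.
  rewrite -[RHS](@integral_oppr _ g); last 2 first.
  - apply: measurable_integral_snd => //.
    apply: (measurable_fun2 mF).
      by apply: (measurableT_comp (@measurable_sqn _)); apply: measurable_rcons_row; meas.
    apply: measurable_funM => //; apply: (measurableT_comp (@measurable_coord _ _ _)).
    by apply: measurable_rcons_row; meas.
  - by move=> t; apply: integral_ge0 => *; exact: F0.
  apply: eq_integral => t _; apply: eq_integral => v _.
  by rewrite !sqn_rcons !rcons_row0 sqrrN mulrNN.
rewrite integral_munS; last 2 first.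
- by apply: (measurable_fun2 mF); [exact: measurable_sqn|exact: measurable_dotp].
- by move=> *; exact: F0.
rewrite -(rcons_rowK x); set x0 := head_row x; set x' := tail_row x.
have mr d (T : measurableType d) k (g : T -> R) (h : T -> 'rV[R]_k) :
    measurable_fun setT g -> measurable_fun setT h ->
    measurable_fun setT (fun p => (g p ^+ 2 + sqn (h p))%R).
  move=> mg mh; apply: measurable_funD; first by meas.
  exact: (measurableT_comp (@measurable_sqn _)).
(* Integrates out all coordinates but two, which leaves a problem in the plane. *)
pose G w z := \int[mun n]_v F (w + sqn v)%R z.
have G0 w z : 0 <= G w z by apply: integral_ge0 => *; exact: F0.
have mG : measurable_fun setT (fun p => G p.1 p.2).
  apply: (@measurable_integral_snd _ _ _ _ _ (mun n) (fun (p : R * R) v => F (p.1 + sqn v)%R p.2)); last first.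
    by move=> *; exact: F0.
  apply: (measurable_fun2 mF); last by meas.
  by apply: measurable_funD; [meas|apply: (measurableT_comp (@measurable_sqn _)); meas].
transitivity (\int[mu]_s \int[mu]_t G (s ^+ 2 + t ^+ 2)%R (x0 * s + Num.sqrt (sqn x') * t)%R).
  apply: eq_integral => s _.
  transitivity (\int[mun n.+1]_v F (s ^+ 2 + sqn v)%R (x0 * s + dotp x' v)%R).
    by apply: eq_integral => v _; rewrite sqn_rcons dotp_rcons.
  rewrite (ih x' (fun w z => F (s ^+ 2 + w)%R (x0 * s + z)%R)); last 2 first.
  - by apply: (measurable_fun2 mF); meas.
  - by move=> *; exact: F0.
  rewrite integral_munS; last 2 first.
  - apply: (measurable_fun2 mF); first by apply: mr; meas.
    apply: measurable_funD; meas; exact: measurable_coord.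
  - by move=> *; exact: F0.
  apply: eq_integral => t _; apply: eq_integral => v _.
  by rewrite sqn_rcons rcons_row0 addrA.
rewrite integral_plane_rotation// sqr_sqrtr ?sqn_ge0// -sqn_rcons.
rewrite [RHS]integral_munS; last 2 first.
- apply: (measurable_fun2 mF); first exact: measurable_sqn.
  by apply: measurable_funM => //; exact: measurable_coord.
- by move=> *; exact: F0.
apply: eq_integral => s _; set c := Num.sqrt _.
rewrite integral_munS; last 2 first.
- apply: (measurable_fun2 mF).
    by apply: (measurableT_comp (@measurable_sqn _)); apply: measurable_rcons_row; meas.
  apply: measurable_funM => //; apply: (measurableT_comp (@measurable_coord _ _ _)).
  by apply: measurable_rcons_row; meas.
- by move=> *; exact: F0.
apply: eq_integral => t _; apply: eq_integral => v _.
by rewrite !sqn_rcons rcons_row0 addrA.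
Qed.

End euclidean.

Section radial_integrals.
Context {R : realType}.
Local Notation mu := (@lebesgue_measure R).
Local Open Scope ereal_scope.

Lemma integral_ge0_gt0 (f : R -> \bar R) : measurable_fun setT f ->
  \int[mu]_t (f t * (0 <= t)%R%:R%:E) = \int[mu]_t (f t * (0 < t)%R%:R%:E).
Proof.
move=> mf.
transitivity (\int[mu]_(t in `[0%R, +oo[) f t).
  rewrite [RHS]integral_mkcond; apply: eq_integral => t _.
  by rewrite patchE mem_setE in_itv/= andbT; case: ifP => _; rewrite ?mule1 ?mule0.
rewrite -integral_itv_obnd_cbnd; last exact: measurable_funTS.
rewrite [LHS]integral_mkcond; apply: eq_integral => t _.
by rewrite patchE mem_setE in_itv/= andbT; case: ifP => _; rewrite ?mule1 ?mule0.
Qed.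

Lemma integral_even (f : R -> \bar R) : measurable_fun setT f -> (forall t, 0 <= f t) ->
  \int[mu]_t f t = \int[mu]_t ((f t + f (- t)%R) * (0 < t)%R%:R%:E).
Proof.
move=> mf f0.
transitivity (\int[mu]_t (f t * (0 < t)%R%:R%:E + f t * (0 <= - t)%R%:R%:E)).
  apply: eq_integral => t _; rewrite oppr_ge0.
  by case: ltP => _; rewrite mule1 mule0 ?adde0 ?add0e.
rewrite integralTD; side.
rewrite -(@integral_oppr _ (fun t => f t * (0 <= - t)%R%:R%:E)); side.
under [X in _ + X]eq_integral do rewrite opprK.
rewrite (@integral_ge0_gt0 (fun t => f (- t)%R)); last by meas.
rewrite -integralTD; side.
by apply: eq_integral => t _; rewrite ge0_muleDl.
Qed.

(** The law of v = |y|^2 has density c v^(n/2-1). The squared norm is used because it is additive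
    when a coordinate is added. The constant is left in [0, +oo] during the induction on n. *)
Definition radial_law n (c : \bar R) := forall g : R -> \bar R,
  measurable_fun setT g -> (forall v, 0 <= g v) ->
  \int[mun n]_y g (sqn y) = c * \int[mu]_v (g v * (v `^ (n%:R / 2 - 1) * (0 < v)%R%:R)%:E).

(** With b the first coordinate and w = |y|^2, the tail has squared norm w - b^2, to which
    [radial_law] applies. Then b = sqrt w * r separates w from r and produces the weight (1 -
    r^2)^(n/2-1) that occurs in [Phi]. *)
Lemma integral_mun_slice n (c : \bar R) (G : R -> R -> \bar R) :
  0 <= c -> radial_law n c ->
  measurable_fun setT (fun p => G p.1 p.2) -> (forall w z, 0 <= G w z) ->
  \int[mun n.+1]_y G (sqn y) (y 0%R ord0) =
  c * \int[mu]_w ((w `^ (n.+1%:R / 2 - 1) * (0 < w)%R%:R)%:E *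
     \int[mu]_r (G w (Num.sqrt w * r)%R *
       ((1 - r ^+ 2) `^ (n%:R / 2 - 1) * (0 < 1 - r ^+ 2)%R%:R)%:E)).
Proof.
move=> c0 rl mG G0.
rewrite integral_munS; last 2 first.
- by apply: (measurable_fun2 mG); [exact: measurable_sqn|exact: measurable_coord].
- by move=> *; exact: G0.
set e : R := (n%:R / 2 - 1)%R.
transitivity (c * \int[mu]_b \int[mu]_w (G w b *
    ((w - b ^+ 2) `^ e * (0 < w - b ^+ 2)%R%:R)%:E)).
  rewrite -integralTZl//; last 2 first.
  - by apply: (@measurable_integral_snd _ _ _ _ _ mu (fun b w => G w b *
      ((w - b ^+ 2) `^ e * (0 < w - b ^+ 2)%R%:R)%:E)); side.
  - by pos.
  apply: eq_integral => b _.
  transitivity (\int[mun n]_v G (b ^+ 2 + sqn v)%R b).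
    by apply: eq_integral => v _; rewrite sqn_rcons rcons_row0.
  rewrite (rl (fun w => G (b ^+ 2 + w)%R b)); side.
  congr (_ * _).
  rewrite -(@integral_shift _ (fun w => G w b *
    ((w - b ^+ 2) `^ e * (0 < w - b ^+ 2)%R%:R)%:E) (b ^+ 2)); side.
  by apply: eq_integral => v _; rewrite addrK [(v + _)%R]addrC.
congr (_ * _).
transitivity (\int[mu]_w \int[mu]_b (G w b *
    ((w - b ^+ 2) `^ e * (0 < w - b ^+ 2)%R%:R)%:E)).
  by apply: integralT_swap; side.
apply: eq_integral => w _.
have [w0|w0] := ltP 0%R w; last first.
  rewrite mulr0 mul0e; apply: integral0_eq => b _.
  rewrite (_ : (0 < _)%R = false) ?mulr0 ?mule0//.
  by apply/negbTE; rewrite -leNgt subr_le0 (le_trans w0)// sqr_ge0.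
set rw := Num.sqrt w.
have rw0 : (0 < rw)%R by rewrite sqrtr_gt0.
have rw2 : (rw ^+ 2 = w)%R by rewrite sqr_sqrtr// ltW.
have -> : \int[mu]_b (G w b * ((w - b ^+ 2) `^ e * (0 < w - b ^+ 2)%R%:R)%:E) =
    rw%:E * \int[mu]_r (G w (rw * r)%R *
      ((w - (rw * r) ^+ 2) `^ e * (0 < w - (rw * r) ^+ 2)%R%:R)%:E).
  rewrite (@integral_pscale _ (fun b => G w b *
    ((w - b ^+ 2) `^ e * (0 < w - b ^+ 2)%R%:R)%:E)) //; side.
  by rewrite muleA -EFinM divff ?gt_eqF// mul1e.
rewrite -!integralTZl//; side.
apply: eq_integral => r _.
rewrite exprMn rw2 -[X in (X - _ * _)%R]mulr1 -mulrBr pmulr_rgt0//.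
have [r1|_] := ltP 0%R (1 - r ^+ 2)%R; last by rewrite !mulr0 !mule0.
rewrite powRM ?ltW// !mulr1 muleCA [RHS]muleCA; congr (_ * _).
rewrite -!EFinM mulrA; congr ((_ * _)%:E).
rewrite /rw -powR12_sqrt ?ltW// -powRD; last by apply/implyP => _; rewrite gt_eqF.
by congr (_ `^ _)%R; rewrite /e -natr1; field.
Qed.

(** The substitution v = t^2 becomes a scaling by 2 once both variables are written as
    exponentials. *)
Lemma radial_law1 : radial_law 1 1.
Proof.
move=> g mg g0; rewrite mul1e integral_munS; last 2 first.
- by apply: measurableT_comp => //; exact: measurable_sqn.
- by move=> *; exact: g0.
transitivity (\int[mu]_t g (t ^+ 2)%R).
  apply: eq_integral => t _; rewrite integral_mun0 sqn_rcons.
  by rewrite /sqn big_ord0 addr0.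
rewrite integral_even; side.
under eq_integral do rewrite sqrrN.
rewrite (@integral_expR _ (fun t => g (t ^+ 2)%R + g (t ^+ 2)%R)); side.
rewrite [RHS](_ : _ = \int[mu]_v ((g v * (v `^ (1 / 2 - 1))%:E) * (0 < v)%R%:R%:E)); last first.
  by apply: eq_integral => v _; rewrite EFinM muleA.
rewrite [RHS](@integral_expR _ (fun v => g v * (v `^ (1 / 2 - 1))%:E)); side.
pose k t := 2%:E * (g (expR t) * (expR (2^-1 * t))%:E).
transitivity (\int[mu]_t k (2 * t)%R).
  apply: eq_integral => t _; rewrite /k.
  have -> : (2^-1 * (2 * t) = t)%R by field.
  have -> : (expR t ^+ 2 = expR (2 * t))%R by rewrite expr2 -expRD; congr expR; ring.
  by rewrite muleA; congr (_ * _); rewrite -mule2n mule_natl.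
rewrite integral_pscale; rewrite /k; side; last by [].
rewrite integralTZl; side.
rewrite muleA -EFinM mulVf// mul1e; apply: eq_integral => t _.
rewrite -muleA -EFinM; congr (_ * _%:E).
rewrite /powR gt_eqF ?expR_gt0// expRK -expRD; congr expR; by field.
Qed.

Lemma radial_lawS n (c : \bar R) : 0 <= c -> radial_law n c ->
  radial_law n.+1 (c * \int[mu]_r (((1 - r ^+ 2) `^ (n%:R / 2 - 1) * (0 < 1 - r ^+ 2)%R%:R)%:E)).
Proof.
move=> c0 rl g mg g0.
rewrite (@integral_mun_slice n c (fun w _ => g w)); side => //.
rewrite -muleA; congr (_ * _); rewrite -integralTZl; side.
apply: eq_integral => w _; rewrite integralTZl; side.
by rewrite muleCA [RHS]muleCA; congr (_ * _); exact: muleC.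
Qed.

Lemma integral_gauss_mun n : \int[mun n]_y (expR (- sqn y))%:E = ((Num.sqrt pi) ^+ n)%:E :> \bar R.
Proof.
elim: n => [|n ih].
  by rewrite integral_mun0 /sqn big_ord0 oppr0 expR0.
rewrite integral_munS; last 2 first.
- apply/measurable_EFinP; apply: measurableT_comp => //.
  by apply: measurable_funN; exact: measurable_sqn.
- by pos.
transitivity (\int[mu]_t ((gauss_fun t)%:E * ((Num.sqrt pi) ^+ n)%:E)).
  apply: eq_integral => t _; rewrite -ih -integralTZl; last 3 first.
  - apply/measurable_EFinP; apply: measurableT_comp => //.
    by apply: measurable_funN; exact: measurable_sqn.
  - by pos.
  - by rewrite lee_fin gauss_fun_ge0.
  apply: eq_integral => v _.
  by rewrite sqn_rcons opprD expRD EFinM.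
rewrite integralTZr.
- by rewrite integralT_gauss -EFinM -exprS.
- by apply/measurable_EFinP; exact: measurable_gauss_fun.
- by move=> t; rewrite lee_fin gauss_fun_ge0.
- by rewrite lee_fin exprn_ge0// sqrtr_ge0.
Qed.

(** Half the surface measure of the unit sphere of R^n; the other factor 2 is lost in v = |y|^2. *)
Definition radial_const n : R := (pi `^ (n%:R / 2) / Gamma (n%:R / 2))%R.

(** Induction gives some constant c in [0, +oo]. Evaluating the Gaussian both as a product and by
    the radial law yields pi^(n/2) = c I with I the Gamma integral. As the left side is positive and
    finite, this excludes 0 and +oo for both factors and determines c. *)
Lemma radial_law_const n : (0 < n)%N ->
  (0 < radial_const n)%R /\ radial_law n (radial_const n)%:E.
Proof.
move=> n0.
have [c c0 rl] : exists2 c, 0 <= c & radial_law n c.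
  case: n n0 => // n _; elim: n => [|n [c c0 rl]].
    by exists 1; [rewrite lee_fin|exact: radial_law1].
  by exists (c * \int[mu]_r (((1 - r ^+ 2) `^ (n.+1%:R / 2 - 1) * (0 < 1 - r ^+ 2)%R%:R)%:E));
    [pos|exact: radial_lawS].
have := rl (fun v => (expR (- v))%:E); rewrite integral_gauss_mun.
set I := \int[mu]_v _ => H.
have {}H : ((Num.sqrt pi) ^+ n)%:E = c * I by apply: H; side.
have IE : I = \int[mu]_(t in [set t : R | (0 < t)%R]) ((t `^ (n%:R / 2 - 1)) * expR (- t))%R%:E.
  rewrite [RHS]integral_mkcond; apply: eq_integral => t _; rewrite patchE.
  rewrite (_ : (t \in _) = (0 < t)%R); last by apply/idP/idP => [/set_mem|t0]; [|apply/mem_set].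
  by case: ifP => _; rewrite ?mulr1 ?mulr0 ?mule0// -EFinM mulrC.
have I0 : 0 <= I by rewrite /I; pos.
have pn : (0 < Num.sqrt (pi : R) ^+ n)%R by rewrite exprn_gt0// sqrtr_gt0 pi_gt0.
move: IE; move: I0 H; case: I => [r|_|//]; last first.
  move: c0; rewrite le_eqVlt => /predU1P[<-|c0]; last by rewrite gt0_muley.
  by rewrite mul0e => /eqP; rewrite eqe gt_eqF.
rewrite lee_fin le_eqVlt => /predU1P[<-|r0].
  by rewrite mule0 => /eqP; rewrite eqe gt_eqF.
case: c c0 rl => [c c0 rl|_ _|//]; last by rewrite gt0_mulye.
rewrite -EFinM => -[H] E.
have G : Gamma (n%:R / 2) = r by rewrite /Gamma -E.
have cE : c = radial_const n.
  rewrite /radial_const G; apply: (mulIf (lt0r_neq0 r0)).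
  rewrite mulfVK ?gt_eqF// -H -powR12_sqrt ?pi_ge0// -powR_mulrn ?powR_ge0// -powRrM.
  by congr (_ `^ _)%R; rewrite mulrC.
have cp : (0 < c)%R by rewrite -(pmulr_lgt0 c r0) -H.
by split; rewrite -cE.
Qed.

End radial_integrals.

Section polar_coordinates.
Context {R : realType}.
Local Notation mu := (@lebesgue_measure R).
Local Open Scope ereal_scope.

Lemma enormE n (x : 'rV[R]_n) : enorm x = Num.sqrt (sqn x).
Proof. by []. Qed.

Lemma enorm_ge0 n (x : 'rV[R]_n) : (0 <= enorm x)%R.
Proof. exact: sqrtr_ge0. Qed.

Lemma enorm_sqr n (x : 'rV[R]_n) : (enorm x ^+ 2 = sqn x)%R.
Proof. by rewrite sqr_sqrtr// sqn_ge0. Qed.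

Lemma measurable_enorm n : measurable_fun setT (@enorm R n).
Proof.
exact: (measurableT_comp measurable_sqrtr (@measurable_sqn R n)).
Qed.

Lemma sqnB n (x y : 'rV[R]_n) : sqn (x - y) = (sqn x - 2 * dotp x y + sqn y)%R.
Proof.
rewrite /sqn /dotp mulr_sumr -sumrB -big_split/=; apply: eq_bigr => i _.
by rewrite !mxE; ring.
Qed.

Lemma enorm_powR n (x : 'rV[R]_n) (a : R) : (enorm x `^ a = sqn x `^ (a / 2))%R.
Proof. by rewrite enormE -powR12_sqrt ?sqn_ge0// -powRrM mulrC. Qed.

Lemma expR_powR (a t : R) : (expR t `^ a = expR (a * t))%R.
Proof. by rewrite /powR gt_eqF ?expR_gt0// expRK. Qed.

Lemma sqrt_expR2 (t : R) : Num.sqrt (expR (2 * t)) = expR t.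
Proof.
have -> : (2 * t = t + t)%R by ring.
by rewrite expRD -expr2 sqrtr_sqr gtr0_norm// expR_gt0.
Qed.

Lemma integral_powR_expR2 (f : R -> \bar R) (a : R) : measurable_fun setT f ->
  (forall v, 0 <= f v) ->
  \int[mu]_v ((v `^ (a / 2 - 1) * (0 < v)%R%:R)%:E * f v) =
  2%:E * \int[mu]_t (f (expR (2 * t)) * (expR (a * t))%:E).
Proof.
move=> mf f0.
transitivity (\int[mu]_v (((v `^ (a / 2 - 1))%:E * f v) * (0 < v)%R%:R%:E)).
  by apply: eq_integral => v _; rewrite EFinM muleAC.
rewrite (@integral_expR _ (fun v => (v `^ (a / 2 - 1))%:E * f v)); side.
pose k t := f (expR t) * (expR (a / 2 * t))%:E.
transitivity (\int[mu]_t k t).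
  apply: eq_integral => t _; rewrite expR_powR muleAC -EFinM -expRD muleC; congr (_ * (expR _)%:E).
  by field.
transitivity (2%:E * \int[mu]_t k (2 * t)%R).
  rewrite integral_pscale; rewrite /k; side; last by [].
  by rewrite muleA -EFinM divff// mul1e.
apply: (congr1 (mule _)); apply: eq_integral => t _; rewrite /k.
have -> : (a / 2 * (2 * t) = a * t)%R by field.
by [].
Qed.

Lemma integral_polar n (g : R -> \bar R) : (0 < n)%N -> measurable_fun setT g ->
  (forall v, 0 <= g v) ->
  \int[mun n]_x g (enorm x) =
  (2 * radial_const n)%:E * \int[mu]_t (g (expR t) * (expR (n%:R * t))%:E).
Proof.
move=> n0 mg g0; have [c0 rl] := @radial_law_const R n n0.
rewrite (rl (fun v => g (Num.sqrt v))); [|by apply: measurableT_comp => //; exact: measurable_sqrtr|by move=> *; exact: g0].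
under eq_integral do rewrite muleC.
rewrite (@integral_powR_expR2 (fun v => g (Num.sqrt v))); [|by apply: measurableT_comp => //; exact: measurable_sqrtr|by move=> *; exact: g0].
rewrite muleA -EFinM mulrC; congr (_ * _).
by apply: eq_integral => t _; rewrite sqrt_expR2.
Qed.

(* Phi extended to all t >= 0: for d = 1 the formula of Phi is only meaningful for t < 1. *)
Definition Psi (d : nat) (s p t : R) : \bar R :=
  match d with
  | 1%N => (`|1 - t| `^ (-1 - s * p) + (1 + t) `^ (-1 - s * p))%R%:E
  | _ => Phi d s p t
  end.

Lemma Psi_Phi d s p t : (0 <= t)%R -> (t < 1)%R -> Psi d s p t = Phi d s p t.
Proof.
move=> t0 t1; case: d => [//|[|//]]; rewrite /Psi /Phi gtr0_norm//.
by rewrite subr_gt0.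
Qed.

Lemma Psi_ge0 d s p t : 0 <= Psi d.+1 s p t.
Proof.
case: d => [|d]; first by rewrite lee_fin addr_ge0 ?powR_ge0.
rewrite /Psi /Phi mule_ge0//.
  rewrite lee_fin /omega !mulr_ge0 ?powR_ge0// invr_ge0.
  by apply: fine_ge0; apply: integral_ge0 => v _; rewrite lee_fin mulr_ge0 ?powR_ge0 ?expR_ge0.
by apply: integral_ge0 => v _; rewrite lee_fin divr_ge0 ?powR_ge0.
Qed.

Lemma omegaE d : omega d.+2 = (2 * radial_const d.+1)%R :> R.
Proof.
rewrite /omega /radial_const mulrA.
by have -> : (d.+2%:R - 1 = d.+1%:R :> R)%R by rewrite -natr1 addrK.
Qed.

(** Puts [Phi] in the shape delivered by [integral_mun_slice]: the endpoints r = 1, -1 are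
    negligible and (d-3)/2 is (d-1)/2 - 1. *)
Lemma PhiE d s p t : Phi d.+2 s p t = (2 * radial_const d.+1)%:E *
  \int[mu]_r (((1 - r ^+ 2) `^ (d.+1%:R / 2 - 1) * (0 < 1 - r ^+ 2)%R%:R *
     (1 - 2 * t * r + t ^+ 2) `^ (- (d.+2%:R + s * p) / 2))%:E).
Proof.
rewrite /Phi omegaE; congr (_ * _).
rewrite (@integral_itv_bndoo _ _ _ _ true false)//; last first.
  by apply: measurable_funTS; meas.
rewrite integral_mkcond; apply: eq_integral => r _; rewrite patchE mem_setE in_itv/=.
have -> : (0 < 1 - r ^+ 2)%R = (-1 < r < 1)%R.
  by rewrite subr_gt0 -ltr_norml -[in LHS](real_normK (num_real r)) expr_lt1.
case: ifP => _; last by rewrite mulr0 mul0r.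
rewrite mulr1 -powRN mulNr; congr ((_ `^ _ * _)%R%:E).
by rewrite -(natr1 d.+1); field.
Qed.

(** For unit vectors, |w - v/t| = |w - t v| / t. This inversion symmetry folds the line onto a
    half-line and produces the two summands in the constant. *)
Lemma Psi_inv d s p t : (0 < t)%R ->
  Psi d.+1 s p t^-1 = (t `^ (d.+1%:R + s * p))%:E * Psi d.+1 s p t.
Proof.
move=> t0; have tN : (t != 0)%R by rewrite gt_eqF.
have ti : (0 <= t^-1)%R by rewrite invr_ge0 ltW.
case: d => [|d].
  have -> : (1%:R + s * p = - (-1 - s * p) :> R)%R by ring.
  have T a : (t `^ (- a) = t^-1 `^ a)%R by rewrite -powR_inv1 ?ltW// -powRrM mulN1r.
  rewrite /Psi -EFinM T mulrDr -!powRM//; last by rewrite addr_ge0// ltW.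
  congr ((_ `^ _ + _ `^ _)%R%:E).
    by rewrite -[X in (X * _)%R]ger0_norm// -normrM mulrBr mulr1 mulVf// distrC.
  by rewrite mulrDr mulr1 mulVf// addrC.
rewrite /Psi !PhiE muleCA; congr (_ * _).
rewrite -integralTZl; side.
apply: eq_integral => r _; rewrite -EFinM mulrCA; congr (_%:E).
have [r1|_] := ltP 0%R (1 - r ^+ 2)%R; last by rewrite !mulr0 !mul0r.
congr (_ * _)%R.
have rt : (0 <= 1 - 2 * t * r + t ^+ 2)%R.
  have -> : (1 - 2 * t * r + t ^+ 2 = (1 - r ^+ 2) + (r - t) ^+ 2)%R by ring.
  by rewrite addr_ge0 ?sqr_ge0// ltW.
have -> : (1 - 2 * t^-1 * r + t^-1 ^+ 2 = (1 - 2 * t * r + t ^+ 2) * (t `^ (-2)))%R.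
  rewrite powRN powR_mulrn ?ltW//; field.
  by [].
rewrite powRM ?powR_ge0// -powRrM mulrC; congr (_ `^ _ * _)%R.
by field.
Qed.

Lemma measurable_Psi d s p : measurable_fun setT (Psi d.+1 s p).
Proof.
case: d => [|d]; first by rewrite /Psi; meas.
rewrite (_ : Psi _ _ _ = fun t => (2 * radial_const d.+1)%:E *
  \int[mu]_r (((1 - r ^+ 2) `^ (d.+1%:R / 2 - 1) * (0 < 1 - r ^+ 2)%R%:R *
     (1 - 2 * t * r + t ^+ 2) `^ (- (d.+2%:R + s * p) / 2))%:E)); last first.
  by apply/funext => t; rewrite /Psi PhiE.
apply: emeasurable_funM; first by meas.
apply: (@measurable_integral_snd _ _ _ _ _ mu (fun t r : R => ((1 - r ^+ 2) `^ (d.+1%:R / 2 - 1) * (0 < 1 - r ^+ 2)%R%:R *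
     (1 - 2 * t * r + t ^+ 2) `^ (- (d.+2%:R + s * p) / 2))%:E)); side.
Qed.

(** Dilation by rho is the shift by ln rho of the logarithmic variable. *)
Lemma integral_expR_scale (P g : R -> \bar R) (rho n lam : R) : (0 < rho)%R ->
  measurable_fun setT P -> (forall v, 0 <= P v) ->
  measurable_fun setT g -> (forall v, 0 <= g v) ->
  \int[mu]_t (g (expR t) * ((expR (n * t))%:E * ((rho `^ (- lam))%:E * P (expR t / rho)%R))) =
  (rho `^ (n - lam))%:E * \int[mu]_t (g (rho * expR t)%R * ((expR (n * t))%:E * P (expR t))).
Proof.
move=> rho0 mP P0 mg g0; have rhoN : (rho != 0)%R by rewrite gt_eqF.
pose k t := g (expR t) * ((expR (n * t))%:E * ((rho `^ (- lam))%:E * P (expR t / rho)%R)).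
have mk : measurable_fun setT k by rewrite /k; meas.
have k0 t : 0 <= k t by rewrite /k; pos.
rewrite -[LHS]/(\int[mu]_t k t) -(integral_shift (ln rho) mk k0) -integralTZl; side.
apply: eq_integral => t _; rewrite /k expRD lnK ?posrE// mulfK//.
rewrite [(expR t * _)%R]mulrC [RHS]muleCA; apply: (congr1 (mule _)).
rewrite [LHS]muleA [RHS]muleA -!EFinM; apply: (congr1 (fun z => z%:E * _)).
have -> : (expR (n * (t + ln rho)) = expR (n * t) * rho `^ n)%R.
  by rewrite mulrDr expRD /powR (negbTE rhoN).
by rewrite -mulrA -powRD ?rhoN ?implybT// mulrC.
Qed.

(** |x - y|^2 = |x|^2 - 2 x.y + |y|^2 depends on y only through |y|^2 and x.y, so x may be rotated
    onto the first axis and the integral sliced along that axis. *)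
Lemma integral_bipolar0 d (s p : R) (x : 'rV[R]_d.+1) (g : R -> \bar R) :
  (0 < enorm x)%R ->
  measurable_fun setT g -> (forall v, 0 <= g v) ->
  \int[mun d.+1]_y (g (enorm y) * (enorm (x - y) `^ (- (d.+1%:R + s * p)))%:E) =
  \int[mu]_t (g (expR t) * ((expR (d.+1%:R * t))%:E *
    ((enorm x `^ (- (d.+1%:R + s * p)))%:E * Psi d.+1 s p (expR t / enorm x)))).
Proof.
move=> x0 mg g0; set rho := enorm x in x0 *.
set lam : R := (d.+1%:R + s * p)%R.
pose F w z : \bar R := g (Num.sqrt w) * ((rho ^+ 2 - 2 * z + w) `^ (- lam / 2))%:E.
have mF : measurable_fun setT (fun q => F q.1 q.2) by rewrite /F; meas.
have F0 w z : 0 <= F w z by rewrite /F; pos.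
transitivity (\int[mun d.+1]_y F (sqn y) (rho * y 0%R ord0)%R).
  rewrite /rho enormE -(integral_mun_rotation x mF F0); apply: eq_integral => y _.
  by rewrite enorm_powR sqnB -enorm_sqr.
have rhoN : (rho != 0)%R by rewrite gt_eqF.
(* On the real line the tail is a point and has no radial density; the two points of the sphere are
   the two signs of y. *)
case: d x @rho x0 @lam @F mF F0 rhoN => [|d] x rho x0 lam F mF F0 rhoN.
  rewrite integral_munS; last 2 first.
  - apply: (measurable_fun2 mF); first exact: measurable_sqn.
    by apply: measurable_funM => //; exact: measurable_coord.
  - by move=> *; exact: F0.
  transitivity (\int[mu]_t F (t ^+ 2)%R (rho * t)%R).
    apply: eq_integral => t _; rewrite integral_mun0 sqn_rcons rcons_row0.
    by rewrite /sqn big_ord0 addr0.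
  rewrite integral_even; side.
  rewrite (@integral_expR _ (fun t => F (t ^+ 2)%R (rho * t)%R + F ((- t) ^+ 2)%R (rho * - t)%R)); side.
  apply: eq_integral => t _; rewrite /F /Psi.
  have et : (0 < expR t)%R by exact: expR_gt0.
  rewrite !sqrrN sqrtr_sqr gtr0_norm// -ge0_muleDr ?lee_fin ?powR_ge0//.
  rewrite -muleA; congr (_ * _); rewrite mul1r muleC; congr (_ * _).
  rewrite -EFinD -EFinM; congr (_%:E).
  have -> : (-1 - s * p = - lam)%R by rewrite /lam; ring.
  rewrite mulrDr -!powRM ?(ltW x0)//; last by rewrite addr_ge0// divr_ge0// ltW.
  have -> : (rho * `|1 - expR t / rho| = `|rho - expR t|)%R.
    by rewrite -{1}(gtr0_norm x0) -normrM mulrBr mulr1 mulrCA divff// mulr1.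
  have -> : (rho * (1 + expR t / rho) = rho + expR t)%R by field.
  rewrite (_ : (rho ^+ 2 - _ + _ = `|rho - expR t| ^+ 2)%R); last by rewrite real_normK ?num_real//; ring.
  rewrite (_ : (rho ^+ 2 - _ + _ = (rho + expR t) ^+ 2)%R); last by ring.
  have sq (a : R) : (0 <= a -> (a ^+ 2) `^ (- lam / 2) = a `^ (- lam))%R.
    by move=> a0; rewrite -powR_mulrn// -powRrM; congr (_ `^ _)%R; field.
  by rewrite !sq// addr_ge0// ltW.
have [c0 rl] := @radial_law_const R d.+1 isT.
rewrite (@integral_mun_slice _ d.+1 (radial_const d.+1)%:E (fun w z => F w (rho * z)%R)); side; last exact: rl.
rewrite (@integral_powR_expR2 (fun w => \int[mu]_r (F w (rho * (Num.sqrt w * r))%R *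
  ((1 - r ^+ 2) `^ (d.+1%:R / 2 - 1) * (0 < 1 - r ^+ 2)%R%:R)%:E))); last 2 first.
- by apply: (@measurable_integral_snd _ _ _ _ _ mu (fun w r : R => F w (rho * (Num.sqrt w * r))%R *
  ((1 - r ^+ 2) `^ (d.+1%:R / 2 - 1) * (0 < 1 - r ^+ 2)%R%:R)%:E)); side.
- by pos.
rewrite muleA -EFinM -integralTZl; last 3 first.
- apply: emeasurable_funM; last by meas.
  by apply: (@measurable_integral_snd _ _ _ _ _ mu (fun t r : R => F (expR (2 * t)) (rho * (Num.sqrt (expR (2 * t)) * r))%R *
  ((1 - r ^+ 2) `^ (d.+1%:R / 2 - 1) * (0 < 1 - r ^+ 2)%R%:R)%:E)); side.
- by pos.
- by rewrite lee_fin mulr_ge0// ltW.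
apply: eq_integral => t _; rewrite /Psi PhiE /F sqrt_expR2.
set I := (X in _ = _ * (_ * (_ * (_ * X)))).
have -> : \int[mu]_r (g (expR t) *
       ((rho ^+ 2 - 2 * (rho * (expR t * r)) + expR (2 * t)) `^ (- lam / 2))%:E *
       ((1 - r ^+ 2) `^ (d.+1%:R / 2 - 1) * (0 < 1 - r ^+ 2)%R%:R)%:E) =
    (g (expR t) * (rho `^ (- lam))%:E) * I.
  rewrite /I -integralTZl; side.
  apply: eq_integral => r _; rewrite -!muleA; apply: (congr1 (mule _)).
  rewrite -!EFinM; congr (_%:E).
  have [r1|_] := ltP 0%R (1 - r ^+ 2)%R; last by rewrite !(mulr0, mul0r).
  have rt : (0 <= 1 - 2 * (expR t / rho) * r + (expR t / rho) ^+ 2)%R.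
    rewrite (_ : (_ + _ = (1 - r ^+ 2) + (r - expR t / rho) ^+ 2)%R); last by ring.
    by rewrite addr_ge0 ?sqr_ge0// ltW.
  have -> : (rho ^+ 2 - 2 * (rho * (expR t * r)) + expR (2 * t) =
      rho ^+ 2 * (1 - 2 * (expR t / rho) * r + (expR t / rho) ^+ 2))%R.
    have -> : (expR (2 * t) = expR t ^+ 2)%R by rewrite expr2 -expRD; congr expR; ring.
    by field.
  rewrite powRM ?sqr_ge0// mulr1 -powR_mulrn ?ltW// -powRrM.
  have -> : (2%:R * (- lam / 2) = - lam)%R by field.
  by rewrite -!mulrA; congr (_ * _)%R; rewrite mulrC.
rewrite [(radial_const _ * 2)%R]mulrC.
have ac (a b e g' I' : \bar R) : a * (g' * b * I' * e) = g' * (e * (b * (a * I'))).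
  rewrite -!muleA [LHS]muleCA; apply: (congr1 (mule _)).
  rewrite [I' * e]muleC [b * (e * I')]muleCA [LHS]muleCA; apply: (congr1 (mule _)).
  by rewrite muleCA.
exact: ac.
Qed.

Lemma integral_bipolar d (s p : R) (x : 'rV[R]_d.+1) (g : R -> \bar R) :
  (0 < enorm x)%R -> measurable_fun setT g -> (forall v, 0 <= g v) ->
  \int[mun d.+1]_y (g (enorm y) * (enorm (x - y) `^ (- (d.+1%:R + s * p)))%:E) =
  (enorm x `^ (- (s * p)))%:E * \int[mu]_t (g (enorm x * expR t)%R *
    ((expR (d.+1%:R * t))%:E * Psi d.+1 s p (expR t))).
Proof.
move=> x0 mg g0; rewrite integral_bipolar0//.
rewrite (integral_expR_scale _ _ x0 (measurable_Psi d s p) (Psi_ge0 d s p) mg g0).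
by congr ((_ `^ _)%R%:E * _); ring.
Qed.

End polar_coordinates.

(** * The convolution kernel on the line and the constant *)

Section log_kernel.
Context {R : realType}.
Local Notation mu := (@lebesgue_measure R).
Local Open Scope ereal_scope.

Definition kern (d : nat) (s p t : R) : \bar R := Psi d s p (expR t).

Lemma kern_ge0 d s p t : 0 <= kern d.+1 s p t. Proof. exact: Psi_ge0. Qed.

Lemma measurable_kern d s p : measurable_fun setT (kern d.+1 s p).
Proof.
exact: (measurableT_comp (@measurable_Psi _ d s p) (@measurable_expR R)).
Qed.

(** Exchanging x and y reverses tau = ln(|y|/|x|); the exponential is the price for the asymmetric
    normalization by |x|. *)
Lemma kern_opp d s p t :
  kern d.+1 s p (- t) = (expR ((d.+1%:R + s * p) * t))%:E * kern d.+1 s p t.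
Proof. by rewrite /kern expRN Psi_inv ?expR_gt0// expR_powR. Qed.

(* Compared with the integral over ]0, 1[ defining the constant, the summand t^-be accounts for
   tau > 0, with t = e^-tau, and the other summand for tau < 0, with t = e^tau. *)
Definition Dconst (d : nat) (s p be kap : R) : \bar R :=
  \int[mu]_t ((expR ((d%:R + be) * t) * `|1 - expR (- kap * t)| `^ p)%:E * kern d s p t).

Lemma Dconst_ge0 d s p be kap : 0 <= Dconst d.+1 s p be kap.
Proof.
apply: integral_ge0 => t _; apply: mule_ge0; last exact: kern_ge0.
by pos.
Qed.

Lemma CconstE d (s p q al be : R) : (0 < p)%R -> (0 < q)%R ->
  Cconst d.+1 s p q al be =
  Dconst d.+1 s p be ((d.+1%:R + al + q * be / p - s * q) / q) `^ (q / p).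
Proof.
move=> p0 q0; rewrite /Cconst; set kap := ((d.+1%:R + al + q * be / p - s * q) / q)%R.
apply: (congr1 (fun z => z `^ (q / p))).
set A : R := (- (p / q - 1) * d.+1%:R - p * al / q)%R.
have pN : (p != 0)%R by rewrite gt_eqF.
have qN : (q != 0)%R by rewrite gt_eqF.
have mk := @measurable_kern d s p.
have k0 t : 0 <= kern d.+1 s p t by exact: kern_ge0.
have mP := @measurable_Psi _ d s p.
have P0 t : 0 <= Psi d.+1 s p t by exact: Psi_ge0.
rewrite /Dconst /kern; rewrite /kern in mk k0.
have kern_oppE := @kern_opp d s p; rewrite /kern in kern_oppE.
move: (Psi d.+1 s p) (Phi d.+1 s p) (@Psi_Phi _ d.+1 s p) mk k0 mP P0 kern_oppE => P Ph PE mk k0 mP P0 Popp.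
pose c t : R := (t `^ (s * p - 1) * (t `^ A + t `^ (- be)) * `|1 - t `^ kap| `^ p)%R.
have c0 t : (0 <= c t)%R by rewrite /c; pos.
have mc : measurable_fun setT c by rewrite /c; meas.
have cE t : c t = (t `^ (s * p - 1) * (t `^ A + t `^ (- be)) * `|1 - t `^ kap| `^ p)%R by [].
transitivity (\int[mu]_(t in `]0%R, 1%R[) ((c t)%:E * Ph t)); first by [].
clearbody c.
transitivity (\int[mu]_t ((c t)%:E * P t * (t < 1)%R%:R%:E * (0 < t)%R%:R%:E)).
  rewrite [LHS]integral_mkcond; apply: eq_integral => t _.
  rewrite patchE mem_setE in_itv/=; case: (ltP 0%R t) => t0 /=; last by rewrite mule0.
  case: (ltP t 1%R) => t1; last by rewrite mule0 mul0e.
  by rewrite !mule1 (PE t (ltW t0) t1).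
rewrite (@integral_expR _ (fun t => (c t)%:E * P t * (t < 1)%R%:R%:E)); side.
rewrite -integral_oppr; side.
rewrite [RHS]integral_even; side.
apply: eq_integral => t _.
have -> : (expR (- t) < 1)%R = (0 < t)%R by rewrite -expR0 ltr_expR oppr_lt0.
case: (ltP 0%R t) => t0; last by rewrite !mule0 mul0e.
rewrite !mule1 Popp.
(* After this both halves of the line carry the same factor |1 - e^(-kap t)|^p, and the extra e^(p
   kap t) is what turns the exponent -be of one half into [A]. *)
have -> : (`|1 - expR (- kap * - t)| `^ p = expR (p * kap * t) * `|1 - expR (- kap * t)| `^ p)%R.
  have -> : (expR (p * kap * t) = `|expR (kap * t)| `^ p)%R.
    by rewrite gtr0_norm ?expR_gt0// expR_powR mulrA.
  rewrite -powRM// -normrM mulrBr mulr1 -expRD.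
  have -> : (kap * t + - kap * t = 0)%R by ring.
  by rewrite expR0 distrC mulrN mulNr opprK.
rewrite cE !expR_powR mulrN [(kap * - t)%R]mulrN -[(- (kap * t))%R]mulNr.
set N := (`|1 - expR (- kap * t)| `^ p)%R.
have N0 : (0 <= N)%R by rewrite powR_ge0.
clearbody N; move: (P (expR t)) => K.
have l1 (x y z k : \bar R) : x * (y * k) * z = x * y * z * k by rewrite muleA -[x * y * k * z]muleA [k * z]muleC muleA.
rewrite l1 [X in _ = _ + X]muleA -!EFinM -ge0_muleDl ?lee_fin; last 2 first.
- by pos.
- by pos.
rewrite -EFinD; apply: (congr1 (fun z => z%:E * K)).
set e1 := expR (- ((s * p - 1) * t)); set e4 := expR ((_ + s * p) * _)%R; set e5 := expR (- t).
set e2 := expR (A * - t); set e3 := expR (- be * - t).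
have h1 : (e1 * e3 * e4 * e5 = expR ((d.+1%:R + be) * t))%R.
  by rewrite /e1 /e3 /e4 /e5 -!expRD; congr expR; ring.
have h2 : (e1 * e2 * e4 * e5 = expR ((d.+1%:R + be) * - t) * expR (p * kap * t) * e4)%R.
  rewrite /e1 /e2 /e4 /e5 -!expRD; congr expR; rewrite /A /kap; field.
  by rewrite qN pN.
transitivity ((e1 * e3 * e4 * e5) * N + (e1 * e2 * e4 * e5) * N)%R; first by ring.
by rewrite h1 h2; ring.
Qed.

End log_kernel.

(** * Finiteness of the exponential moments of the kernel *)

Section integrability.
Context {R : realType}.
Local Notation mu := (@lebesgue_measure R).
Local Open Scope ereal_scope.

Lemma integral_expR_le_lty (c b : R) : (0 < c)%R ->
  \int[mu]_t (expR (c * t) * (t <= b)%R%:R)%:E < +oo.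
Proof.
move=> c0.
pose k t : \bar R := (expR t * (t <= c * b)%R%:R)%:E.
have -> : \int[mu]_t (expR (c * t) * (t <= b)%R%:R)%:E = \int[mu]_t k (c * t)%R.
  by apply: eq_integral => t _; rewrite /k ler_pM2l.
rewrite integral_pscale; rewrite /k; side => //.
rewrite lte_mul_pinfty//; first by pos.
have -> : \int[mu]_t (expR t * (t <= c * b)%R%:R)%:E =
    \int[mu]_t (((t <= expR (c * b))%R%:R)%:E * (0 < t)%R%:R%:E).
  rewrite (@integral_expR _ (fun t => ((t <= expR (c * b))%R%:R)%:E)); side.
  by apply: eq_integral => t _; rewrite -EFinM ler_expR mulrC.
have -> : \int[mu]_t (((t <= expR (c * b))%R%:R)%:E * (0 < t)%R%:R%:E) =
    \int[mu]_(t in `]0%R, expR (c * b)]) (1%:E : \bar R).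
  rewrite [RHS]integral_mkcond; apply: eq_integral => t _.
  by rewrite patchE mem_setE in_itv/= -EFinM mulrC; case: ltP => _ /=; case: leP => _;
    rewrite ?mulr1 ?mulr0 ?mul0r ?mul1r.
rewrite integral_cst//= mul1e lebesgue_measure_itv/= lte_fin expR_gt0.
by rewrite -EFinB ltry.
Qed.

Lemma integral_expR_ge_lty (c b : R) : (0 < c)%R ->
  \int[mu]_t (expR (- c * t) * (b <= t)%R%:R)%:E < +oo.
Proof.
move=> c0; rewrite -integral_oppr; side.
have := @integral_expR_le_lty c (- b)%R c0.
by under eq_integral => t _ do rewrite lerNr -[(c * t)%R]mulrNN.
Qed.

Lemma measurable_subr_row n (z : 'rV[R]_n) :
  measurable_fun setT (fun y : 'rV[R]_n => (z - y)%R).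
Proof.
apply: measurable_fun_coordP => i.
rewrite (_ : (fun y => _) = (fun y : 'rV[R]_n => (z 0 i - y 0 i)%R)); last first.
  by apply/funext => y; rewrite !mxE.
by apply: measurable_funB => //; exact: measurable_coord.
Qed.

Lemma integral_mun_sub n (x : 'rV[R]_n) (f : 'rV[R]_n -> \bar R) :
  measurable_fun setT f -> (forall y, 0 <= f y) ->
  \int[mun n]_y f (x - y)%R = \int[mun n]_y f y.
Proof.
elim: n x f => [|n ih] x f mf f0.
  by rewrite !integral_mun0; congr f; apply/rowP => -[].
have mfx := measurableT_comp mf (measurable_subr_row x).
rewrite (integral_munS mfx (fun y => f0 _)) (integral_munS mf f0).
pose F t v := f (rcons_row t v).
have mF : measurable_fun setT (fun q => F q.1 q.2).
  by apply: measurableT_comp => //; apply: measurable_rcons_row; meas.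
have F0 t v : 0 <= F t v by exact: f0.
transitivity (\int[mu]_t \int[mun n]_v F (head_row x - t)%R v).
  apply: eq_integral => t _; rewrite -[RHS](ih (tail_row x)); side.
  apply: eq_integral => v _; congr f; apply/rowP => i; rewrite !mxE.
  by case: unliftP => [j ->|->]; rewrite ?mxE// ?liftK ?unlift_none ?mxE.
pose G t := \int[mun n]_v F t v.
have mG : measurable_fun setT G by exact: measurable_integral_snd.
have G0 t : 0 <= G t by rewrite /G; pos.
rewrite -[RHS]/(\int[mu]_t G t) -(integral_shift (head_row x) mG G0).
rewrite -[RHS](@integral_oppr _ (fun t => G (t + head_row x)%R)); side.
by apply: eq_integral => t _; rewrite /G addrC.
Qed.

Definition unit_row n : 'rV[R]_n.+1 := \row_i (i == ord0)%:R.

Lemma sqn_unit_row n : sqn (unit_row n) = 1%R.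
Proof.
rewrite /sqn big_ord_recl big1 ?addr0 => [|i _]; first by rewrite mxE eqxx expr1n.
by rewrite mxE expr0n.
Qed.

Lemma dotp_unit_row n (y : 'rV[R]_n.+1) : dotp (unit_row n) y = y 0%R ord0.
Proof.
rewrite /dotp big_ord_recl big1 ?addr0 => [|i _]; first by rewrite mxE eqxx mul1r.
by rewrite mxE mul0r.
Qed.

Lemma enorm_unit_row n : enorm (unit_row n) = 1%R.
Proof. by rewrite enormE sqn_unit_row sqrtr1. Qed.

Lemma coord_le_enorm n (y : 'rV[R]_n) i : (`|y 0 i| <= enorm y)%R.
Proof.
rewrite enormE -sqrtr_sqr ler_wsqrtr// /sqn (bigD1 i)//= lerDl.
by apply: sumr_ge0 => j _; exact: sqr_ge0.
Qed.

Lemma enorm_unit_sub n (y : 'rV[R]_n.+1) :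
  (`|1 - enorm y| <= enorm (unit_row n - y) <= 1 + enorm y)%R.
Proof.
have yN := enorm_ge0 y.
have := coord_le_enorm y ord0; rewrite ler_norml => /andP[h1 h2].
rewrite [enorm (_ - _)]enormE sqnB sqn_unit_row dotp_unit_row -enorm_sqr; apply/andP; split.
  by rewrite -sqrtr_sqr ler_wsqrtr//; lra.
rewrite -[leRHS]ger0_norm ?addr_ge0// -sqrtr_sqr ler_wsqrtr//; lra.
Qed.

(** From z <= e^z at z = e |t| / p, raised to the power p. *)
Lemma powR_le_expR (p e t : R) : (0 < p)%R -> (0 < e)%R ->
  (`|t| `^ p <= (p / e) `^ p * expR (e * `|t|))%R.
Proof.
move=> p0 e0.
have h : (`|t| <= p / e * expR (e / p * `|t|))%R.
  have := expR_ge1Dx (e / p * `|t|)%R => h1.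
  have h2 : (e / p * `|t| <= expR (e / p * `|t|))%R by apply: le_trans h1; rewrite lerDr.
  rewrite -ler_pdivrMl ?divr_gt0// invf_div//.
have -> : (expR (e * `|t|) = expR (e / p * `|t|) `^ p)%R.
  by rewrite expR_powR; congr expR; field; rewrite gt_eqF.
rewrite -powRM ?expR_ge0 ?divr_ge0 ?(ltW p0) ?(ltW e0)//.
by rewrite ge0_ler_powR ?nnegrE ?(ltW p0)// mulr_ge0 ?expR_ge0// divr_ge0// ltW.
Qed.

End integrability.

Section kernel_moments.
Context {R : realType}.
Local Notation mu := (@lebesgue_measure R).

Lemma ln_powR_le_inside (v p e : R) : (0 < v)%R -> (v <= 1)%R -> (0 < p)%R -> (0 < e)%R ->
  (`|ln v| `^ p <= (p / e) `^ p * v `^ (- e))%R.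
Proof.
move=> v0 v1 p0 e0; apply: (le_trans (powR_le_expR (ln v) p0 e0)).
rewrite ler0_norm ?ln_le0//.
by rewrite -[in X in (_ <= _ * X `^ _)%R](lnK v0) expR_powR mulrN mulNr.
Qed.

Lemma ln_powR_le_outside (v p e : R) : (1 <= v)%R -> (0 < p)%R -> (0 < e)%R ->
  (`|ln v| `^ p <= (p / e) `^ p * v `^ e)%R.
Proof.
move=> v1 p0 e0; apply: (le_trans (powR_le_expR (ln v) p0 e0)).
have v0 : (0 < v)%R by exact: lt_le_trans v1.
rewrite ger0_norm ?ln_ge0//.
by rewrite -[in X in (_ <= _ * X `^ _)%R](lnK v0) expR_powR.
Qed.

Lemma norm_ln_le (v : R) : (2^-1 <= v)%R -> (`|ln v| <= 2 * `|1 - v|)%R.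
Proof.
move=> v2; have v0 : (0 < v)%R by apply: lt_le_trans v2; rewrite invr_gt0.
have l1 (w : R) : (0 < w)%R -> (ln w <= w - 1)%R.
  have := @le_ln1Dx R (w - 1)%R; rewrite (_ : (1 + (w - 1) = w)%R); last by ring.
  by move=> + w0; apply; lra.
have [v1|v1] := leP 1%R v.
  rewrite ger0_norm ?ln_ge0// distrC ger0_norm ?subr_ge0//.
  by apply: (le_trans (l1 v v0)); rewrite ler_peMl ?subr_ge0// ler1n.
rewrite ltr0_norm ?ln_lt0 ?v0// gtr0_norm ?subr_gt0// -lnV ?posrE//.
have vi : (v^-1 <= 2)%R by rewrite invf_ple ?posrE.
have vi0 : (0 < v^-1)%R by rewrite invr_gt0.
apply: (le_trans (l1 _ vi0)).
have -> : (v^-1 - 1 = v^-1 * (1 - v))%R by rewrite mulrBr mulr1 mulVf// gt_eqF.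
by rewrite ler_wpM2r// subr_ge0 ltW.
Qed.

Lemma powR_le_near1 (v c : R) : (2^-1 <= v)%R -> (v <= 2)%R -> (v `^ c <= expR (2 * `|c|))%R.
Proof.
move=> v1 v2; have v0 : (0 < v)%R by apply: lt_le_trans v1; rewrite invr_gt0.
rewrite -[in X in (X `^ _)%R](lnK v0) expR_powR ler_expR.
apply: (le_trans (ler_norm _)); rewrite normrM mulrC ler_wpM2r//.
apply: (le_trans (norm_ln_le v1)).
have : (`|1 - v| <= 1)%R by rewrite ler_norml; apply/andP; split; lra.
lra.
Qed.

(** Here v = |y| and D = |u0 - y| for a unit vector u0. For v <= 1/2 and v >= 2 the distance D is at
    least 1/2 and v/2 respectively, and the logarithm costs v^(-e) or v^e. In between, |ln v| <= 2
    |1 - v| <= 2 D, so |ln v|^p weakens the singularity D^(-lam) to D^(p - sp - n). *)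
Lemma kern_moment_pointwise (p s a n e v D : R) (lam := n + s * p)
    (C1 := (p / e) `^ p * 2 `^ lam) (C3 := 2 `^ p * expR (2 * `|a - n|)) :
  0 < p -> 0 < e -> 0 < lam -> 0 <= v -> 0 <= D -> `|1 - v| <= D -> D <= 1 + v ->
  `|ln v| `^ p * v `^ (a - n) * D `^ (- lam) <=
  C1 * (v `^ (a - e - n) * (v <= 2^-1)%R%:R)
  + C1 * (v `^ (- (lam - a - e) - n) * (2 <= v)%R%:R)
  + C3 * (D `^ (p - s * p - n) * (D <= 3)%R%:R).
Proof.
move=> p0 e0 lam0 v0 D0 d1 d2; set K := (p / e) `^ p in C1 *.
have C10 : (0 <= C1)%R by rewrite /C1 /K; pos.
have C30 : (0 <= C3)%R by rewrite /C3; pos.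
move: v0; rewrite le_eqVlt => /predU1P[<-|y0].
  rewrite ln0// normr0 powR0 ?gt_eqF// !mul0r.
  by rewrite !addr_ge0// mulr_ge0// mulr_ge0// powR_ge0.
have [v1|v1] := leP v 2^-1%R.
  rewrite -[leLHS]addr0 -[leLHS]addr0; apply: lerD; last first.
    by rewrite mulr_ge0// mulr_ge0// powR_ge0.
  apply: lerD; last by rewrite mulr_ge0// mulr_ge0// powR_ge0.
  have D2 : (2^-1 <= D)%R by move: d1; rewrite ger0_norm; lra.
  have -> : (C1 * (v `^ (a - e - n) * true%:R) = (K * v `^ (- e)) * v `^ (a - n) * 2 `^ lam)%R.
    rewrite mulr1 /C1 -!mulrA [(2 `^ lam * _)%R]mulrC !mulrA; congr (_ * _)%R.
    rewrite -mulrA -powRD ?(gt_eqF y0) ?implybT//; congr (_ * _ `^ _)%R.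
    by ring.
  apply: ler_pM; [by pos|exact: powR_ge0| |].
    by rewrite ler_wpM2r ?powR_ge0// ln_powR_le_inside//; lra.
  rewrite powRN -[leRHS]invrK lef_pV2 ?posrE ?invr_gt0 ?powR_gt0//; last lra.
  rewrite -powRN -[in leLHS](invrK 2) -powR_inv1// -powRrM mulN1r opprK.
  by rewrite ge0_ler_powR ?nnegrE// ltW.
have [v2|v2] := leP 2%R v.
  rewrite -[leLHS]addr0; apply: lerD; last by rewrite mulr_ge0// mulr_ge0// powR_ge0.
  rewrite -[leLHS]add0r; apply: lerD; first by rewrite mulr_ge0// mulr_ge0// powR_ge0.
  have D2 : (v / 2 <= D)%R by move: d1; rewrite ler0_norm; lra.
  have -> : (C1 * (v `^ (- (lam - a - e) - n) * true%:R) = (K * v `^ e) * v `^ (a - n) * (v / 2) `^ (- lam))%R.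
    rewrite mulr1 /C1 powRM ?(ltW y0) ?invr_ge0// -[(2^-1 `^ _)%R]invrK -powRN opprK.
    have -> : ((2^-1 `^ lam)^-1 = 2 `^ lam)%R by rewrite -powRN -powR_inv1// -powRrM mulN1r opprK.
    rewrite -!mulrA; congr (_ * _)%R; rewrite mulrC !mulrA; congr (_ * _)%R.
    rewrite -!powRD ?(gt_eqF y0) ?implybT//; congr (_ `^ _)%R.
    by rewrite /lam; ring.
  apply: ler_pM; [by pos|exact: powR_ge0| |].
    by rewrite ler_wpM2r ?powR_ge0// ln_powR_le_outside//; lra.
  rewrite !powRN lef_pV2 ?posrE ?powR_gt0//; [|lra|lra].
  by rewrite ge0_ler_powR ?nnegrE ?divr_ge0 ?(ltW y0) ?(ltW lam0).
rewrite !mulr0 !add0r.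
have -> : (D <= 3)%R by lra.
rewrite mulr1.
(* At D = 0 the convention 0^(-lam) = 0 makes the left side vanish. *)
have [D00|D00] := eqVneq D 0%R.
  by rewrite D00 powR0 ?mulr0 ?oppr_eq0 ?gt_eqF// mulr_ge0 ?powR_ge0.
have -> : (D `^ (p - s * p - n) = D `^ p * D `^ (- lam))%R.
  by rewrite -powRD ?D00 ?implybT//; congr (_ `^ _)%R; rewrite /lam; ring.
rewrite mulrA ler_wpM2r ?powR_ge0// /C3 mulrAC.
apply: ler_pM; [exact: powR_ge0|exact: powR_ge0| |exact: powR_le_near1 (ltW v1) (ltW v2)].
rewrite -powRM//; apply: ge0_ler_powR; rewrite ?nnegrE ?(ltW p0) ?mulr_ge0//.
by apply: (le_trans (norm_ln_le (ltW v1))); rewrite ler_wpM2l.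
Qed.

Local Open Scope ereal_scope.

Lemma integral_enorm_le_lty n (c b : R) : (0 < n)%N -> (0 < c)%R -> (0 < b)%R ->
  \int[mun n]_y ((enorm y `^ (c - n%:R) * (enorm y <= b)%R%:R)%:E : \bar R) < +oo.
Proof.
move=> n0 c0 b0.
rewrite (@integral_polar _ n (fun v => (v `^ (c - n%:R) * (v <= b)%R%:R)%:E)); side.
have [cn _] := @radial_law_const R n n0.
rewrite lte_mul_pinfty//; first by rewrite lee_fin mulr_ge0// ltW.
have := integral_expR_le_lty (ln b) c0; congr (_ < _).
apply: eq_integral => t _; rewrite -EFinM expR_powR.
have -> : (expR t <= b)%R = (t <= ln b)%R by rewrite -[in LHS](lnK b0) ler_expR.
by rewrite mulrAC -expRD; congr ((expR _ * _)%:E); ring.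
Qed.

Lemma integral_enorm_ge_lty n (c b : R) : (0 < n)%N -> (0 < c)%R -> (0 < b)%R ->
  \int[mun n]_y ((enorm y `^ (- c - n%:R) * (b <= enorm y)%R%:R)%:E : \bar R) < +oo.
Proof.
move=> n0 c0 b0.
rewrite (@integral_polar _ n (fun v => (v `^ (- c - n%:R) * (b <= v)%R%:R)%:E)); side.
have [cn _] := @radial_law_const R n n0.
rewrite lte_mul_pinfty//; first by rewrite lee_fin mulr_ge0// ltW.
have := integral_expR_ge_lty (ln b) c0; congr (_ < _).
apply: eq_integral => t _; rewrite -EFinM expR_powR.
have -> : (b <= expR t)%R = (ln b <= t)%R by rewrite -[in LHS](lnK b0) ler_expR.
by rewrite mulrAC -expRD; congr ((expR _ * _)%:E); ring.
Qed.

(** The bipolar formula is read backwards at a unit vector u0: the moment is an integral over R^n of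
    explicit powers of |y| and |u0 - y|. It converges at 0 since a > 0, at infinity since a < n +
    sp, and at u0 since p - sp > 0. *)
Lemma kern_moment_lty d (s p a : R) : (0 < s)%R -> (s < 1)%R -> (1 <= p)%R ->
  (0 < a)%R -> (a < d.+1%:R + s * p)%R ->
  \int[mu]_t ((`|t| `^ p * expR (a * t))%:E * kern d.+1 s p t) < +oo.
Proof.
move=> s0 s1 p1 a0 al; set n : R := d.+1%:R; set lam := (n + s * p)%R.
have p0 : (0 < p)%R by exact: lt_le_trans p1.
have sp0 : (0 < s * p)%R by exact: mulr_gt0.
have spp : (s * p < p)%R by rewrite gtr_pMl.
have lam0 : (0 < lam)%R by rewrite /lam ltr_wpDl// ler0n.
(* Small enough that the powers lost to the logarithm keep the integrals at 0 and at infinity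
   convergent. *)
pose e := (Num.min a (lam - a) / 2)%R.
have e0 : (0 < e)%R by rewrite divr_gt0// lt_min a0 subr_gt0.
have ea : (0 < a - e)%R.
  have : (Num.min a (lam - a) <= a)%R by rewrite ge_min lexx.
  rewrite /e; lra.
have el : (0 < lam - a - e)%R.
  have : (Num.min a (lam - a) <= lam - a)%R by rewrite ge_min lexx orbT.
  have : (0 < lam - a)%R by rewrite subr_gt0.
  rewrite /e; lra.
pose g v : \bar R := (`|ln v| `^ p * v `^ (a - n))%:E.
have mg : measurable_fun setT g by rewrite /g; meas.
have g0 v : 0 <= g v by rewrite /g; pos.
pose u0 := @unit_row R d.
have un : enorm u0 = 1%R by exact: enorm_unit_row.
have u1 : (0 < enorm u0)%R by rewrite un.
have -> : \int[mu]_t ((`|t| `^ p * expR (a * t))%:E * kern d.+1 s p t) =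
    \int[mun d.+1]_y (g (enorm y) * (enorm (u0 - y) `^ (- lam))%:E).
  rewrite (@integral_bipolar R d s p u0 g u1 mg g0) un powR1 mul1e; apply: eq_integral => t _.
  rewrite mul1r /g expRK expR_powR muleA -EFinM; apply: (congr1 (fun z => z%:E * _)).
  by rewrite -mulrA -expRD; congr (_ * expR _)%R; rewrite /n; ring.
pose K := ((p / e) `^ p)%R.
pose M1 (y : 'rV[R]_d.+1) : \bar R := (enorm y `^ ((a - e) - n) * (enorm y <= 2^-1)%R%:R)%:E.
pose M2 (y : 'rV[R]_d.+1) : \bar R := (enorm y `^ (- (lam - a - e) - n) * (2 <= enorm y)%R%:R)%:E.
pose M3 (y : 'rV[R]_d.+1) : \bar R := (enorm y `^ ((p - s * p) - n) * (enorm y <= 3)%R%:R)%:E.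
pose C1 := (K * 2 `^ lam)%R; pose C3 := (2 `^ p * expR (2 * `|a - n|))%R.
have C10 : (0 <= C1)%R by rewrite /C1 /K; pos.
have C30 : (0 <= C3)%R by rewrite /C3; pos.
have men := @measurable_enorm R d.+1.
have mM1 : measurable_fun setT M1 by rewrite /M1; meas.
have mM2 : measurable_fun setT M2 by rewrite /M2; meas.
have mM3 : measurable_fun setT M3 by rewrite /M3; meas.
have mM3' : measurable_fun setT (fun y : 'rV[R]_d.+1 => M3 (u0 - y)%R).
  by apply: measurableT_comp => //; exact: measurable_subr_row.
have M10 y : 0 <= M1 y by rewrite /M1; pos.
have M20 y : 0 <= M2 y by rewrite /M2; pos.
have M30 y : 0 <= M3 y by rewrite /M3; pos.
apply: (@le_lt_trans _ _ (\int[mun d.+1]_y (C1%:E * M1 y + C1%:E * M2 y + C3%:E * M3 (u0 - y)%R))).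
  apply: integralT_le.
  - by pos.
  - apply: emeasurable_funM; first by meas.
    apply/measurable_EFinP; apply: (measurableT_comp (@measurable_powR R (- lam))).
    by apply: measurableT_comp => //; exact: measurable_subr_row.
  - by meas.
  move=> y; rewrite /M1 /M2 /M3 /g -!EFinM -!EFinD lee_fin.
  have /andP[d1 d2] := enorm_unit_sub y.
  exact: (@kern_moment_pointwise p s a n e (enorm y) (enorm (u0 - y)%R) p0 e0 lam0 (enorm_ge0 y) (enorm_ge0 _) d1 d2).
rewrite integralTD; side; rewrite integralTD; side.
rewrite !integralTZl; side.
rewrite (integral_mun_sub _ mM3 M30).
rewrite !lte_add_pinfty// lte_mul_pinfty//.
- exact: integral_enorm_le_lty.
- exact: integral_enorm_ge_lty.
- by apply: integral_enorm_le_lty => //; rewrite subr_gt0.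
Qed.

End kernel_moments.

(** * The inequality *)

Section pointwise_inequalities.
Context {R : realType}.

Lemma powR_convex (q l x y : R) : 1 <= q -> 0 <= l -> l <= 1 -> 0 <= x -> 0 <= y ->
  (l * x + (1 - l) * y) `^ q <= l * x `^ q + (1 - l) * y `^ q.
Proof.
move=> q1 l0 l1 x0 y0.
have := @convex_powR R q q1 (Itv01 l0 l1) x y.
rewrite !inE/= !in_itv/= x0 y0 => /(_ isT isT).
by rewrite !convRE.
Qed.

(** Joint convexity of (x, A) -> x^q A^(1-q): convexity of the power with weights A/(A+B) and
    B/(A+B). It gives the ground state inequalities as well as the splitting of the error in the
    sharpness part. *)
Lemma powR_perspective (q A B x y : R) : 1 <= q -> 0 < A -> 0 < B -> 0 <= x -> 0 <= y ->
  (x + y) `^ q <= (A + B) `^ (q - 1) * (A `^ (1 - q) * x `^ q + B `^ (1 - q) * y `^ q).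
Proof.
move=> q1 A0 B0 x0 y0; have AB0 : 0 < A + B by exact: addr_gt0.
have l0 : 0 <= A / (A + B) by rewrite divr_ge0// ltW.
have l1 : A / (A + B) <= 1 by rewrite ler_pdivrMr// mul1r lerDl ltW.
have x1 : 0 <= x * (A + B) / A by rewrite divr_ge0 ?mulr_ge0// ltW.
have y1 : 0 <= y * (A + B) / B by rewrite divr_ge0 ?mulr_ge0// ltW.
have := powR_convex q1 l0 l1 x1 y1.
have -> : A / (A + B) * (x * (A + B) / A) + (1 - A / (A + B)) * (y * (A + B) / B) = x + y.
  by field; rewrite !gt_eqF.
move=> /le_trans; apply; rewrite le_eqVlt; apply/orP; left; apply/eqP.
have -> : 1 - A / (A + B) = B / (A + B) by field; rewrite gt_eqF.
have T (z C : R) : 0 <= z -> 0 < C ->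
    C / (A + B) * (z * (A + B) / C) `^ q = (A + B) `^ (q - 1) * (C `^ (1 - q) * z `^ q).
  move=> z0 C0; rewrite powRM ?invr_ge0 ?(ltW C0)//; last by rewrite mulr_ge0// ltW.
  have ABn : A + B != 0 by rewrite gt_eqF.
  have Cn : C != 0 by rewrite gt_eqF.
  rewrite powRM ?(ltW AB0)// !powRB ?ABn ?Cn ?implybT//.
  rewrite !powRr1 ?ltW// -[C^-1]powR_inv1 ?ltW// -powRrM mulN1r powRN.
  by field; rewrite !gt_eqF ?powR_gt0.
by rewrite !T// mulrDr.
Qed.

(** |a| <= |a - b| + |b| with weights 1 - E and E. Equality holds at b = E a, the ratio of the
    values of |x|^-kap at y and x. *)
Lemma ground_state_pos (q E a b : R) : 1 <= q -> 0 < E -> E < 1 ->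
  (1 - E) `^ (q - 1) * `|a| `^ q <=
  `|a - b| `^ q + (1 - E) `^ (q - 1) * E `^ (1 - q) * `|b| `^ q.
Proof.
move=> q1 E0 E1; have s0 : 0 < 1 - E by rewrite subr_gt0.
have q0 : 0 <= q by exact: le_trans q1.
have := @powR_perspective q (1 - E) E `|a - b| `|b| q1 s0 E0 (normr_ge0 _) (normr_ge0 _).
rewrite subrK powR1 mul1r => h.
have : `|a| `^ q <= (`|a - b| + `|b|) `^ q.
  apply: ge0_ler_powR; rewrite ?nnegrE ?addr_ge0//.
  by rewrite -{1}(subrK b a) ler_normD.
move=> /le_trans/(_ h) {}h.
apply: (le_trans (ler_wpM2l (powR_ge0 (1 - E) (q - 1)) h)).
rewrite mulrDr !mulrA -powRD ?(gt_eqF s0) ?implybT//.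
have -> : q - 1 + (1 - q) = 0 by ring.
by rewrite powRr0 mul1r.
Qed.

(** |b| <= |a - b| + |a| with weights E - 1 and 1; equality again at b = E a. *)
Lemma ground_state_neg (q E a b : R) : 1 <= q -> 1 < E ->
  (E - 1) `^ (q - 1) * E `^ (1 - q) * `|b| `^ q <=
  `|a - b| `^ q + (E - 1) `^ (q - 1) * `|a| `^ q.
Proof.
move=> q1 E1; have s0 : 0 < E - 1 by rewrite subr_gt0.
have E0 : 0 < E by exact: lt_trans E1.
have q0 : 0 <= q by exact: le_trans q1.
have := @powR_perspective q (E - 1) 1 `|a - b| `|a| q1 s0 ltr01 (normr_ge0 _) (normr_ge0 _).
rewrite subrK powR1 mul1r => h.
have : `|b| `^ q <= (`|a - b| + `|a|) `^ q.
  apply: ge0_ler_powR; rewrite ?nnegrE ?addr_ge0//.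
  by rewrite distrC -{1}(subrK a b) ler_normD.
move=> /le_trans/(_ h) {}h.
have c0 : 0 <= (E - 1) `^ (q - 1) * E `^ (1 - q) by rewrite mulr_ge0 ?powR_ge0.
apply: (le_trans (ler_wpM2l c0 h)).
rewrite le_eqVlt; apply/orP; left; apply/eqP.
have e1 : E `^ (1 - q) * E `^ (q - 1) = 1.
  rewrite -powRD ?(gt_eqF E0) ?implybT//.
  have -> : 1 - q + (q - 1) = 0 by ring.
  by rewrite powRr0.
have e2 : (E - 1) `^ (q - 1) * (E - 1) `^ (1 - q) = 1.
  rewrite -powRD ?(gt_eqF s0) ?implybT//.
  have -> : q - 1 + (1 - q) = 0 by ring.
  by rewrite powRr0.
rewrite mulrA -[_ * _ * E `^ (q - 1)]mulrA e1 mulr1 mulrDr !mulrA e2 mul1r.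
by [].
Qed.

(** Young's inequality with exponents 1/r and 1/(1-r) for rescaled A and B: the powers of eta cancel
    in the product. For r = 1 the dual exponent is infinite and the bound is an identity. *)
Lemma young_powR (r A B eta : R) : 0 < r -> r <= 1 -> 0 <= A -> 0 <= B -> 0 < eta ->
  A `^ r * B `^ (1 - r) <= r * eta `^ (r - 1) * A + (1 - r) * eta `^ r * B.
Proof.
move=> r0; rewrite le_eqVlt => /predU1P[->|r1] A0 B0 eta0.
  by rewrite !subrr !powRr0 powRr1// !mul0r addr0 !mulr1 mul1r.
have rN : r != 0 by rewrite gt_eqF.
have r1' : 0 < 1 - r by rewrite subr_gt0.
have := @conjugate_powR R ((eta `^ (r - 1) * A) `^ r) ((eta `^ r * B) `^ (1 - r)) r^-1 (1 - r)^-1.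
rewrite !powR_ge0 !invr_gt0 r0 r1' !invrK => /(_ isT isT isT isT).
rewrite addrC subrK => /(_ erefl).
have e1 : 0 <= eta `^ (r - 1) * A by rewrite mulr_ge0// powR_ge0.
have e2 : 0 <= eta `^ r * B by rewrite mulr_ge0// powR_ge0.
rewrite -!powRrM !mulfV// ?gt_eqF// !powRr1//.
rewrite !powRM ?powR_ge0// -!powRrM.
have -> : eta `^ ((r - 1) * r) * A `^ r * (eta `^ (r * (1 - r)) * B `^ (1 - r)) =
  A `^ r * B `^ (1 - r).
  rewrite mulrACA -powRD ?(gt_eqF eta0) ?implybT//.
  have -> : (r - 1) * r + r * (1 - r) = 0 by ring.
  by rewrite powRr0 mul1r.
by move=> /le_trans; apply; rewrite le_eqVlt; apply/orP; left; apply/eqP; ring.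
Qed.
End pointwise_inequalities.

Section hardy_tools.
Context {R : realType}.
Local Notation mu := (@lebesgue_measure R).

(** The two ground state inequalities times |1 - E|^(p-q) on the cutoff region. Negative terms are
    moved across, so that each term can be integrated in [0, +oo]. At most one of the indicators of
    eps < 1 - E and eps < E - 1 is nonzero. *)
Lemma ground_state_kernel (p q E eps a b : R) : 1 <= q -> 0 < E -> 0 < eps ->
  (1 - E) `^ (p - 1) * (eps < 1 - E)%R%:R * `|a| `^ q +
  (E - 1) `^ (p - 1) * (eps < E - 1)%R%:R * E `^ (1 - q) * `|b| `^ q <=
  `|a - b| `^ q * (`|1 - E| `^ (p - q) * (eps < `|1 - E|)%R%:R) +
  ((1 - E) `^ (p - 1) * (eps < 1 - E)%R%:R * E `^ (1 - q) * `|b| `^ q +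
   (E - 1) `^ (p - 1) * (eps < E - 1)%R%:R * `|a| `^ q).
Proof.
move=> q1 E0 e0.
have comb (S : R) : 0 < S -> S `^ (p - 1) = S `^ (p - q) * S `^ (q - 1).
  by move=> S0; rewrite -powRD ?(gt_eqF S0) ?implybT//; congr (_ `^ _); ring.
have [h1|h1] := boolP (eps < 1 - E).
  have S0 : 0 < 1 - E by exact: lt_trans h1.
  have -> : (eps < E - 1) = false by apply/negbTE; rewrite -leNgt; lra.
  rewrite (gtr0_norm S0) ?h1 !mulr1 !mulr0 !mul0r !addr0 comb//.
  have E1 : E < 1 by rewrite -subr_gt0.
  have := ler_wpM2l (powR_ge0 (1 - E) (p - q)) (ground_state_pos a b q1 E0 E1).
  by rewrite mulrDr !mulrA [_ `^ (p - q) * `|a - b| `^ q]mulrC.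
have [h2|h2] := boolP (eps < E - 1).
  have S0 : 0 < E - 1 by exact: lt_trans h2.
  rewrite [`|1 - E|]distrC (gtr0_norm S0) ?h2 !mulr1 !mulr0 !mul0r !add0r comb//.
  have E1 : 1 < E by rewrite -subr_gt0.
  have := ler_wpM2l (powR_ge0 (E - 1) (p - q)) (ground_state_neg a b q1 E1).
  by rewrite mulrDr !mulrA [_ `^ (p - q) * `|a - b| `^ q]mulrC.
by rewrite !(mulr0, mul0r, add0r, addr0) !mulr_ge0 ?powR_ge0.
Qed.

(* Hoelder's inequality is used through its Young form, optimized over eta only at the very
   end: integrals may then be infinite without case analysis. *)
Lemma young_kernel (p q A S : R) (eta : R) : 1 <= q -> q <= p -> 0 <= A -> 0 < S -> 0 < eta ->
  A `^ q * S `^ (p - q) <=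
  (q / p) * eta `^ (q / p - 1) * A `^ p + (1 - q / p) * eta `^ (q / p) * S `^ p.
Proof.
move=> q1 qp A0 S0 eta0.
have q0 : 0 < q by exact: lt_le_trans q1.
have p0 : 0 < p by exact: lt_le_trans qp.
have pN : p != 0 by rewrite gt_eqF.
have r0 : 0 < q / p by rewrite divr_gt0.
have r1 : q / p <= 1 by rewrite ler_pdivrMr// mul1r.
have := young_powR r0 r1 (powR_ge0 A p) (powR_ge0 S p) eta0.
rewrite -!powRrM; apply: le_trans; rewrite le_eqVlt; apply/orP; left; apply/eqP.
by congr (_ `^ _ * _ `^ _); field.
Qed.

Local Open Scope ereal_scope.

Lemma young_optimize (r B : R) (J X : \bar R) : (0 < r)%R -> (r <= 1)%R -> (0 < B)%R ->
  0 <= J ->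
  (forall eta : R, (0 < eta)%R ->
     X <= (r * eta `^ (r - 1))%:E * J + ((1 - r) * eta `^ r * B)%:E) ->
  X <= J `^ r * (B `^ (1 - r))%:E.
Proof.
move=> r0 r1 B0; have rN : r != 0%R by rewrite gt_eqF.
case: J => [J|_ _|//]; last first.
  by rewrite poweRyr// gt0_mulye ?leey// lte_fin powR_gt0.
rewrite lee_fin le_eqVlt => /predU1P[<-|J0] H; last first.
  have JN : J != 0%R by rewrite gt_eqF.
  have BN : B != 0%R by rewrite gt_eqF.
  (* eta = J / B minimizes the right side and gives Hoelder's bound. *)
  have := H (J / B)%R (divr_gt0 J0 B0).
  rewrite -EFinM -EFinD poweR_EFin -EFinM => /le_trans; apply.
  rewrite lee_fin le_eqVlt; apply/orP; left; apply/eqP.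
  have JB : (J / B)%R != 0%R by rewrite mulf_neq0// invr_neq0.
  rewrite !powRB ?JB ?BN ?implybT// !powRr1 ?divr_ge0 ?(ltW J0) ?(ltW B0)//.
  rewrite powRM ?invr_ge0 ?(ltW J0) ?(ltW B0)//.
  have -> : (B^-1 `^ r = (B `^ r)^-1)%R.
    by rewrite -powR_inv1 ?(ltW B0)// -powRrM mulN1r powRN.
  have Br : (B `^ r != 0)%R by rewrite gt_eqF ?powR_gt0.
  by field; rewrite Br JN BN.
rewrite poweR_EFin powR0// mul0e leNgt; apply/negP => X0.
case: X X0 H => [x||//]; last first.
  move=> _ /(_ 1%R ltr01); rewrite -EFinM -EFinD leye_eq; discriminate.
rewrite lte_fin => x0 H.
(* With J = 0 the hypothesis reads x <= (1 - r) eta^r B. This eta makes the right side (1 - r) x /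
   2, which is less than x > 0. *)
pose eta := ((x / (2 * B)) `^ r^-1)%R.
have xB : (0 < x / (2 * B))%R by rewrite divr_gt0// mulr_gt0.
have eta0 : (0 < eta)%R by rewrite powR_gt0.
have := H eta eta0; rewrite -EFinM -EFinD mulr0 add0r lee_fin.
rewrite /eta -powRrM mulVf// powRr1 ?(ltW xB)//.
have -> : ((1 - r) * (x / (2 * B)) * B = (1 - r) * (x / 2))%R by field; rewrite gt_eqF.
have : (r * x > 0)%R by exact: mulr_gt0.
nra.
Qed.

(** Fatou's lemma for sequences that are stationary at each point. It removes the cutoff eps and the
    truncation of u without monotonicity or a dominating function. *)
Lemma integral_le_eventually d (T : measurableType d) (m : {measure set T -> \bar R})
    (f_ : nat -> T -> \bar R) (f : T -> \bar R) (C : \bar R) :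
  (forall k, measurable_fun setT (f_ k)) -> (forall k x, 0 <= f_ k x) ->
  (forall x, \forall k \near \oo, f_ k x = f x) ->
  (forall k, \int[m]_x f_ k x <= C) -> \int[m]_x f x <= C.
Proof.
move=> mf f0 cvf H.
have E x : limn_einf (f_ ^~ x) = f x.
  have c : f_ n x @[n --> \oo] --> f x by apply: cvg_near_cst; exact: cvf.
  by rewrite is_cvg_limn_einfE; [exact/cvg_lim|exact: cvgP c].
under eq_integral do rewrite -E.
apply: (le_trans (fatou _ _ _ _)) => //.
rewrite limn_einf_lim; apply: lime_le; first exact: is_cvg_einfs.
apply: nearW => n; apply: le_trans (H n).
by apply: ereal_inf_lbound; exists n => /=.
Qed.

(** The origin is a null set; discarding it avoids the default values of ln and of the powers at
    0. *)
Lemma integral_enorm_gt0 n (f : 'rV[R]_n.+1 -> \bar R) : measurable_fun setT f ->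
  (forall x, 0 <= f x) ->
  \int[mun n.+1]_x (f x * (0 < enorm x)%R%:R%:E) = \int[mun n.+1]_x f x.
Proof.
move=> mf f0; have men := @measurable_enorm R n.+1.
apply: ge0_ae_eq_integral => //.
- by apply: emeasurable_funM => //; meas.
- by move=> x _; rewrite mule_ge0// lee_fin.
exists [set x | (enorm x <= 0)%R]; split.
- rewrite -[X in measurable X]setTI; exact: (measurable_fun_ler men (measurable_cst _)).
- have mN : measurable [set x : 'rV[R]_n.+1 | (enorm x <= 0)%R].
    by rewrite -[X in measurable X]setTI; exact: (measurable_fun_ler men (measurable_cst _)).
  set N := [set x | _] in mN *.
  suff: mun n.+1 N = 0 by [].
  transitivity (\int[mun n.+1]_x (\1_N x)%:E); first by rewrite integral_indic// setIT.
  transitivity (\int[mun n.+1]_x ((enorm x <= 0)%R%:R)%:E : \bar R).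
    apply: eq_integral => x _; rewrite indicE.
    by rewrite (_ : (x \in N) = (enorm x <= 0)%R)//; apply/idP/idP => [/set_mem|h]; last exact/mem_set.
  rewrite (@integral_polar _ n.+1 (fun v => ((v <= 0)%R%:R)%:E) isT); side.
  rewrite integral0_eq ?mule0// => t _.
  by rewrite leNgt expR_gt0 mul0e.
- move=> x /= h; apply: contrapT => /negP; rewrite -ltNge => x0; apply: h => _.
  by rewrite x0 mule1.
Qed.

End hardy_tools.

Section hardy_inequality.
Context {R : realType}.
Local Notation mu := (@lebesgue_measure R).
Local Open Scope ereal_scope.

Definition mom d (s p c : R) (h : R -> R) : \bar R :=
  \int[mu]_t ((h t * expR (c * t))%:E * kern d s p t).

Lemma mom_ge0 d s p c h : (forall t, (0 <= h t)%R) -> 0 <= mom d.+1 s p c h.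
Proof.
move=> h0; apply: integral_ge0 => t _; apply: mule_ge0; last exact: kern_ge0.
by rewrite lee_fin mulr_ge0// expR_ge0.
Qed.

Lemma enormBC n (x y : 'rV[R]_n) : enorm (x - y) = enorm (y - x).
Proof.
rewrite !enormE; congr Num.sqrt; apply: eq_bigr => i _.
by rewrite !mxE -[LHS]sqrrN opprB.
Qed.

Lemma integral_log_kernel_out d (s p b : R) (x : 'rV[R]_d.+1) (h : R -> R) :
  (0 < enorm x)%R -> measurable_fun setT h -> (forall t, (0 <= h t)%R) ->
  \int[mun d.+1]_y (h (ln (enorm y) - ln (enorm x)) *
    (enorm y `^ b * enorm (x - y) `^ (- (d.+1%:R + s * p)) * (0 < enorm y)%R%:R))%:E =
  (enorm x `^ (b - s * p))%:E * mom d.+1 s p (d.+1%:R + b) h.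
Proof.
move=> x0 mh h0.
pose g v : \bar R := (h (ln v - ln (enorm x)) * (v `^ b * (0 < v)%R%:R))%:E.
have mg : measurable_fun setT g by rewrite /g; meas.
have g0 v : 0 <= g v by rewrite /g; pos.
transitivity (\int[mun d.+1]_y (g (enorm y) * (enorm (x - y) `^ (- (d.+1%:R + s * p)))%:E)).
  apply: eq_integral => y _; rewrite /g -EFinM; congr (_%:E).
  by rewrite -!mulrA; congr (_ * (_ * _))%R; rewrite mulrC.
rewrite (@integral_bipolar R d s p x g x0 mg g0).
have -> : (enorm x `^ (b - s * p) = enorm x `^ (- (s * p)) * enorm x `^ b)%R.
  by rewrite -powRD ?(gt_eqF x0) ?implybT// addrC.
rewrite EFinM -muleA; apply: (congr1 (mule _)).
have mk := @measurable_kern R d s p.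
have k0 t : 0 <= kern d.+1 s p t by exact: kern_ge0.
rewrite /mom -integralTZl; side.
apply: eq_integral => t _; rewrite /g.
have xt : (0 < enorm x * expR t)%R by rewrite mulr_gt0// expR_gt0.
rewrite xt mulr1 lnM ?posrE ?expR_gt0// expRK addrAC subrr add0r.
rewrite powRM ?expR_ge0 ?(ltW x0)// expR_powR !muleA -!EFinM.
apply: (congr1 (fun z => z%:E * _)); rewrite mulrDl expRD; ring.
Qed.

(** The companion formula with the roles of x and y exchanged: tau changes sign, and [kern_opp]
    replaces the exponent d + a by sp - a. *)
Lemma integral_log_kernel_in d (s p a : R) (y : 'rV[R]_d.+1) (h : R -> R) :
  (0 < enorm y)%R -> measurable_fun setT h -> (forall t, (0 <= h t)%R) ->
  \int[mun d.+1]_x (h (ln (enorm y) - ln (enorm x)) *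
    (enorm x `^ a * enorm (x - y) `^ (- (d.+1%:R + s * p)) * (0 < enorm x)%R%:R))%:E =
  (enorm y `^ (a - s * p))%:E * mom d.+1 s p (s * p - a) h.
Proof.
move=> y0 mh h0.
transitivity (\int[mun d.+1]_x ((fun t => h (- t)%R) (ln (enorm x) - ln (enorm y)) *
    (enorm x `^ a * enorm (y - x) `^ (- (d.+1%:R + s * p)) * (0 < enorm x)%R%:R))%:E).
  by apply: eq_integral => x _; rewrite opprB enormBC.
have mh' : measurable_fun setT (fun t : R => h (- t)%R) by meas.
rewrite (@integral_log_kernel_out d s p a y _ y0 mh' (fun t => h0 (- t)%R)).
apply: (congr1 (mule _)).
have mk := @measurable_kern R d s p.
have k0 t : 0 <= kern d.+1 s p t by exact: kern_ge0.
rewrite /mom -[LHS]integral_oppr; side.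
apply: eq_integral => t _; rewrite opprK kern_opp muleA -EFinM.
apply: (congr1 (fun z => z%:E * _)); rewrite -mulrA -expRD; congr (_ * expR _)%R; ring.
Qed.

Lemma integral2D d1 d2 (T1 : measurableType d1) (T2 : measurableType d2)
    (m1 : {sigma_finite_measure set T1 -> \bar R}) (m2 : {sigma_finite_measure set T2 -> \bar R})
    (f g : T1 -> T2 -> \bar R) :
  measurable_fun setT (fun z => f z.1 z.2) -> measurable_fun setT (fun z => g z.1 z.2) ->
  (forall x y, 0 <= f x y) -> (forall x y, 0 <= g x y) ->
  \int[m1]_x \int[m2]_y f x y + \int[m1]_x \int[m2]_y g x y =
  \int[m1]_x \int[m2]_y (f x y + g x y).
Proof.
move=> mf mg f0 g0.
have mx (h : T1 -> T2 -> \bar R) x : measurable_fun setT (fun z => h z.1 z.2) ->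
    measurable_fun setT (h x).
  by move=> mh; apply: (measurable_fun2 mh); meas.
rewrite -integralTD; [|exact: measurable_integral_snd|by pos|exact: measurable_integral_snd|by pos].
apply: eq_integral => x _; rewrite integralTD//; exact: mx.
Qed.

Lemma integral2_le d1 d2 (T1 : measurableType d1) (T2 : measurableType d2)
    (m1 : {sigma_finite_measure set T1 -> \bar R}) (m2 : {sigma_finite_measure set T2 -> \bar R})
    (f g : T1 -> T2 -> \bar R) :
  measurable_fun setT (fun z => f z.1 z.2) -> measurable_fun setT (fun z => g z.1 z.2) ->
  (forall x y, 0 <= f x y) -> (forall x y, f x y <= g x y) ->
  \int[m1]_x \int[m2]_y f x y <= \int[m1]_x \int[m2]_y g x y.
Proof.
move=> mf mg f0 fg.
have g0 x y : 0 <= g x y by exact: le_trans (fg x y).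
have mx (h : T1 -> T2 -> \bar R) x : measurable_fun setT (fun z => h z.1 z.2) ->
    measurable_fun setT (h x).
  by move=> mh; apply: (measurable_fun2 mh); meas.
apply: integralT_le; [by pos|exact: measurable_integral_snd|exact: measurable_integral_snd|].
by move=> x; apply: integralT_le => //; exact: mx.
Qed.

(** Hoelder for A^q and S^(p-q) against the weight W, with exponent p/q. It is applied with A = |u x
    - u y| and S = |1 - E|; the cutoff keeps S positive where the left integrand does not vanish. *)
Lemma holder_cutoff dT (T : measurableType dT) (m : {measure set T -> \bar R})
    (p q eps B : R) (A S W : T -> R) (J : \bar R) :
  (1 <= q)%R -> (q <= p)%R -> (0 < eps)%R -> (0 < B)%R ->
  measurable_fun setT A -> measurable_fun setT S -> measurable_fun setT W ->
  (forall y, (0 <= A y)%R) -> (forall y, (0 <= W y)%R) ->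
  \int[m]_y (A y `^ p * W y)%:E <= J -> \int[m]_y (S y `^ p * W y)%:E = B%:E ->
  \int[m]_y (A y `^ q * (S y `^ (p - q) * (eps < S y)%R%:R) * W y)%:E <=
  J `^ (q / p) * (B `^ (1 - q / p))%:E.
Proof.
move=> q1 qp eps0 B0 mA mS mW A0 W0 HJ HB.
have q0 : (0 < q)%R by exact: lt_le_trans q1.
have p0 : (0 < p)%R by exact: lt_le_trans qp.
have r0 : (0 < q / p)%R by rewrite divr_gt0.
have r1 : (q / p <= 1)%R by rewrite ler_pdivrMr// mul1r.
have J0 : 0 <= J by apply: le_trans HJ; pos.
apply: young_optimize => // eta eta0.
set c1 := (q / p * eta `^ (q / p - 1))%R; set c2 := ((1 - q / p) * eta `^ (q / p))%R.
have c10 : (0 <= c1)%R by rewrite mulr_ge0 ?powR_ge0// ltW.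
have c20 : (0 <= c2)%R by rewrite mulr_ge0 ?powR_ge0// subr_ge0.
apply: (@le_trans _ _ (c1%:E * \int[m]_y (A y `^ p * W y)%:E + c2%:E * B%:E)); last first.
  by rewrite -EFinM leeD2r// lee_wpmul2l.
rewrite -HB -!integralTZl; side.
rewrite -integralTD; side.
apply: integralT_le; side.
move=> y; rewrite -!EFinM -EFinD lee_fin.
have [hV|hV] := ltP eps (S y); last first.
  by rewrite !mulr0 mul0r; apply: addr_ge0; apply: mulr_ge0 => //; pos.
have S0 : (0 < S y)%R by exact: lt_trans hV.
rewrite mulr1 !mulrA -mulrDl; apply: ler_wpM2r => //.
exact: young_kernel.
Qed.

(** Subtraction in the extended reals is legitimate only for the finite terms P1 N and P2 N; M2 and
    X may be infinite. *)
Lemma cancel_finite_moments (P1 P2 M1 M2 X : \bar R) (N : R) :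
  0 <= P1 -> 0 <= P2 -> 0 <= M1 -> 0 <= M2 -> (0 <= N)%R -> P1 + M1 < +oo -> P2 < +oo ->
  (P1 + M1) * N%:E + (P2 + M2) * N%:E <= X + (P1 * N%:E + P2 * N%:E) ->
  (M1 + M2) * N%:E <= X.
Proof.
move=> P10 P20 M10 M20 N0 PM P2y; rewrite !ge0_muleDl// => h.
have P1f : P1 \is a fin_num.
  by rewrite ge0_fin_numE//; apply: (le_lt_trans _ PM); exact: leeDl.
have P2f : P2 \is a fin_num by rewrite ge0_fin_numE.
rewrite -(@leeD2rE _ (P1 * N%:E + P2 * N%:E)); last by rewrite fin_numD !fin_numM.
apply: le_trans h; rewrite addeACA.
by rewrite [M1 * _ + _]addeC [M2 * _ + _]addeC.
Qed.

Lemma hardy_finite_norm d (s p q al be : R) (u : 'rV[R]_d.+1 -> R)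
    (gam := (s * q - al - q * be / p)%R) (kap := ((d.+1%:R - gam) / q)%R)
    (Nu := \int[mun d.+1]_x (`|u x| `^ q * enorm x `^ (- gam))%:E) :
  (1 <= q)%R -> (q <= p)%R -> measurable_fun setT u ->
  Nu < +oo -> Dconst d.+1 s p be kap < +oo ->
  Dconst d.+1 s p be kap `^ (q / p) * Nu <=
  \int[mun d.+1]_x ((\int[mun d.+1]_y
     (`|u x - u y| `^ p * enorm (x - y) `^ (- (d.+1%:R + s * p)) * enorm y `^ be)%:E) `^ (q / p)
     * (enorm x `^ al)%:E).
Proof.
move=> q1 qp mU Nfin Dfin.
have q0 : (0 < q)%R by exact: lt_le_trans q1.
have p0 : (0 < p)%R by exact: lt_le_trans qp.
have qN : (q != 0)%R by rewrite gt_eqF.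
have pN : (p != 0)%R by rewrite gt_eqF.
set n : R := d.+1%:R in kap Dfin *.
set lam := (n + s * p)%R.
set r := (q / p)%R.
have r0 : (0 < r)%R by rewrite divr_gt0.
have r1 : (r <= 1)%R by rewrite ler_pdivrMr// mul1r.
set D := Dconst d.+1 s p be kap in Dfin *.
have D0 : 0 <= D by exact: Dconst_ge0.
have N0 : 0 <= Nu by rewrite /Nu; pos.
have [Dr DE] : exists Dr : R, D = Dr%:E by exists (fine D); rewrite fineK// ge0_fin_numE.
have [Nr NE] : exists Nr : R, Nu = Nr%:E by exists (fine Nu); rewrite fineK// ge0_fin_numE.
have men := @measurable_enorm R d.+1.
have mk := @measurable_kern R d s p.
have k0 t : 0 <= kern d.+1 s p t by exact: kern_ge0.
have mxy : measurable_fun setT (fun z : 'rV[R]_d.+1 * 'rV[R]_d.+1 => enorm (z.1 - z.2)).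
  apply: (measurableT_comp men); apply: measurable_fun_coordP => i.
  rewrite (_ : (fun z => _) = (fun z : 'rV[R]_d.+1 * 'rV[R]_d.+1 => (z.1 0 i - z.2 0 i)%R)); last first.
    by apply/funext => z; rewrite !mxE.
  by apply: measurable_funB; apply: (measurableT_comp (@measurable_coord R _ i));
    [exact: measurable_fst|exact: measurable_snd].
have mxy2 (x : 'rV[R]_d.+1) : measurable_fun setT (fun y : 'rV[R]_d.+1 => enorm (x - y)).
  by apply: (measurableT_comp men); exact: measurable_subr_row.
pose J x := \int[mun d.+1]_y
     (`|u x - u y| `^ p * enorm (x - y) `^ (- lam) * enorm y `^ be)%:E.
have mJ : measurable_fun setT J.
  apply: (@measurable_integral_snd _ _ _ _ _ (mun d.+1) (fun x y =>
    (`|u x - u y| `^ p * enorm (x - y) `^ (- lam) * enorm y `^ be)%:E)); side.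
have J0 x : 0 <= J x by rewrite /J; pos.
(* The end of the proof divides by a power of D; for D = 0 the claim is trivial. *)
have [D00|DN] := eqVneq D 0.
  rewrite D00 poweR0r ?gt_eqF// mul0e; apply: integral_ge0 => x _.
  by apply: mule_ge0; [exact: poweR_ge0|rewrite lee_fin powR_ge0].
have Dr0 : (0 < Dr)%R by rewrite -lte_fin -DE lt0e DN.
(* Chosen so that the factor |x|^((be - sp)(1 - r)) created by Hoelder turns |x|^a' into |x|^al. At
   the same time a' + be - sp = -gam, so the integrals of |u|^q below carry the weight of the
   right-hand side. *)
pose a' := (al - (be - s * p) * (1 - r))%R.
pose E t := expR (- kap * t).
have mE : measurable_fun setT E by rewrite /E; meas.
have E0 t : (0 < E t)%R by exact: expR_gt0.
pose G1 eps t := ((1 - E t) `^ (p - 1) * (eps < 1 - E t)%R%:R)%R.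
pose G2 eps t := ((E t - 1) `^ (p - 1) * (eps < E t - 1)%R%:R)%R.
pose V eps t := (`|1 - E t| `^ (p - q) * (eps < `|1 - E t|)%R%:R)%R.
pose F t := (E t `^ (1 - q))%R.
pose De eps := mom d.+1 s p (n + be) (fun t => (`|1 - E t| `^ p * (eps < `|1 - E t|)%R%:R)%R).
have gamE : (- gam = a' + (be - s * p))%R by rewrite /gam /a' /r; field.
have kapE : (kap * q = n - gam)%R by rewrite /kap mulfVK.
pose w (x y : 'rV[R]_d.+1) : R := (enorm x `^ a' * (0 < enorm x)%R%:R *
  (enorm y `^ be * enorm (x - y) `^ (- lam) * (0 < enorm y)%R%:R))%R.
have w0 x y : (0 <= w x y)%R by rewrite /w; pos.
pose T (x y : 'rV[R]_d.+1) := (ln (enorm y) - ln (enorm x))%R.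
have mT : measurable_fun setT (fun z => T z.1 z.2) by rewrite /T; meas.
have mw : measurable_fun setT (fun z => w z.1 z.2) by rewrite /w; meas.
(* Both double integrals of [|u|^q] against the kernel reduce to one-dimensional moments. *)
have out (h : R -> R) : measurable_fun setT h -> (forall t, (0 <= h t)%R) ->
    \int[mun d.+1]_x \int[mun d.+1]_y (h (T x y) * `|u x| `^ q * w x y)%:E =
    mom d.+1 s p (n + be) h * Nu.
  move=> mh h0.
  transitivity (\int[mun d.+1]_x (mom d.+1 s p (n + be) h *
      ((`|u x| `^ q * enorm x `^ (- gam))%:E * (0 < enorm x)%R%:R%:E))).
    apply: eq_integral => x _.
    have [x0|x0] := ltP 0%R (enorm x); last first.
      rewrite !mule0; apply: integral0_eq => y _.
      by rewrite /w ltNge x0/= mulr0 mul0r mulr0.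
    transitivity (\int[mun d.+1]_y ((`|u x| `^ q * enorm x `^ a')%:E *
       (h (T x y) * (enorm y `^ be * enorm (x - y) `^ (- lam) * (0 < enorm y)%R%:R))%:E)).
      have reg (a b a1 b1 : R) : (a * b * (a1 * b1) = b * a1 * (a * b1))%R by ring.
      by apply: eq_integral => y _; rewrite -EFinM /w x0 mulr1 reg.
    rewrite integralTZl; [|by rewrite /T; have m2 := mxy2 x; meas|by rewrite /T; pos|by pos].
    rewrite (@integral_log_kernel_out d s p be x h x0 mh h0).
    rewrite mule1 muleA -EFinM muleC; apply: (congr1 (mule _)); congr (_%:E).
    by rewrite gamE -mulrA -powRD ?(gt_eqF x0) ?implybT.
  rewrite integralTZl; [|by meas|by pos|exact: mom_ge0].
  apply: (congr1 (mule _)); rewrite /Nu -[RHS]integral_enorm_gt0//; [by meas|by pos].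
have inn (h : R -> R) : measurable_fun setT h -> (forall t, (0 <= h t)%R) ->
    \int[mun d.+1]_x \int[mun d.+1]_y (h (T x y) * `|u y| `^ q * w x y)%:E =
    mom d.+1 s p (s * p - a') h * Nu.
  move=> mh h0.
  transitivity (\int[mun d.+1]_y \int[mun d.+1]_x (h (T x y) * `|u y| `^ q * w x y)%:E).
    by apply: integralT_swap; side.
  transitivity (\int[mun d.+1]_x (mom d.+1 s p (s * p - a') h *
      ((`|u x| `^ q * enorm x `^ (- gam))%:E * (0 < enorm x)%R%:R%:E))).
    apply: eq_integral => y _.
    have [y0|y0] := ltP 0%R (enorm y); last first.
      rewrite !mule0; apply: integral0_eq => x _.
      by rewrite /w [(0 < enorm y)%R]ltNge y0/= !mulr0.
    transitivity (\int[mun d.+1]_x ((`|u y| `^ q * enorm y `^ be)%:E *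
       (h (T x y) * (enorm x `^ a' * enorm (x - y) `^ (- lam) * (0 < enorm x)%R%:R))%:E)).
      have reg (a b a1 z b1 c1 : R) : (a * b * (a1 * z * (b1 * c1)) = b * b1 * (a * (a1 * c1 * z)))%R by ring.
      by apply: eq_integral => x _; rewrite -EFinM /w y0 mulr1 reg.
    have mxy1 : measurable_fun setT (fun x : 'rV[R]_d.+1 => enorm (x - y)).
      by have := mxy2 y; under eq_fun do rewrite enormBC.
    rewrite integralTZl; [|by rewrite /T; meas|by rewrite /T; pos|by pos].
    rewrite (@integral_log_kernel_in d s p a' y h y0 mh h0).
    rewrite mule1 muleA -EFinM muleC; apply: (congr1 (mule _)); congr (_%:E).
    rewrite -mulrA -powRD ?(gt_eqF y0) ?implybT//; congr (_ * _ `^ _)%R.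
    by rewrite gamE; ring.
  rewrite integralTZl; [|by meas|by pos|exact: mom_ge0].
  apply: (congr1 (mule _)); rewrite /Nu -[RHS]integral_enorm_gt0//; [by meas|by pos].
have main eps : (0 < eps)%R -> De eps * Nu <= (Dr `^ (1 - r))%:E * \int[mun d.+1]_x (J x `^ r * (enorm x `^ al)%:E).
  move=> eps0.
  have mG1 : measurable_fun setT (G1 eps) by rewrite /G1; meas.
  have mG2 : measurable_fun setT (G2 eps) by rewrite /G2; meas.
  have mV : measurable_fun setT (V eps) by rewrite /V; meas.
  have mF : measurable_fun setT F by rewrite /F; meas.
  have G10 t : (0 <= G1 eps t)%R by rewrite /G1; pos.
  have G20 t : (0 <= G2 eps t)%R by rewrite /G2; pos.
  have V0 t : (0 <= V eps t)%R by rewrite /V; pos.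
  have F0 t : (0 <= F t)%R by rewrite /F; pos.
  pose c := (n + be)%R.
  have mommeas (c' : R) (h : R -> R) : measurable_fun setT h ->
      measurable_fun setT (fun t => (h t * expR (c' * t))%:E * kern d.+1 s p t).
    by move=> mh; meas.
  have momD (c' : R) (h1 h2 h3 : R -> R) : measurable_fun setT h1 -> measurable_fun setT h2 ->
      (forall t, (0 <= h1 t)%R) -> (forall t, (0 <= h2 t)%R) ->
      (forall t, h3 t = h1 t + h2 t)%R ->
      mom d.+1 s p c' h3 = mom d.+1 s p c' h1 + mom d.+1 s p c' h2.
    move=> m1 m2 h10 h20 h3E; rewrite /mom -integralTD; side.
    apply: eq_integral => t _; rewrite h3E mulrDl EFinD ge0_muleDl// lee_fin.
      by pos.
    by pos.
  (* [M1] and [M2] are the parts of the truncated constant over E < 1 and E > 1. They are what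
     remains once the |a|^q and |b|^q moments cancel. *)
  pose M1 := mom d.+1 s p c (fun t => G1 eps t * (1 - E t))%R.
  pose M2 := mom d.+1 s p c (fun t => G2 eps t * (E t - 1))%R.
  have G1E t : (0 <= G1 eps t * (1 - E t))%R.
    rewrite /G1; case: (boolP (eps < 1 - E t)%R) => h; last by rewrite mulr0 mul0r.
    by rewrite mulr1 mulr_ge0 ?powR_ge0// ltW// (lt_trans eps0).
  have G2E t : (0 <= G2 eps t * (E t - 1))%R.
    rewrite /G2; case: (boolP (eps < E t - 1)%R) => h; last by rewrite mulr0 mul0r.
    by rewrite mulr1 mulr_ge0 ?powR_ge0// ltW// (lt_trans eps0).
  (* The exponents match: this is where the homogeneity of the weights enters. *)
  have shiftF (h : R -> R) : mom d.+1 s p (s * p - a') (fun t => h t * F t)%R =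
      mom d.+1 s p c (fun t => h t * E t)%R.
    apply: eq_integral => t _; apply: (congr1 (fun z => z%:E * _)).
    rewrite -!mulrA; congr (_ * _)%R; rewrite /F /E expR_powR -!expRD; congr expR.
    have -> : (s * p - a' = n + be - kap * q)%R by rewrite kapE -[gam]opprK gamE; ring.
    by rewrite /c; ring.
  have id1 : mom d.+1 s p c (G1 eps) =
      mom d.+1 s p (s * p - a') (fun t => G1 eps t * F t)%R + M1.
    rewrite shiftF; apply: momD => //; [by meas|by meas| |].
    - by move=> t; rewrite mulr_ge0// ltW.
    - by move=> t; ring.
  have id2 : mom d.+1 s p (s * p - a') (fun t => G2 eps t * F t)%R =
      mom d.+1 s p c (G2 eps) + M2.
    by rewrite shiftF; apply: momD => //; [by meas|move=> t; ring].
  have idE : De eps = M1 + M2.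
    apply: momD => //; [by meas|by meas|move=> t; rewrite /G1 /G2].
    have pp (z : R) : (0 < z)%R -> (z `^ p = z `^ (p - 1) * z)%R.
      by move=> z0; rewrite mulrC mulr_powRB1// ltW.
    case: (boolP (eps < 1 - E t)%R) => h1.
      have S0 : (0 < 1 - E t)%R by exact: lt_trans h1.
      have -> : (eps < E t - 1)%R = false by apply/negbTE; rewrite -leNgt; lra.
      by rewrite (gtr0_norm S0) h1 !mulr1 !mulr0 mul0r addr0 pp.
    case: (boolP (eps < E t - 1)%R) => h2.
      have S0 : (0 < E t - 1)%R by exact: lt_trans h2.
      by rewrite distrC (gtr0_norm S0) h2 !mulr1 !mulr0 mul0r add0r pp.
    have -> : (eps < `|1 - E t|)%R = false.
      by apply/negbTE; move: h1 h2; rewrite -!leNgt ler_norml => h1 h2; apply/andP; split; lra.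
    by rewrite !mulr0 !mul0r addr0.
  (* On |1 - E| > eps one has |1 - E|^(p-1) <= |1 - E|^p / eps, so these moments are bounded by D /
     eps. *)
  have Gfin (h : R -> R) : measurable_fun setT h -> (forall t, (0 <= h t)%R) ->
      (forall t, h t <= eps^-1 * `|1 - E t| `^ p)%R -> mom d.+1 s p c h < +oo.
    move=> mh h0 hle; apply: (@le_lt_trans _ _ ((eps^-1)%:E * D)); last first.
      by rewrite lte_mul_pinfty// lee_fin invr_ge0 ltW.
    rewrite /D /Dconst -integralTZl; side.
    apply: integralT_le; side.
    move=> t; rewrite muleA -EFinM; apply: lee_wpmul2r; first exact: k0.
    rewrite lee_fin [leLHS]mulrC mulrCA; apply: ler_wpM2l; first exact: expR_ge0.
    exact: hle.
  have G1fin : mom d.+1 s p c (G1 eps) < +oo.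
    apply: Gfin => // t; rewrite /G1.
    case: (boolP (eps < 1 - E t)%R) => h1; last by rewrite mulr0; pos; rewrite ltW.
    have S0 : (0 < 1 - E t)%R by exact: lt_trans h1.
    rewrite mulr1 (gtr0_norm S0) -(mulr_powRB1 (ltW S0) p0) mulrA ler_peMl ?powR_ge0//.
    by rewrite -ler_pdivrMl ?invr_gt0// invrK mulr1 ltW.
  have G2fin : mom d.+1 s p c (G2 eps) < +oo.
    apply: Gfin => // t; rewrite /G2.
    case: (boolP (eps < E t - 1)%R) => h1; last by rewrite mulr0; pos; rewrite ltW.
    have S0 : (0 < E t - 1)%R by exact: lt_trans h1.
    rewrite mulr1 distrC (gtr0_norm S0) -(mulr_powRB1 (ltW S0) p0) mulrA ler_peMl ?powR_ge0//.
    by rewrite -ler_pdivrMl ?invr_gt0// invrK mulr1 ltW.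
  pose Xt := \int[mun d.+1]_x \int[mun d.+1]_y (`|u x - u y| `^ q * V eps (T x y) * w x y)%:E.
  pose f1 x y : \bar R := (G1 eps (T x y) * `|u x| `^ q * w x y)%:E.
  pose f2 x y : \bar R := (G2 eps (T x y) * F (T x y) * `|u y| `^ q * w x y)%:E.
  pose f3 x y : \bar R := (G1 eps (T x y) * F (T x y) * `|u y| `^ q * w x y)%:E.
  pose f4 x y : \bar R := (G2 eps (T x y) * `|u x| `^ q * w x y)%:E.
  pose f5 x y : \bar R := (`|u x - u y| `^ q * V eps (T x y) * w x y)%:E.
  have mf1 : measurable_fun setT (fun z => f1 z.1 z.2) by rewrite /f1; meas.
  have mf2 : measurable_fun setT (fun z => f2 z.1 z.2) by rewrite /f2; meas.
  have mf3 : measurable_fun setT (fun z => f3 z.1 z.2) by rewrite /f3; meas.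
  have mf4 : measurable_fun setT (fun z => f4 z.1 z.2) by rewrite /f4; meas.
  have mf5 : measurable_fun setT (fun z => f5 z.1 z.2) by rewrite /f5; meas.
  have f10 x y : 0 <= f1 x y by rewrite /f1; pos.
  have f20 x y : 0 <= f2 x y by rewrite /f2; pos.
  have f30 x y : 0 <= f3 x y by rewrite /f3; pos.
  have f40 x y : 0 <= f4 x y by rewrite /f4; pos.
  have f50 x y : 0 <= f5 x y by rewrite /f5; pos.
  have key x y : f1 x y + f2 x y <= f5 x y + (f3 x y + f4 x y).
    rewrite /f1 /f2 /f3 /f4 /f5 -!EFinD lee_fin -!mulrDl; apply: ler_wpM2r; first exact: w0.
    exact: (ground_state_kernel p (u x) (u y) q1 (E0 (T x y)) eps0).
  have I1 : \int[mun d.+1]_x \int[mun d.+1]_y f1 x y = mom d.+1 s p c (G1 eps) * Nu := out _ mG1 G10.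
  have mGF2 : measurable_fun setT (fun t => G2 eps t * F t)%R by meas.
  have mGF1 : measurable_fun setT (fun t => G1 eps t * F t)%R by meas.
  have GF20 t : (0 <= G2 eps t * F t)%R by pos.
  have GF10 t : (0 <= G1 eps t * F t)%R by pos.
  have I2 : \int[mun d.+1]_x \int[mun d.+1]_y f2 x y = mom d.+1 s p (s * p - a') (fun t => G2 eps t * F t)%R * Nu := inn _ mGF2 GF20.
  have I3 : \int[mun d.+1]_x \int[mun d.+1]_y f3 x y = mom d.+1 s p (s * p - a') (fun t => G1 eps t * F t)%R * Nu := inn _ mGF1 GF10.
  have I4 : \int[mun d.+1]_x \int[mun d.+1]_y f4 x y = mom d.+1 s p c (G2 eps) * Nu := out _ mG2 G20.
  have I5 : \int[mun d.+1]_x \int[mun d.+1]_y f5 x y = Xt by [].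
  clearbody f1 f2 f3 f4 f5.
  have sumle (a1 a2 a3 a4 : \bar R) :
      \int[mun d.+1]_x \int[mun d.+1]_y f1 x y = a1 -> \int[mun d.+1]_x \int[mun d.+1]_y f2 x y = a2 ->
      \int[mun d.+1]_x \int[mun d.+1]_y f3 x y = a3 -> \int[mun d.+1]_x \int[mun d.+1]_y f4 x y = a4 ->
      a1 + a2 <= Xt + (a3 + a4).
    move=> <- <- <- <-; rewrite -I5.
    rewrite (integral2D (mun d.+1) (mun d.+1) mf1 mf2 f10 f20) (integral2D (mun d.+1) (mun d.+1) mf3 mf4 f30 f40).
    have m34 : measurable_fun setT (fun z => f3 z.1 z.2 + f4 z.1 z.2) by meas.
    have p34 x y : 0 <= f3 x y + f4 x y by rewrite adde_ge0.
    rewrite (@integral2D _ _ _ _ (mun d.+1) (mun d.+1) f5 (fun x y => f3 x y + f4 x y) mf5 m34 f50 p34).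
    apply: integral2_le; [by meas|by meas| |exact: key].
    by move=> x y; rewrite adde_ge0.
  have {}sumle := sumle _ _ _ _ I1 I2 I3 I4.
  have XtN : De eps * Nu <= Xt.
    have Nr0 : (0 <= Nr)%R by rewrite -lee_fin -NE.
    have PM := G1fin; rewrite id1 in PM.
    rewrite id1 id2 NE in sumle; rewrite idE NE.
    by apply: (cancel_finite_moments _ _ _ _ Nr0 PM G2fin sumle); exact: mom_ge0.
  apply: (le_trans XtN); rewrite /Xt -integralTZl; [|by meas|by pos|by pos].
  have mXt : measurable_fun setT (fun x : 'rV[R]_d.+1 => \int[mun d.+1]_y (`|u x - u y| `^ q * V eps (T x y) * w x y)%:E).
    apply: (@measurable_integral_snd _ _ _ _ _ (mun d.+1) (fun x y : 'rV[R]_d.+1 =>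
      (`|u x - u y| `^ q * V eps (T x y) * w x y)%:E)); side.
  apply: integralT_le; [by pos|exact: mXt|by meas|].
  move=> x; have [x0|x0] := ltP 0%R (enorm x); last first.
    rewrite integral0_eq; first by pos.
    by move=> y _; rewrite /w ltNge x0/= mulr0 mul0r mulr0.
  have m2 := mxy2 x.
  pose W y := (enorm y `^ be * enorm (x - y) `^ (- lam) * (0 < enorm y)%R%:R)%R.
  have W0 y : (0 <= W y)%R by rewrite /W; pos.
  have mW : measurable_fun setT W by rewrite /W; meas.
  have mTx : measurable_fun setT (T x) by rewrite /T; meas.
  pose X := \int[mun d.+1]_y (`|u x - u y| `^ q * V eps (T x y) * W y)%:E.
  have -> : \int[mun d.+1]_y (`|u x - u y| `^ q * V eps (T x y) * w x y)%:E = (enorm x `^ a')%:E * X.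
    rewrite /X -integralTZl; [|by meas|by pos|by pos].
    by apply: eq_integral => y _; rewrite -EFinM /w /W x0 mulr1 mulrCA.
  (* The integral over y of |1 - E|^p against the kernel and |y|^be, equal to D up to the scaling in
     |x|. *)
  pose B := (enorm x `^ (be - s * p) * Dr)%R.
  have B0 : (0 < B)%R by rewrite mulr_gt0// powR_gt0.
  have XJ : X <= J x `^ r * (B `^ (1 - r))%:E.
    pose h t := (`|1 - E t| `^ p)%R.
    have mh : measurable_fun setT h by rewrite /h; meas.
    have h0 t : (0 <= h t)%R by rewrite /h; pos.
    have BE : \int[mun d.+1]_y (h (T x y) * W y)%:E = B%:E.
      rewrite (@integral_log_kernel_out d s p be x h x0 mh h0) /B EFinM -DE.
      apply: (congr1 (mule _)); apply: eq_integral => t _.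
      by rewrite [(h t * _)%R]mulrC.
    have mA : measurable_fun setT (fun y => `|u x - u y|%R) by meas.
    have mS : measurable_fun setT (fun y => `|1 - E (T x y)|%R) by meas.
    apply: (holder_cutoff q1 qp eps0 B0 mA mS mW _ W0 _ BE); first by move=> y; exact: normr_ge0.
    rewrite /J; apply: integralT_le; [by pos|by meas|by meas|move=> y].
    rewrite lee_fin -mulrA; apply: ler_wpM2l; first exact: powR_ge0.
    rewrite /W mulrC [leRHS]mulrC mulrCA mulrA.
    by case: (ltP 0%R (enorm y)) => _; rewrite ?mulr1 ?mulr0 ?mul0r ?mul1r// mulr_ge0 ?powR_ge0.
  apply: (@le_trans _ _ ((enorm x `^ a')%:E * (J x `^ r * (B `^ (1 - r))%:E))).
    by rewrite lee_wpmul2l// lee_fin powR_ge0.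
  rewrite le_eqVlt; apply/orP; left; apply/eqP.
  rewrite muleCA [RHS]muleCA; apply: (congr1 (mule _)); rewrite -!EFinM; congr (_%:E).
  rewrite /B powRM ?powR_ge0 ?(ltW Dr0)// -powRrM mulrA -powRD ?(gt_eqF x0) ?implybT//.
  by rewrite mulrC; congr (_ * _ `^ _)%R; rewrite /a'; ring.
set L := \int[mun d.+1]_x (J x `^ r * (enorm x `^ al)%:E) in main.
(* Let eps = 1/(k+1) tend to 0: at each t the cutoff is eventually inactive, or else |1 - E| = 0 and
   both integrands vanish. *)
have DNu : D * Nu <= (Dr `^ (1 - r))%:E * L.
  pose f t := (expR ((n + be) * t) * `|1 - E t| `^ p)%:E * kern d.+1 s p t * Nu.
  pose g (k : nat) t := ((`|1 - E t| `^ p * (k.+1%:R^-1 < `|1 - E t|)%R%:R) * expR ((n + be) * t))%:E *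
    kern d.+1 s p t * Nu.
  have -> : D * Nu = \int[mu]_t f t.
    by rewrite /D /Dconst -integralTZr; [|by meas|by pos|exact: N0].
  apply: (@integral_le_eventually _ _ _ mu g).
  - by move=> k; rewrite /g; meas.
  - by move=> k t; rewrite /g; apply: mule_ge0 => //; apply: mule_ge0 => //; pos.
  - move=> t; have [h0|h0] := eqVneq (`|1 - E t|)%R 0%R.
      by apply: nearW => k; rewrite /f /g h0 powR0// !mul0r mulr0.
    have hp : (0 < `|1 - E t|)%R by rewrite lt_neqAle eq_sym h0 normr_ge0.
    have := near_infty_natSinv_lt (PosNum hp); apply: filterS => k /= hk.
    by rewrite /f /g hk mulr1 [(_ * expR _)%R]mulrC.
  - move=> k; have k0' : (0 < k.+1%:R^-1 :> R)%R by rewrite invr_gt0.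
    have := main _ k0'; congr (_ <= _).
    rewrite /De /mom -integralTZr; [by []|by meas|by pos|exact: N0].
suff: D `^ r * Nu <= L by [].
(* It remains to divide by D^(1-r), which is positive and finite. *)
have -> : D `^ r * Nu = (Dr `^ (r - 1))%:E * (D * Nu).
  rewrite DE poweR_EFin muleA -EFinM; apply: (congr1 (fun z => z%:E * Nu)).
  by rewrite mulrC mulr_powRB1// ltW.
have -> : L = (Dr `^ (r - 1))%:E * ((Dr `^ (1 - r))%:E * L).
  rewrite muleA -EFinM -powRD ?(gt_eqF Dr0) ?implybT//.
  have -> : (r - 1 + (1 - r) = 0)%R by ring.
  by rewrite powRr0 mul1e.
by apply: lee_wpmul2l => //; rewrite lee_fin powR_ge0.
Qed.

End hardy_inequality.

(** * Finiteness of the constant *)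

Section constant_finite.
Context {R : realType}.
Local Notation mu := (@lebesgue_measure R).

Lemma norm_one_sub_expR (z : R) : `|1 - expR z| <= `|z| * (1 + expR z).
Proof.
have e0 := expR_gt0 z.
have [z0|z0] := leP 0 z.
  have h1 : expR z - 1 <= z * expR z.
    have := expR_ge1Dx (- z) => h.
    have : (1 - z) * expR z <= 1.
      by rewrite -(@ler_pM2r _ (expR (- z))) ?expR_gt0// -mulrA -expRD subrr expR0 mul1r mulr1.
    by lra.
  rewrite distrC !ger0_norm ?subr_ge0 -?expR0 ?ler_expR//.
  by rewrite expR0 mulrDr; lra.
have h1 := expR_ge1Dx z.
have e1 : expR z < 1 by rewrite -expR0 ltr_expR.
rewrite (ltr0_norm z0) [`|1 - expR z|]gtr0_norm ?subr_gt0//.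
by nra.
Qed.

Lemma powR_1D_le (p x : R) : 0 <= p -> 0 <= x -> (1 + x) `^ p <= 2 `^ p * (1 + x `^ p).
Proof.
move=> p0 x0.
have [x1|x1] := leP x 1.
  apply: (@le_trans _ _ (2 `^ p)); first by apply: ge0_ler_powR; rewrite ?nnegrE ?addr_ge0//; lra.
  by rewrite ler_peMr ?powR_ge0// lerDl powR_ge0.
apply: (@le_trans _ _ ((2 * x) `^ p)).
  by apply: ge0_ler_powR; rewrite ?nnegrE ?addr_ge0 ?mulr_ge0//; lra.
by rewrite powRM// ler_wpM2l ?powR_ge0// lerDr.
Qed.

Local Open Scope ereal_scope.

(** |1 - e^z| <= |z| (1 + e^z) at z = -kap t bounds the integrand by moments with exponents d + be
    and d + be - p kap. The four hypotheses place both in ]0, d + sp[. *)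
Lemma Dconst_lty d (s p be kap : R) : (0 < s)%R -> (s < 1)%R -> (1 <= p)%R ->
  (0 < d.+1%:R + be)%R -> (be < s * p)%R ->
  (0 < d.+1%:R + be - p * kap)%R -> (be - p * kap < s * p)%R ->
  Dconst d.+1 s p be kap < +oo.
Proof.
move=> s0 s1 p1 h1 h2 h3 h4.
have p0 : (0 < p)%R by exact: lt_le_trans p1.
set a1 := (d.+1%:R + be)%R in h1 *; set a2 := (d.+1%:R + be - p * kap)%R in h3.
have I1 : \int[mu]_t ((`|t| `^ p * expR (a1 * t))%:E * kern d.+1 s p t) < +oo.
  by apply: kern_moment_lty => //; rewrite /a1 ltrD2l.
have I2 : \int[mu]_t ((`|t| `^ p * expR (a2 * t))%:E * kern d.+1 s p t) < +oo.
  by apply: kern_moment_lty => //; rewrite /a2 -addrA ltrD2l.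
have mk := @measurable_kern R d s p.
have k0 t : 0 <= kern d.+1 s p t by exact: kern_ge0.
pose K := (`|kap| `^ p * 2 `^ p)%R.
have K0 : (0 <= K)%R by rewrite mulr_ge0 ?powR_ge0.
apply: (@le_lt_trans _ _ (K%:E * (\int[mu]_t ((`|t| `^ p * expR (a1 * t))%:E * kern d.+1 s p t) +
  \int[mu]_t ((`|t| `^ p * expR (a2 * t))%:E * kern d.+1 s p t)))); last first.
  by rewrite lte_mul_pinfty// lte_add_pinfty.
rewrite -integralTD; side; rewrite -integralTZl; side.
apply: integralT_le; side.
move=> t; rewrite -ge0_muleDl ?lee_fin; [|by pos|by pos].
rewrite -EFinD muleA -EFinM; apply: lee_wpmul2r => //; rewrite lee_fin.
have -> : (a2 * t = a1 * t + p * (- kap * t))%R by rewrite /a2 /a1; ring.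
rewrite expRD -[expR (p * _)]expR_powR /K.
set x := expR (- kap * t).
have -> : (`|kap| `^ p * 2 `^ p * (`|t| `^ p * expR (a1 * t) + `|t| `^ p * (expR (a1 * t) * x `^ p)) =
  expR (a1 * t) * ((`|kap| * `|t|) `^ p * (2 `^ p * (1 + x `^ p))))%R.
  by rewrite powRM//; ring.
apply: ler_wpM2l; first exact: expR_ge0.
apply: (@le_trans _ _ ((`|kap| * `|t|) `^ p * (1 + x) `^ p)%R); last first.
  by apply: ler_wpM2l; [exact: powR_ge0|apply: powR_1D_le; [exact: ltW|exact: expR_ge0]].
rewrite -powRM ?mulr_ge0 ?addr_ge0 ?expR_ge0//.
apply: ge0_ler_powR; rewrite ?nnegrE ?(ltW p0) ?mulr_ge0 ?addr_ge0 ?expR_ge0//.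
by have := norm_one_sub_expR (- kap * t); rewrite normrM normrN.
Qed.

End constant_finite.

(** * Functions in C_c^1 *)

Section separate_continuity.
Context {R : realType}.

Lemma floor_grid_cvg (a : R) :
  (Num.floor (k.+1%:R * a))%:~R / k.+1%:R - a @[k --> \oo] --> (0 : R).
Proof.
apply/cvgrPdist_lt => e e0.
have := near_infty_natSinv_lt (PosNum e0); apply: filterS => k /= ke.
have k0 : 0 < k.+1%:R :> R by [].
rewrite sub0r normrN; apply: le_lt_trans ke.
have /andP[h1 h2] := floor_itv (k.+1%:R * a).
have -> : (Num.floor (k.+1%:R * a))%:~R / k.+1%:R - a =
    ((Num.floor (k.+1%:R * a))%:~R - k.+1%:R * a) / k.+1%:R :> R by field.
rewrite normrM [X in _ * X]ger0_norm ?invr_ge0// ler_piMl ?invr_ge0//.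
rewrite ler_norml; apply/andP; split; move: h1 h2; rewrite intrD; lra.
Qed.

(* The partial derivatives only give continuity along the axes. This suffices: u is the limit of
   the functions obtained by discretizing its first coordinate. *)
Lemma measurable_separately_continuous n (u : 'rV[R]_n -> R) :
  (forall x i, u (h *: delta_mx 0 i + x) @[h --> (0 : R)] --> u x) ->
  measurable_fun setT u.
Proof.
elim: n u => [|n ih] u cu.
  rewrite (_ : u = cst (u 0)); first exact: measurable_cst.
  by apply/funext => x; rewrite (thinmx0 x).
have shift a b (v : 'rV[R]_n) : rcons_row a v = (a - b) *: delta_mx 0 ord0 + rcons_row b v.
  apply/rowP => i; rewrite !mxE eqxx/=.
  case: unliftP => [j ->|->]; first by rewrite mulr0 add0r.
  by rewrite eqxx mulr1 subrK.
have slice a : measurable_fun setT (fun v => u (rcons_row a v)).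
  apply: ih => v i.
  rewrite (_ : (fun h => _) = (fun h => u (h *: delta_mx 0 (lift ord0 i) + rcons_row a v))); first exact: cu.
  apply/funext => h; congr u; apply/rowP => j; rewrite !mxE eqxx/=.
  case: unliftP => [j' ->|->]; last by rewrite mulr0 add0r.
  by rewrite !mxE eqxx/= (inj_eq lift_inj).
apply: (@measurable_fun_cvg _ _ _ _ (fun k x =>
  u (rcons_row ((Num.floor (k.+1%:R * head_row x))%:~R / k.+1%:R) (tail_row x)))).
  move=> k.
  (* Where the integer part of (k+1) x_0 is constant, the discretized function depends on the tail
     alone and is measurable by induction; countably many such sets cover the space. *)
  pose E i : set 'rV[R]_n.+1 :=
    if unpickle i is Some z then [set x | Num.floor (k.+1%:R * head_row x) = z] else set0.
  have mE i : measurable (E i).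
    rewrite /E; case: (unpickle i) => [z|//].
    have mh : measurable_fun setT (fun x : 'rV[R]_n.+1 => k.+1%:R * head_row x).
      by apply: measurable_funM => //; exact: measurable_head_row.
    have := mh measurableT _ (measurable_itv (`[z%:~R, (z + 1)%:~R[)).
    rewrite setTI; congr (measurable _); apply/seteqP; split => x /=; rewrite in_itv/=.
      exact: floor_def.
    by move=> <-; exact: floor_itv.
  have -> : [set: 'rV[R]_n.+1] = \bigcup_i E i.
    apply/esym; rewrite -subTset => x _; exists (pickle (Num.floor (k.+1%:R * head_row x))); first exact: I.
    by rewrite /E pickleK.
  apply/measurable_fun_bigcup => // i; rewrite /E; case: (unpickle i) => [z|]; last exact: measurable_fun_set0.
  apply: (@eq_measurable_fun _ _ _ _ _ (fun x => u (rcons_row (z%:~R / k.+1%:R) (tail_row x)))).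
    by move=> x; rewrite inE/= => ->.
  apply: (@measurable_funS _ _ _ _ setT) => //.
  exact: (measurableT_comp (slice _) (@measurable_tail_row _ _)).
move=> x _.
rewrite (_ : (fun k => _) = (fun h => u (h *: delta_mx 0 ord0 + x)) \o
  (fun k => (Num.floor (k.+1%:R * head_row x))%:~R / k.+1%:R - head_row x)); last first.
  by apply/funext => k /=; rewrite [rcons_row _ _](shift _ (head_row x)) rcons_rowK.
apply: cvg_comp; last exact: (cu x ord0).
exact: floor_grid_cvg.
Qed.

Lemma sqn_continuous n : continuous (@sqn R n).
Proof.
have ca : continuous (fun z : R * R => z.1 + z.2) by exact: add_continuous.
have ci (i : 'I_n) : true -> continuous (fun x : 'rV[R]_n => x 0 i ^+ 2).
  move=> _ y.
  by apply: (@continuous_comp _ _ _ (fun x : 'rV[R]_n => x 0 i) (fun t => t ^+ 2));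
    [exact: coord_continuous|exact: exprn_continuous].
exact: (@continuous_big R 'I_n +%R 0 xpredT ca 'rV[R]_n (index_enum 'I_n) _ ci).
Qed.

Lemma enorm_continuous n : continuous (@enorm R n).
Proof.
move=> x; apply: (@continuous_comp _ _ _ (@sqn R n) Num.sqrt); first exact: sqn_continuous.
exact: sqrt_continuous.
Qed.

Lemma enorm_compact_bounded n (K : set 'rV[R]_n) : compact K ->
  exists b : R, 0 < b /\ forall x, K x -> enorm x <= b.
Proof.
move=> cK.
have : compact (@enorm R n @` K).
  by apply: continuous_compact => //; apply: continuous_subspaceT; exact: enorm_continuous.
move/compact_bounded => -[M [_ HM]].
exists (Num.max M 0 + 1); split; first by rewrite ltr_wpDl// le_max lexx orbT.
have h : M < Num.max M 0 + 1 by rewrite ltr_pwDr// le_max lexx.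
move=> x Kx; have /= := HM _ h (enorm x) (ex_intro2 _ _ x Kx erefl).
by rewrite ger0_norm// enorm_ge0.
Qed.

Lemma enorm_compact_ge n (K : set 'rV[R]_n) : compact K -> ~ K 0 ->
  exists b : R, 0 < b /\ forall x, K x -> b <= enorm x.
Proof.
move=> cK K0.
have : nbhs (0 : 'rV[R]_n) (~` K).
  by apply: open_nbhs_nbhs; split => //; apply: closed_openC; apply: compact_closed => //; exact: norm_hausdorff.
rewrite -nbhs_ballE => -[e /= e0 he].
exists e; split => // x Kx; rewrite leNgt; apply/negP => xe.
apply: (he x) => //; split => // i j; rewrite ord1 mxE /ball/= sub0r normrN.
by apply: le_lt_trans xe; exact: coord_le_enorm.
Qed.

(** In U this follows from differentiability along the axes. Outside U, the complement of the
    compact K is a neighbourhood of the point on which u vanishes. *)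
Lemma C1c_separately_continuous n (U : set 'rV[R]_n) (u : 'rV[R]_n -> R) : C1c_on U u ->
  forall x i, u (h *: delta_mx 0 i + x) @[h --> (0 : R)] --> u x.
Proof.
move=> [du _ [K [cK KU uK]]] x i.
have [Ux|Ux] := pselect (U x).
  have /derivable1P/derivable1_diffP/differentiable_continuous := du x Ux i.
  by rewrite /prop_for /continuous_at /= scale0r add0r.
have Kx : ~ K x by move/KU.
have nK : nbhs x (~` K).
  by apply: open_nbhs_nbhs; split => //; apply: closed_openC; apply: compact_closed => //; exact: norm_hausdorff.
rewrite (uK x Kx).
have cx : (h *: delta_mx 0 i + x : 'rV[R]_n) @[h --> (0 : R)] --> x.
  have : (h *: delta_mx 0 i + x : 'rV[R]_n) @[h --> (0 : R)] --> 0 *: delta_mx 0 i + x.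
    apply: cvgD; last exact: cvg_cst.
    by apply: cvgZl; exact: cvg_id.
  by rewrite scale0r add0r.
apply: cvg_near_cst; have := cx _ nK; rewrite nbhs_simpl /=.
by apply: filterS => h /= hK; exact: uK.
Qed.

End separate_continuity.

Section hardy_compact_support.
Context {R : realType}.
Local Notation mu := (@lebesgue_measure R).
Local Open Scope ereal_scope.

Lemma measurable_energy d (s p be : R) (u : 'rV[R]_d -> R) : measurable_fun setT u ->
  measurable_fun setT (fun z : 'rV[R]_d * 'rV[R]_d =>
    (`|u z.1 - u z.2| `^ p * enorm (z.1 - z.2) `^ (- (d%:R + s * p)) * enorm z.2 `^ be)%:E).
Proof.
move=> mu; have men := @measurable_enorm R d.
have mxy : measurable_fun setT (fun z : 'rV[R]_d * 'rV[R]_d => enorm (z.1 - z.2)).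
  apply: (measurableT_comp men); apply: measurable_fun_coordP => i.
  rewrite (_ : (fun z => _) = (fun z : 'rV[R]_d * 'rV[R]_d => (z.1 0 i - z.2 0 i)%R)); last first.
    by apply/funext => z; rewrite !mxE.
  by apply: measurable_funB; apply: (measurableT_comp (@measurable_coord R _ i));
    [exact: measurable_fst|exact: measurable_snd].
by meas.
Qed.

Lemma measurable_energy_slice d (s p be : R) (u : 'rV[R]_d -> R) x : measurable_fun setT u ->
  measurable_fun setT (fun y : 'rV[R]_d =>
    (`|u x - u y| `^ p * enorm (x - y) `^ (- (d%:R + s * p)) * enorm y `^ be)%:E).
Proof.
move=> mu; have h := measurable_energy s p be mu.
apply: (@measurable_fun2 _ _ _ _ _ _ _ _ (fun x y =>
  (`|u x - u y| `^ p * enorm (x - y) `^ (- (d%:R + s * p)) * enorm y `^ be)%:E) (fun=> x) id h); meas.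
Qed.

Lemma measurable_energy_density d (s p q al be : R) (u : 'rV[R]_d -> R) : measurable_fun setT u ->
  measurable_fun setT (fun x : 'rV[R]_d => (\int[mun d]_y
     (`|u x - u y| `^ p * enorm (x - y) `^ (- (d%:R + s * p)) * enorm y `^ be)%:E) `^ (q / p)
     * (enorm x `^ al)%:E).
Proof.
move=> mu; have men := @measurable_enorm R d.
apply: emeasurable_funM; last by meas.
apply: (measurableT_comp (@measurable_poweR R (q / p))).
apply: (@measurable_integral_snd _ _ _ _ _ (mun d) (fun x y =>
  (`|u x - u y| `^ p * enorm (x - y) `^ (- (d%:R + s * p)) * enorm y `^ be)%:E)).
  exact: measurable_energy.
by move=> x y; pos.
Qed.

Lemma clamp_lipschitz (M a b : R) :
  (`|Num.max (- M) (Num.min a M) - Num.max (- M) (Num.min b M)| <= `|a - b|)%R.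
Proof.
rewrite /Num.max /Num.min.
have := ler_norm (a - b)%R; have := ler_norm (b - a)%R; rewrite [`|b - a|%R]distrC => h1 h2.
rewrite ler_norml; apply/andP; split.
  by case: (ltP a M) => ?; case: (ltP b M) => ?; do ?(case: ifPn; rewrite -?leNgt => ?); lra.
by case: (ltP a M) => ?; case: (ltP b M) => ?; do ?(case: ifPn; rewrite -?leNgt => ?); lra.
Qed.

Lemma clamp_norm (M a : R) : (0 <= M)%R ->
  (`|Num.max (- M) (Num.min a M)| <= M * (0 < `|a|)%R%:R)%R.
Proof.
move=> M0; have [->|a0] := eqVneq a 0%R.
  by rewrite normr0 ltxx mulr0 min_l// max_r ?oppr_le0// normr0.
rewrite normr_gt0 a0 mulr1 ler_norml le_max lexx/= ge_max ge_min lexx orbT andbT; lra.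
Qed.

Lemma clamp_id (M a : R) : (`|a| <= M)%R -> Num.max (- M)%R (Num.min a M) = a.
Proof. by rewrite ler_norml => /andP[h1 h2]; rewrite min_l// max_r. Qed.

(** Clamping the values of u to [-k, k] is 1-Lipschitz, so it does not increase the left side, and
    it bounds the right-hand integral by k^q times the weighted measure of the set where u is
    nonzero. Then k tends to infinity. *)
Lemma hardy_finite_support d (s p q al be : R) (u : 'rV[R]_d.+1 -> R)
    (gam := (s * q - al - q * be / p)%R) (kap := ((d.+1%:R - gam) / q)%R) :
  (1 <= q)%R -> (q <= p)%R -> measurable_fun setT u ->
  \int[mun d.+1]_x (enorm x `^ (- gam) * (0 < `|u x|)%R%:R)%:E < +oo ->
  Dconst d.+1 s p be kap < +oo ->
  Dconst d.+1 s p be kap `^ (q / p) * \int[mun d.+1]_x (`|u x| `^ q * enorm x `^ (- gam))%:E <=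
  \int[mun d.+1]_x ((\int[mun d.+1]_y
     (`|u x - u y| `^ p * enorm (x - y) `^ (- (d.+1%:R + s * p)) * enorm y `^ be)%:E) `^ (q / p)
     * (enorm x `^ al)%:E).
Proof.
move=> q1 qp mU sU Dfin.
have q0 : (0 < q)%R by exact: lt_le_trans q1.
have p0 : (0 < p)%R by exact: lt_le_trans qp.
have r0 : (0 <= q / p)%R by rewrite divr_ge0// ltW.
have men := @measurable_enorm R d.+1.
pose c (k : nat) (a : R) := Num.max (- k%:R)%R (Num.min a k%:R).
have mc k : measurable_fun setT (c k).
  by apply: measurable_maxr => //; apply: measurable_minr.
pose uk k x := c k (u x).
have muk k : measurable_fun setT (uk k) by exact: measurableT_comp.
set C := Dconst _ _ _ _ _ `^ _.
have C0 : 0 <= C by exact: poweR_ge0.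
rewrite -integralTZl; [|by meas|by pos|exact: C0].
apply: (@integral_le_eventually _ _ _ (mun d.+1)
  (fun k x => C * (`|uk k x| `^ q * enorm x `^ (- gam))%:E)).
- by move=> k; meas.
- by move=> k x; apply: mule_ge0 => //; pos.
- move=> x; exists (Num.truncn `|u x|).+1 => // k /= hk.
  rewrite /uk /c clamp_id//; apply: (le_trans (ltW (truncnS_gt _))).
  by rewrite ler_nat.
- move=> k; rewrite integralTZl; [|by meas|by pos|exact: C0].
  apply: (le_trans (@hardy_finite_norm R d s p q al be (uk k) q1 qp (muk k) _ Dfin)).
    apply: (@le_lt_trans _ _ ((k%:R `^ q)%:E * \int[mun d.+1]_x (enorm x `^ (- gam) * (0 < `|u x|)%R%:R)%:E)).
      rewrite -integralTZl; [|by meas|by pos|by pos].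
      apply: integralT_le; [by pos|by meas|by meas|].
      move=> x; rewrite -EFinM lee_fin mulrCA mulrC; apply: ler_wpM2l; first exact: powR_ge0.
      have h := clamp_norm (u x) (ler0n R k).
      apply: (@le_trans _ _ ((k%:R * (0 < `|u x|)%R%:R) `^ q)%R).
        by apply: ge0_ler_powR; rewrite ?nnegrE ?(ltW q0)// mulr_ge0.
      by case: (0 < `|u x|)%R; rewrite ?mulr1 ?mulr0 ?powR0// gt_eqF.
    by rewrite lte_mul_pinfty// lee_fin powR_ge0.
  apply: integralT_le; [|exact: measurable_energy_density|exact: measurable_energy_density|].
    by move=> x; apply: mule_ge0; [exact: poweR_ge0|rewrite lee_fin powR_ge0].
  move=> x; apply: lee_wpmul2r; first by rewrite lee_fin powR_ge0.
  apply: gt0_ler_poweR; [exact: r0| | |].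
  - by rewrite in_itv/= leey andbT; pos.
  - by rewrite in_itv/= leey andbT; pos.
  apply: integralT_le; [by pos|exact: measurable_energy_slice|exact: measurable_energy_slice|].
  move=> y; rewrite lee_fin -!mulrA; apply: ler_wpM2r.
    by rewrite mulr_ge0 ?powR_ge0.
  by apply: ge0_ler_powR; rewrite ?nnegrE ?(ltW p0)//; exact: clamp_lipschitz.
Qed.

End hardy_compact_support.

Section hardy_C1c.
Context {R : realType}.
Local Notation mu := (@lebesgue_measure R).
Local Open Scope ereal_scope.

Lemma LhsE d (s p q al be : R) (u : 'rV[R]_d -> R) : measurable_fun setT u ->
  Lhs d s p q al be u = \int[mun d]_x ((\int[mun d]_y
     (`|u x - u y| `^ p * enorm (x - y) `^ (- (d%:R + s * p)) * enorm y `^ be)%:E) `^ (q / p)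
     * (enorm x `^ al)%:E).
Proof.
move=> mu; rewrite -Rn_integralE; last 2 first.
- exact: measurable_energy_density.
- by move=> x; apply: mule_ge0; [exact: poweR_ge0|rewrite lee_fin powR_ge0].
rewrite /Lhs; congr (Rn_integral _); apply/funext => x.
apply: (congr1 (fun z => z `^ (q / p) * _)).
rewrite -Rn_integralE; last 2 first.
- exact: measurable_energy_slice.
- by move=> y; pos.
by congr (Rn_integral _); apply/funext => y; rewrite powRN.
Qed.

Lemma RhsE d (s p q al be : R) (u : 'rV[R]_d -> R) : measurable_fun setT u ->
  Rhs d s p q al be u =
  \int[mun d]_x (`|u x| `^ q * enorm x `^ (- (s * q - al - q * be / p)))%:E.
Proof.
move=> mu; have men := @measurable_enorm R d.
rewrite -Rn_integralE; last 2 first.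
- by meas.
- by move=> x; pos.
by rewrite /Rhs; congr (Rn_integral _); apply/funext => x; rewrite powRN.
Qed.

Lemma C1c_measurable n (U : set 'rV[R]_n) (u : 'rV[R]_n -> R) : C1c_on U u ->
  measurable_fun setT u.
Proof. by move=> /C1c_separately_continuous; exact: measurable_separately_continuous. Qed.

(** For gam < d the weight |x|^-gam is integrable at 0 and the support is bounded; for gam > d it is
    integrable at infinity and the support stays away from 0. *)
Lemma C1c_weight_lty d (gam : R) (u : 'rV[R]_d.+1 -> R) : gam != d.+1%:R ->
  C1c_on (if (gam < d.+1%:R)%R then [set: 'rV[R]_d.+1] else ~` [set 0%R]) u ->
  \int[mun d.+1]_x (enorm x `^ (- gam) * (0 < `|u x|)%R%:R)%:E < +oo.
Proof.
move=> gn uC; have mu := C1c_measurable uC.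
have men := @measurable_enorm R d.+1.
have [_ _ [K [cK KU uK]]] := uC.
have K1 x : (0 < `|u x|)%R -> K x.
  by move=> ux; apply: contrapT => /uK ux0; rewrite ux0 normr0 ltxx in ux.
move: KU; case: ifPn => gn' KU.
  have [b [b0 Kb]] := enorm_compact_bounded cK.
  have := @integral_enorm_le_lty R d.+1 (d.+1%:R - gam) b isT.
  rewrite subr_gt0 => /(_ gn' b0); apply: le_lt_trans.
  apply: integralT_le; [by pos|by meas|by meas|move=> x].
  rewrite lee_fin addrAC subrr add0r; apply: ler_wpM2l; first exact: powR_ge0.
  by case: ltP => // /K1/Kb ->.
have {}gn' : (d.+1%:R < gam)%R by rewrite lt_neqAle eq_sym gn leNgt.
have K0 : ~ K 0%R by move=> /KU/=; apply.
have [b [b0 Kb]] := enorm_compact_ge cK K0.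
have := @integral_enorm_ge_lty R d.+1 (gam - d.+1%:R) b isT.
rewrite subr_gt0 => /(_ gn' b0); apply: le_lt_trans.
apply: integralT_le; [by pos|by meas|by meas|move=> x].
rewrite lee_fin opprB addrAC subrr add0r; apply: ler_wpM2l; first exact: powR_ge0.
by case: ltP => // /K1/Kb ->.
Qed.

Lemma hardy_C1c d (s p q al be : R) (u : 'rV[R]_d.+1 -> R)
    (gam := (s * q - al - q * be / p)%R) :
  (1 <= q)%R -> (q <= p)%R -> gam != d.+1%:R ->
  C1c_on (if (gam < d.+1%:R)%R then [set: 'rV[R]_d.+1] else ~` [set 0%R]) u ->
  Cconst d.+1 s p q al be < +oo ->
  Cconst d.+1 s p q al be * Rhs d.+1 s p q al be u <= Lhs d.+1 s p q al be u.
Proof.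
move=> q1 qp gn uC.
have q0 : (0 < q)%R by exact: lt_le_trans q1.
have p0 : (0 < p)%R by exact: lt_le_trans qp.
have mu := C1c_measurable uC.
rewrite LhsE// RhsE// CconstE//.
have -> : (d.+1%:R + al + q * be / p - s * q = d.+1%:R - gam)%R by rewrite /gam; ring.
move=> Cfin; apply: hardy_finite_support => //; first exact: C1c_weight_lty.
rewrite ltey; apply/eqP => Dy; move: Cfin; rewrite Dy poweRyr ?ltxx//.
by rewrite gt_eqF// divr_gt0.
Qed.

End hardy_C1c.

(** * Sharpness *)

Section radial_C1c.
Context {R : realType}.

(** A quadratic remainder bound is a polynomial inequality for the piecewise polynomials below,
    including at their gluing points. *)
Lemma is_derive_quadratic (f : R -> R) (x d K : R) :
  (forall h, `|f (x + h) - f x - d * h| <= K * h ^+ 2) -> is_derive x 1 f d.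
Proof.
move=> hf.
have cf : h^-1 *: ((f \o shift x) (h *: 1) - f x) @[h --> 0^'] --> d.
  apply/subr_cvg0; apply: (@cvg_to_0_linear _ _ K 1) => // r /andP[r0 _].
  have rN : r != 0 by rewrite -normr_gt0.
  have -> : r^-1 *: ((f \o shift x) (r *: 1) - f x) - d = r^-1 * (f (x + r) - f x - d * r).
    by rewrite /= /GRing.scale/= mulr1 [r + x]addrC; field.
  rewrite normrM normfV ler_pdivrMl//; apply: (le_trans (hf r)).
  by rewrite [leRHS]mulrCA -normrM -expr2 ger0_norm ?sqr_ge0.
split; first by apply: cvgP cf.
exact: cvg_lim cf.
Qed.

Lemma is_derive_line (V : normedModType R) (f : V -> R) (x v : V) (d : R) :
  is_derive (0 : R) 1 (fun h => f (h *: v + x)) d -> is_derive x v f d.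
Proof.
case=> df dv; split; first exact/derivable1P.
rewrite -dv /derive.
suff -> : (fun h : R => h^-1 *: ((f \o shift x) (h *: v) - f x)) =
  (fun h : R => h^-1 *: (((fun t => f (t *: v + x)) \o shift 0) (h *: 1) - f (0 *: v + x))) by [].
by apply/funext => h /=; rewrite addr0 scale0r add0r [_%:A]mulr1.
Qed.

Lemma sqn_line n (x : 'rV[R]_n) i (h : R) :
  sqn (h *: delta_mx 0 i + x) = sqn x + h * (2 * x 0 i) + h ^+ 2.
Proof.
rewrite /sqn (bigD1 i)//= [in RHS](bigD1 i)//= !mxE !eqxx/= mulr1.
under eq_bigr => j ji do rewrite !mxE eqxx (negbTE ji)/= mulr0 add0r.
by ring.
Qed.

Lemma C1_comp_sqn n (H H' : R -> R) : (forall v : R, is_derive v 1 H (H' v)) -> continuous H' ->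
  forall (i : 'I_n) (x : 'rV[R]_n),
    is_derive x (delta_mx 0 i) (fun y => H (sqn y)) (H' (sqn x) * (2 * x 0 i)) /\
    (fun y => derive (fun z => H (sqn z)) y (delta_mx 0 i)) @ x -->
      derive (fun z => H (sqn z)) x (delta_mx 0 i).
Proof.
move=> dH cH i.
have D (x : 'rV[R]_n) : is_derive x (delta_mx 0 i) (fun y => H (sqn y)) (H' (sqn x) * (2 * x 0 i)).
  apply: is_derive_line.
  rewrite (_ : (fun h => _) = H \o (fun h => sqn x + h * (2 * x 0 i) + h ^+ 2)); last first.
    by apply/funext => h /=; rewrite sqn_line.
  apply: is_derive1_comp.
    by rewrite mul0r expr0n/= !addr0.
  apply: (@is_derive_quadratic _ _ _ 1) => h.
  rewrite add0r mul0r expr0n/= !addr0 mul1r.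
  rewrite (_ : _ - _ = h ^+ 2); last by ring.
  by rewrite ger0_norm// sqr_ge0.
move=> x; split; first exact: D.
have -> : (fun y => derive (fun z => H (sqn z)) y (delta_mx 0 i)) =
    (fun y : 'rV[R]_n => H' (sqn y) * (2 * y 0 i)).
  by apply/funext => y; have [_ ->] := D y.
have [_ ->] := D x.
have c1 : H' (sqn y) @[y --> x] --> H' (sqn x).
  by apply: (@continuous_comp _ _ _ (@sqn R n) H'); [exact: sqn_continuous|exact: cH].
have c2 : 2 * y 0 i @[y --> x] --> 2 * x 0 i.
  by apply: cvgM; [exact: cvg_cst|exact: coord_continuous].
exact: cvgM c1 c2.
Qed.

(* As a function of |x|^2 rather than |x|, a radial function is as smooth as its profile. The
   test is needed because ln is 0 at nonpositive arguments. *)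
Definition log_profile (G : R -> R) (v : R) : R := if 0 < v then G (ln v) else 0.

(** The support of G makes the profile vanish for all v < e^(-A), hence near every v <= 0; for v > 0
    it is the composition of G with ln. *)
Lemma log_profile_C1 (G G' : R -> R) (A : R) :
  (forall a : R, is_derive a 1 G (G' a)) -> continuous G' ->
  (forall a, A < `|a| -> G a = 0 /\ G' a = 0) ->
  (forall v : R, is_derive v 1 (log_profile G) (log_profile G' v / v)) /\
  continuous (fun v => log_profile G' v / v).
Proof.
move=> dG cG sG.
have z v : v < expR (- A) -> log_profile G v = 0 /\ log_profile G' v = 0.
  rewrite /log_profile; case: ifP => // v0 vA; apply: sG.
  have : ln v < - A by rewrite -[ltRHS]expRK ltr_ln// posrE expR_gt0.
  by rewrite ltrNr => /lt_le_trans; apply; rewrite -normrN ler_norm.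
have nz (v : R) : v <= 0 -> \forall w \near v, w < expR (- A).
  by move=> v0; apply: lt_nbhsl; apply: (le_lt_trans v0); exact: expR_gt0.
split=> v.
  have [v0|v0] := ltP 0 v.
    apply: (@near_eq_is_derive _ _ _ (G \o @ln R)).
      by apply: filterS (lt_nbhsr v0) => w w0; rewrite /log_profile w0.
    rewrite /log_profile v0; exact: (is_derive1_comp (dG (ln v)) (is_derive1_ln v0)).
  have -> : log_profile G' v / v = 0 by rewrite /log_profile ltNge v0/= mul0r.
  apply: near_eq_is_derive (@is_derive_cst _ R R 0 v 1).
  by apply: filterS (nz v v0) => w /z[] ->.
have [v0|v0] := ltP 0 v; last first.
  apply: (@near_cst_continuous _ _ 0); apply: filterS (nz v v0) => w /z[_ ->].
  by rewrite mul0r.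
have cl : (fun w : R => G' (ln w) / w) @ v --> log_profile G' v / v.
  rewrite /log_profile v0; apply: cvgM; last by apply: cvgV; [rewrite gt_eqF|exact: cvg_id].
  apply: (@continuous_comp _ _ _ (@ln R) G'); last exact: cG.
  apply/differentiable_continuous/derivable1_diffP.
  by have [] := is_derive1_ln v0.
apply: cvg_trans cl; apply: near_eq_cvg.
by apply: filterS (lt_nbhsr v0) => w w0; rewrite /log_profile w0.
Qed.

Lemma C1c_radial n (U : set 'rV[R]_n) (G G' : R -> R) (A : R) :
  ~` [set 0] `<=` U ->
  (forall a : R, is_derive a 1 G (G' a)) -> continuous G' ->
  (forall a, A < `|a| -> G a = 0 /\ G' a = 0) ->
  C1c_on U (fun x => log_profile G (sqn x)).
Proof.
move=> U0 dG cG sG.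
have [dH cH] := log_profile_C1 dG cG sG.
have D := C1_comp_sqn dH cH.
split.
- by move=> x _ i; have [[]] := D n i x.
- by move=> i x _; have [_] := D n i x.
(* A closed annulus: it avoids the origin, so the function is admissible for both choices of U in
   the theorem. *)
pose K : set 'rV[R]_n := [set x | expR (- A) <= sqn x <= expR A].
have KU : K `<=` ~` [set 0].
  move=> x /andP[+ _] x0; rewrite x0 /sqn big1 => [|i _]; last by rewrite mxE expr0n.
  by rewrite leNgt expR_gt0.
exists K; split; last 2 first.
- exact: subset_trans KU U0.
- move=> x /= Kx; rewrite /log_profile; case: ifP => // x0; apply: (sG _ _).1.
  rewrite ltNge; apply: contra_notN Kx; rewrite ler_norml.
  by move=> h; rewrite /K/= -(lnK x0) !ler_expR.
apply: bounded_closed_compact; last first.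
  have -> : K = @sqn R n @^-1` `[expR (- A), expR A].
    by apply/seteqP; split=> x; rewrite /K/= in_itv.
  by apply: closed_comp => [x _|]; [exact: sqn_continuous|exact: itv_closed].
exists (Num.sqrt (expR A)); split; first exact: num_real.
move=> M AM x /andP[_ xA].
rewrite /= [leLHS]/Num.norm/= mx_normrE; apply/bigmax_leP; split.
  by apply: le_trans (ltW AM); exact: sqrtr_ge0.
move=> ij _; rewrite ord1; apply: (le_trans (coord_le_enorm _ _)); apply: le_trans (ltW AM).
by rewrite enormE ler_wsqrtr.
Qed.

(** The cutoff phi, supported in [-1, 1]. Squaring the positive part makes it continuously
    differentiable. *)
Definition quartic_bump (b : R) : R := Num.max 0 (1 - b ^+ 2) ^+ 2.

Lemma is_derive_maxr0_sqr (w : R) :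
  is_derive w 1 (fun v => Num.max 0 v ^+ 2) (2 * Num.max 0 w).
Proof.
apply: (@is_derive_quadratic _ _ _ 1) => h.
rewrite ler_norml; apply/andP; split;
  case: (leP 0 (w + h)) => h1; case: (leP 0 w) => h2; rewrite ?expr0n/=; nra.
Qed.

Lemma quartic_bump_out (b : R) : 1 <= `|b| -> Num.max 0 (1 - b ^+ 2) = 0.
Proof.
move=> b1; rewrite max_l// subr_le0 -real_normK ?num_real//.
by rewrite -(expr1n _ 2%N) ler_sqr ?nnegrE.
Qed.

Lemma quartic_bump_ge0 b : 0 <= quartic_bump b. Proof. exact: sqr_ge0. Qed.

Lemma quartic_bump_le1 b : quartic_bump b <= 1.
Proof.
have b2 := sqr_ge0 b; have m0 : 0 <= Num.max 0 (1 - b ^+ 2) by rewrite le_max lexx.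
have m1 : Num.max 0 (1 - b ^+ 2) <= 1 by rewrite ge_max ler01 lerBlDl lerDr.
by rewrite /quartic_bump expr_le1.
Qed.

Lemma quartic_bump_lipschitz a b : `|quartic_bump a - quartic_bump b| <= 4 * `|a - b|.
Proof.
pose c (a : R) := Num.max (- 1) (Num.min a 1).
(* Clamping the argument to [-1, 1] makes the bump a polynomial, whose difference factors; the clamp
   itself is 1-Lipschitz. *)
have cE t : Num.max 0 (1 - t ^+ 2) = 1 - c t ^+ 2.
  rewrite /c; case: (leP t 1) => t1; case: leP => t2; case: leP => t3; nra.
have c1 t : -1 <= c t <= 1.
  by rewrite /c le_max lexx/= ge_max ge_min lexx orbT andbT; lra.
rewrite /quartic_bump !cE; have := clamp_lipschitz 1 a b; rewrite -/(c a) -/(c b).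
move: (c a) (c b) (c1 a) (c1 b) => x y /andP[x1 x2] /andP[y1 y2] xy.
have -> : (1 - x ^+ 2) ^+ 2 - (1 - y ^+ 2) ^+ 2 = ((x + y) * (x ^+ 2 + y ^+ 2 - 2)) * (x - y) by ring.
rewrite normrM; apply: ler_pM => //.
rewrite normrM (_ : 4 = 2 * 2); last by ring.
by apply: ler_pM => //; rewrite ler_norml; apply/andP; split; nra.
Qed.

Lemma expR_quartic_bump_C1 (c k : R) (G' := fun a => expR (c * a) * (c * quartic_bump (k * a)
    - 4 * k ^+ 2 * a * Num.max 0 (1 - (k * a) ^+ 2))) :
  (forall a : R, is_derive a 1 (fun a => expR (c * a) * quartic_bump (k * a)) (G' a)) /\ continuous G'.
Proof.
have d1 (b a : R) : is_derive a 1 (fun t : R => b * t) b.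
  by apply: (@is_derive_quadratic _ _ _ 0) => h; rewrite mul0r (_ : _ - _ = 0) ?normr0//; ring.
have d2 (a : R) : is_derive a 1 (fun t : R => 1 - (k * t) ^+ 2) (- 2 * k ^+ 2 * a).
    apply: (@is_derive_quadratic _ _ _ (k ^+ 2)) => h.
    by rewrite (_ : _ - _ = - ((k * h) ^+ 2)) ?normrN ?ger0_norm ?sqr_ge0 ?exprMn//; ring.
have dc (f : R -> R) : (forall a : R, exists d, is_derive a 1 f d) -> continuous f.
  by move=> df t; apply/differentiable_continuous/derivable1_diffP; have [d []] := df t.
have d3 (a : R) : is_derive a 1 (fun t : R => quartic_bump (k * t))
    (2 * Num.max 0 (1 - (k * a) ^+ 2) * (- 2 * k ^+ 2 * a)).
  exact: (@is_derive1_comp R (fun v => Num.max 0 v ^+ 2) (fun t => 1 - (k * t) ^+ 2) a _ _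
    (is_derive_maxr0_sqr _) (d2 a)).
have d4 (a : R) : is_derive a 1 (fun t : R => expR (c * t)) (expR (c * a) * c).
  exact: (@is_derive1_comp R expR (fun t => c * t) a _ _ (is_derive_expR _) (d1 c a)).
split=> a.
  have e : expR (c * a) *: (2 * Num.max 0 (1 - (k * a) ^+ 2) * (- 2 * k ^+ 2 * a)) +
      quartic_bump (k * a) *: (expR (c * a) * c) = G' a.
    by rewrite /GRing.scale/= /G' /quartic_bump; ring.
  by rewrite -e; exact: is_deriveM (d4 a) (d3 a).
have cm (b : R) : continuous (fun t : R => b * t) by apply: dc => t; exists b.
have cv : continuous (fun t : R => 1 - (k * t) ^+ 2) by apply: dc => t; eexists; exact: d2.
have cb : continuous (fun t : R => quartic_bump (k * t)) by apply: dc => t; eexists; exact: d3.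
have ce : continuous (fun t : R => expR (c * t)) by apply: dc => t; eexists; exact: d4.
have cmax : continuous (fun t : R => Num.max 0 (1 - (k * t) ^+ 2)).
  have -> : (fun t : R => Num.max 0 (1 - (k * t) ^+ 2)) =
      (fun t : R => (1 - (k * t) ^+ 2 + `|1 - (k * t) ^+ 2|) * 2^-1).
    by apply/funext => t; rewrite maxr_absE add0r sub0r normrN.
  move=> t; apply: cvgM; last exact: cvg_cst.
  by apply: cvgD; [exact: cv|apply: cvg_norm; exact: cv].
apply: cvgM; first exact: ce.
apply: cvgB; first by apply: cvgM; [exact: cvg_cst|exact: cb].
by apply: cvgM; [exact: cm|exact: cmax].
Qed.

End radial_C1c.

(** * Both sides of the inequality for radial functions, in logarithmic variables *)

Section radial_energy.
Context {R : realType}.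
Local Notation mu := (@lebesgue_measure R).
Local Open Scope ereal_scope.

Lemma radial_norm d (q gam : R) (F : R -> R) : measurable_fun setT F ->
  \int[mun d.+1]_x (`|F (enorm x)| `^ q * enorm x `^ (- gam))%:E =
  (2 * radial_const d.+1)%:E * \int[mu]_t (`|F (expR t)| `^ q * expR ((d.+1%:R - gam) * t))%:E.
Proof.
move=> mF.
pose g v : \bar R := (`|F v| `^ q * v `^ (- gam))%:E.
have mg : measurable_fun setT g by rewrite /g; meas.
have g0 v : 0 <= g v by rewrite /g; pos.
rewrite (@integral_polar R d.+1 g isT mg g0).
apply: (congr1 (mule _)); apply: eq_integral => t _.
by rewrite /g -EFinM expR_powR -mulrA -expRD; congr ((_ * expR _)%:E); ring.
Qed.

Lemma radial_inner d (s p be a : R) (x : 'rV[R]_d.+1) (F : R -> R) : measurable_fun setT F ->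
  enorm x = expR a ->
  \int[mun d.+1]_y (`|F (enorm x) - F (enorm y)| `^ p * enorm (x - y) `^ (- (d.+1%:R + s * p)) *
    enorm y `^ be)%:E =
  (expR ((be - s * p) * a))%:E *
  \int[mu]_t ((`|F (expR a) - F (expR (a + t))| `^ p * expR ((d.+1%:R + be) * t))%:E * kern d.+1 s p t).
Proof.
move=> mF xa.
have x0 : (0 < enorm x)%R by rewrite xa expR_gt0.
pose g v : \bar R := (`|F (expR a) - F v| `^ p * v `^ be)%:E.
have mg : measurable_fun setT g by rewrite /g; meas.
have g0 v : 0 <= g v by rewrite /g; pos.
have mk := @measurable_kern R d s p.
have k0 t : 0 <= kern d.+1 s p t by exact: kern_ge0.
transitivity (\int[mun d.+1]_y (g (enorm y) * (enorm (x - y) `^ (- (d.+1%:R + s * p)))%:E)).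
  by apply: eq_integral => y _; rewrite /g -EFinM xa; congr (_%:E); ring.
rewrite (@integral_bipolar R d s p x g x0 mg g0) xa expR_powR.
have -> : (expR ((be - s * p) * a) = expR (- (s * p) * a) * expR (be * a))%R.
  by rewrite -expRD; congr expR; ring.
rewrite EFinM -muleA; apply: (congr1 (mule _)).
rewrite -integralTZl; side.
apply: eq_integral => t _; rewrite /g -expRD expR_powR !muleA -!EFinM.
apply: (congr1 (fun z => z%:E * _)).
have -> : ((d.+1%:R + be) * t = be * t + d.+1%:R * t)%R by ring.
by rewrite mulrDr !expRD; ring.
Qed.

(** The inner integral of the left side at |x| = e^a, without its scaling factor e^((be - sp) a). *)
Definition radial_density d (s p be : R) (F : R -> R) (a : R) : \bar R :=
  \int[mu]_t ((`|F (expR a) - F (expR (a + t))| `^ p * expR ((d%:R + be) * t))%:E * kern d s p t).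

Lemma radial_density_ge0 d (s p be : R) (F : R -> R) a : 0 <= radial_density d.+1 s p be F a.
Proof.
by apply: integral_ge0 => t _; apply: mule_ge0; [pos|exact: kern_ge0].
Qed.

Lemma measurable_radial_density d (s p be : R) (F : R -> R) : measurable_fun setT F ->
  measurable_fun setT (radial_density d.+1 s p be F).
Proof.
move=> mF; have mk := @measurable_kern R d s p.
pose h (a t : R) : \bar R :=
  (`|F (expR a) - F (expR (a + t))| `^ p * expR ((d.+1%:R + be) * t))%:E * kern d.+1 s p t.
have mh : measurable_fun setT (fun z => h z.1 z.2).
  apply: emeasurable_funM; last exact: (measurableT_comp mk measurable_snd).
  by apply/measurable_EFinP; apply: measurable_funM; clear mk; meas.
have h0 a t : 0 <= h a t by apply: mule_ge0; [pos|exact: kern_ge0].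
exact: (@measurable_integral_snd _ _ _ _ _ mu h mh h0).
Qed.

Lemma radial_energy d (s p q al be : R) (F : R -> R) : measurable_fun setT F ->
  \int[mun d.+1]_x ((\int[mun d.+1]_y
     (`|F (enorm x) - F (enorm y)| `^ p * enorm (x - y) `^ (- (d.+1%:R + s * p)) * enorm y `^ be)%:E) `^ (q / p)
     * (enorm x `^ al)%:E) =
  (2 * radial_const d.+1)%:E * \int[mu]_a (radial_density d.+1 s p be F a `^ (q / p) *
     (expR ((d.+1%:R + al + (be - s * p) * (q / p)) * a))%:E).
Proof.
move=> mF; have men := @measurable_enorm R d.+1.
have mI := measurable_radial_density d s p be mF.
have I0 a : 0 <= radial_density d.+1 s p be F a by exact: radial_density_ge0.
have aux (I : R -> \bar R) : measurable_fun setT I -> (forall a, 0 <= I a) ->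
    measurable_fun setT (fun v => ((v `^ (be - s * p))%:E * I (ln v)) `^ (q / p) *
      (v `^ al)%:E * (0 < v)%R%:R%:E) /\
    forall v, 0 <= ((v `^ (be - s * p))%:E * I (ln v)) `^ (q / p) * (v `^ al)%:E * (0 < v)%R%:R%:E.
  by move=> mI' I0'; split; [meas|pos].
have [mg g0] := aux _ mI I0.
pose g v : \bar R := ((v `^ (be - s * p))%:E * radial_density d.+1 s p be F (ln v)) `^ (q / p) *
  (v `^ al)%:E * (0 < v)%R%:R%:E.
transitivity (\int[mun d.+1]_x g (enorm x)).
  rewrite -integral_enorm_gt0; last 2 first.
  - exact: (@measurable_energy_density R d.+1 s p q al be (fun x => F (enorm x)) (measurableT_comp mF men)).
  - by move=> x; apply: mule_ge0; [exact: poweR_ge0|rewrite lee_fin powR_ge0].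
  apply: eq_integral => x _; rewrite /g.
  have [x0|x0] := ltP 0%R (enorm x); last by rewrite !mule0.
  have xa : enorm x = expR (ln (enorm x)) by rewrite lnK.
  rewrite (@radial_inner d s p be _ x F mF xa).
  have -> : (enorm x `^ (be - s * p) = expR ((be - s * p) * ln (enorm x)))%R by rewrite [in LHS]xa expR_powR.
  reflexivity.
rewrite (@integral_polar R d.+1 g isT mg g0).
apply: (congr1 (mule _)); apply: eq_integral => a _.
rewrite /g expR_gt0 mule1 !expR_powR expRK poweRM; [|by pos|by []].
rewrite poweR_EFin expR_powR -!muleA muleCA -!EFinM -!expRD.
by apply: (congr1 (fun z => _ * (expR z)%:E)); ring.
Qed.

End radial_energy.

(** * Error estimates for the cutoff *)

Section sharpness_pointwise.
Context {R : realType}.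

Lemma powR_subadditive (r x y : R) : 0 < r -> r <= 1 -> 0 <= x -> 0 <= y ->
  (x + y) `^ r <= x `^ r + y `^ r.
Proof.
move=> r0 r1 x0 y0.
have [z0|zN] := eqVneq (x + y) 0.
  by rewrite z0 powR0 ?gt_eqF// addr_ge0 ?powR_ge0.
have z0 : 0 < x + y by rewrite lt_neqAle eq_sym zN addr_ge0.
have part (w : R) : 0 <= w -> w <= x + y -> w / (x + y) * (x + y) `^ r <= w `^ r.
  move=> w0 wz; have {2}-> : w = w / (x + y) * (x + y) by rewrite divfK.
  rewrite powRM ?divr_ge0 ?(ltW z0)//; apply: ler_wpM2r; first exact: powR_ge0.
  have [->|wN] := eqVneq w 0; first by rewrite mul0r powR_ge0.
  apply: ger1_powR => //; apply/andP; split.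
    by rewrite divr_gt0// lt_neqAle eq_sym wN.
  by rewrite ler_pdivrMr// mul1r.
have -> : (x + y) `^ r = x / (x + y) * (x + y) `^ r + y / (x + y) * (x + y) `^ r.
  by rewrite -mulrDl -mulrDl divff// mul1r.
by apply: lerD; apply: part => //; rewrite ?lerDl ?lerDr.
Qed.

(** The increment is at most 4 |h| and vanishes when |b| > 1 + |h|. The exponential majorizes the
    indicator of |b| <= 1 + |h| and splits into a factor in b and a factor in h. *)
Lemma quartic_bump_increment (c p b h : R) : 0 <= c -> 0 < p ->
  `|quartic_bump b - quartic_bump (b + h)| `^ p <= (4 * `|h|) `^ p * expR (c * (1 + `|h| - `|b|)).
Proof.
move=> c0 p0.
have [hb|hb] := leP `|b| (1 + `|h|).
  apply: (@le_trans _ _ ((4 * `|h|) `^ p)).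
    apply: ge0_ler_powR; rewrite ?nnegrE ?(ltW p0) ?mulr_ge0//.
    apply: (le_trans (quartic_bump_lipschitz _ _)).
    by rewrite opprD addrA subrr add0r normrN.
  by rewrite ler_peMr ?powR_ge0// -[leLHS]expR0 ler_expR mulr_ge0// subr_ge0.
have z (w : R) : 1 <= `|w| -> quartic_bump w = 0 by move=> /quartic_bump_out; rewrite /quartic_bump => ->; rewrite expr0n.
have hN := normr_ge0 h.
have z1 : quartic_bump b = 0 by apply: z; apply: (le_trans _ (ltW hb)); rewrite lerDl.
have z2 : quartic_bump (b + h) = 0.
  apply: z; rewrite -(lerD2r `|h|); apply: (le_trans (ltW hb)).
  by have := ler_normD (b + h) (- h); rewrite addrK normrN.
by rewrite z1 z2 subrr normr0 powR0 ?gt_eqF// mulr_ge0 ?powR_ge0 ?expR_ge0.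
Qed.

(** f - E f' = f (1 - E) + E (f - f'), split with weights 1 - l and l. The main term keeps a factor
    (1 - l)^(1-p) that tends to 1, so no constant is lost in the limit. *)
Lemma powR_norm_split (p l f f' E : R) : 1 <= p -> 0 < l -> l < 1 -> 0 <= f -> 0 <= E ->
  `|f - E * f'| `^ p <=
    (1 - l) `^ (1 - p) * (f `^ p * `|1 - E| `^ p) + l `^ (1 - p) * (E `^ p * `|f - f'| `^ p).
Proof.
move=> p1 l0 l1 f0 E0; have p0 : 0 < p by exact: lt_le_trans p1.
apply: (@le_trans _ _ ((f * `|1 - E| + E * `|f - f'|) `^ p)).
  apply: ge0_ler_powR; rewrite ?nnegrE ?(ltW p0) ?addr_ge0 ?mulr_ge0//.
  have -> : f - E * f' = f * (1 - E) + E * (f - f') by ring.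
  by apply: (le_trans (ler_normD _ _)); rewrite !normrM (ger0_norm f0) (ger0_norm E0).
have l1' : 0 < 1 - l by rewrite subr_gt0.
have := @powR_perspective R p (1 - l) l (f * `|1 - E|) (E * `|f - f'|) p1 l1' l0.
by rewrite subrK powR1 mul1r !powRM//; apply; exact: mulr_ge0.
Qed.

Lemma quartic_bump_density_pointwise (p kap m c e l a t : R) :
  1 <= p -> 0 <= c -> 0 < e -> e <= 1 -> 0 < l -> l < 1 ->
  `|expR (- kap * a) * quartic_bump (e * a) - expR (- kap * (a + t)) * quartic_bump (e * (a + t))| `^ p * expR (m * t) <=
  expR (- (p * kap) * a) *
    (((1 - l) `^ (1 - p) * quartic_bump (e * a) `^ p) * (expR (m * t) * `|1 - expR (- kap * t)| `^ p) +
     (l `^ (1 - p) * ((4 * e) `^ p * expR (c - c * (e * `|a|)))) *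
       (`|t| `^ p * expR ((m - p * kap + c) * t) + `|t| `^ p * expR ((m - p * kap - c) * t))).
Proof.
move=> p1 c0 e0 e1 l0 l1; have p0 : 0 < p by exact: lt_le_trans p1.
set E := expR (- kap * t); set f := quartic_bump (e * a); set f' := quartic_bump (e * (a + t)).
have f0 : 0 <= f by exact: quartic_bump_ge0.
have f'0 : 0 <= f' by exact: quartic_bump_ge0.
have E0 : 0 <= E by exact: expR_ge0.
have -> : expR (- kap * a) * f - expR (- kap * (a + t)) * f' = expR (- kap * a) * (f - E * f').
  by rewrite mulrDr expRD /E; ring.
rewrite normrM (ger0_norm (expR_ge0 _)) (powRM _ (expR_ge0 _) (normr_ge0 _)) expR_powR.
have -> : p * (- kap * a) = - (p * kap) * a by ring.
rewrite -mulrA; apply: ler_wpM2l; first exact: expR_ge0.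
have h2 := @powR_norm_split p l f f' E p1 l0 l1 f0 E0.
have h3 : E `^ p * `|f - f'| `^ p * expR (m * t) <=
    ((4 * e) `^ p * expR (c - c * (e * `|a|))) *
       (`|t| `^ p * expR ((m - p * kap + c) * t) + `|t| `^ p * expR ((m - p * kap - c) * t)).
  have := @quartic_bump_increment c p (e * a) (e * t) c0 p0.
  rewrite -mulrDr -/f -/f' !normrM (gtr0_norm e0) (mulrA 4) => h.
  apply: (@le_trans _ _ (E `^ p * ((4 * e * `|t|) `^ p * expR (c * (1 + e * `|t| - e * `|a|))) * expR (m * t))).
    by apply: ler_wpM2r; [exact: expR_ge0|apply: ler_wpM2l; [exact: powR_ge0|]].
  rewrite (@powRM _ (4 * e) `|t|) ?mulr_ge0 ?(ltW e0)// /E expR_powR -mulrDr.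
  have -> : (m - p * kap + c) * t = p * (- kap * t) + m * t + c * t by ring.
  have -> : (m - p * kap - c) * t = p * (- kap * t) + m * t + - (c * t) by ring.
  rewrite 2!(expRD (_ + m * t)) -mulrDr (expRD (p * _)).
  have -> : c * (1 + e * `|t| - e * `|a|) = c - c * (e * `|a|) + c * (e * `|t|) by ring.
  rewrite (expRD (c - _)).
  (* e <= 1 makes the bound uniform in e; the two exponentials give moments whose exponents are
     shifted by c and -c. *)
  have h4 : expR (c * (e * `|t|)) <= expR (c * t) + expR (- (c * t)).
    apply: (@le_trans _ _ (expR (c * `|t|))).
      by rewrite ler_expR ler_wpM2l// ler_piMl.
    have [t0|t0] := leP 0 t; first by rewrite ger0_norm// lerDl expR_ge0.
    by rewrite ltr0_norm// mulrN lerDr expR_ge0.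
  set X := expR (p * _); set Y := expR (m * t); set Z := expR (c - _).
  have -> : X * ((4 * e) `^ p * `|t| `^ p * (Z * expR (c * (e * `|t|)))) * Y =
    ((4 * e) `^ p * Z * (`|t| `^ p * (X * Y))) * expR (c * (e * `|t|)) by ring.
  have -> : (4 * e) `^ p * Z * (`|t| `^ p * (X * Y * (expR (c * t) + expR (- (c * t))))) =
    ((4 * e) `^ p * Z * (`|t| `^ p * (X * Y))) * (expR (c * t) + expR (- (c * t))) by ring.
  by apply: ler_wpM2l => //; rewrite /X /Y /Z !mulr_ge0 ?powR_ge0 ?expR_ge0.
apply: (@le_trans _ _ (((1 - l) `^ (1 - p) * (f `^ p * `|1 - E| `^ p) +
    l `^ (1 - p) * (E `^ p * `|f - f'| `^ p)) * expR (m * t))).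
  by apply: ler_wpM2r => //; exact: expR_ge0.
rewrite mulrDl; apply: lerD; last first.
  by rewrite -!mulrA; apply: ler_wpM2l; [exact: powR_ge0|rewrite !mulrA in h3 *].
by rewrite le_eqVlt; apply/orP; left; apply/eqP; ring.
Qed.

(** With the splitting parameter l equal to e, the error factor e^(1-p) (4 e)^p is 4^p e, which
    tends to 0, while (1 - e)^(1-p) tends to 1. Here [Phi] and [Psi] are plain real numbers. *)
Lemma sharpness_limit (C D M Phi Psi p r : R) : 1 <= p -> 0 < r -> 0 < Phi -> 0 <= D -> 0 <= M ->
  (forall e, 0 < e -> e < 1 ->
    C * Phi <= ((1 - e) `^ (1 - p) * D) `^ r * Phi + (e `^ (1 - p) * ((4 * e) `^ p * M)) `^ r * Psi) ->
  C <= D `^ r.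
Proof.
move=> p1 r0 P0 D0 M0 H.
have e1E (e : R) : 0 < e -> e `^ (1 - p) * ((4 * e) `^ p * M) = 4 `^ p * M * e.
  move=> e0; rewrite powRM ?(ltW e0)//.
  have -> : e `^ (1 - p) * (4 `^ p * e `^ p * M) = 4 `^ p * M * (e `^ (1 - p) * e `^ p) by ring.
  rewrite -powRD ?(gt_eqF e0) ?implybT// (_ : 1 - p + p = 1); last by ring.
  by rewrite powRr1// ltW.
pose g (e : R) := (1 - e) `^ ((1 - p) * r) * (D `^ r * Phi) + e `^ r * ((4 `^ p * M) `^ r * Psi).
have gc : g e @[e --> 0^'+] --> D `^ r * Phi.
  have -> : D `^ r * Phi = 1 `^ ((1 - p) * r) * (D `^ r * Phi) + 0 * ((4 `^ p * M) `^ r * Psi).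
    by rewrite powR1 mul1r mul0r addr0.
  apply: cvgD; apply: cvgM; try exact: cvg_cst; last exact: powR_cvg0.
  apply: cvg_at_right_filter.
  have c1 : {for (1 - 0 : R), continuous (fun x : R => x `^ ((1 - p) * r))}.
    apply/differentiable_continuous/derivable1_diffP; apply: derivable_powR.
    by rewrite subr0 in_itv/= ltr01.
  have c2 : (1 - e : R) @[e --> (0 : R)] --> (1 - 0 : R).
    by apply: cvgB; [exact: cvg_cst|exact: cvg_id].
  rewrite -[X in _ --> X `^ _](subr0 1).
  exact: (cvg_comp _ _ c2 c1).
suff : C * Phi <= D `^ r * Phi by rewrite ler_pM2r.
rewrite -(cvg_lim _ gc)//; apply: limr_ge; first by apply/cvg_ex; exists (D `^ r * Phi).
near=> e.
have e0 : 0 < e by near: e; exact: nbhs_right_gt.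
have e1 : e < 1 by near: e; exact: nbhs_right_lt.
apply: (le_trans (H e e0 e1)); rewrite /g e1E// !powRM ?powR_ge0 ?mulr_ge0 ?powR_ge0 ?(ltW e0)//.
rewrite -powRrM le_eqVlt; apply/orP; left; apply/eqP; ring.
Unshelve. all: by end_near. Qed.

End sharpness_pointwise.

Section sharpness.
Context {R : realType}.
Local Notation mu := (@lebesgue_measure R).

(* |x|^-kap times a cutoff of ln |x| at scale 1/e; v stands for |x|. *)
Definition virtual_extremal (kap e v : R) : R :=
  log_profile (fun a => expR (- kap / 2 * a) * quartic_bump (e / 2 * a)) (v ^+ 2).

Lemma virtual_extremal_expR (kap e t : R) :
  virtual_extremal kap e (expR t) = expR (- kap * t) * quartic_bump (e * t).
Proof.
rewrite /virtual_extremal /log_profile exprn_gt0 ?expR_gt0// -expRM_natl expRK mulr_natl.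
by congr (expR _ * quartic_bump _); field.
Qed.

Lemma measurable_quartic_bump : measurable_fun setT (@quartic_bump R).
Proof.
apply: measurable_funX; apply: measurable_maxr; first exact: measurable_cst.
by meas.
Qed.

Lemma measurable_virtual_extremal (kap e : R) : measurable_fun setT (virtual_extremal kap e).
Proof.
have mb := measurable_quartic_bump.
rewrite (_ : virtual_extremal kap e = fun v : R => expR (- kap / 2 * ln (v ^+ 2)) *
    quartic_bump (e / 2 * ln (v ^+ 2)) * (0 < v ^+ 2)%R%:R); first by meas.
apply/funext => v; rewrite /virtual_extremal /log_profile.
by case: ifP; rewrite ?mulr1 ?mulr0.
Qed.

Lemma C1c_virtual_extremal n (U : set 'rV[R]_n) (kap e : R) : 0 < e -> ~` [set 0] `<=` U ->
  C1c_on U (fun x => virtual_extremal kap e (enorm x)).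
Proof.
move=> e0 U0.
have [dG cG] := expR_quartic_bump_C1 (- kap / 2) (e / 2).
have := C1c_radial U0 dG cG (A := 2 / e).
rewrite (_ : (fun x => virtual_extremal kap e (enorm x)) = fun x : 'rV[R]_n =>
  log_profile (fun a => expR (- kap / 2 * a) * quartic_bump (e / 2 * a)) (sqn x)); last first.
  by apply/funext => x; rewrite /virtual_extremal enorm_sqr.
apply=> a Aa.
have /quartic_bump_out b0 : 1 <= `|e / 2 * a|.
  rewrite normrM ger0_norm ?divr_ge0 ?(ltW e0)//.
  by rewrite mulrC -ler_pdivrMr ?divr_gt0// invf_div mul1r ltW.
by rewrite /quartic_bump b0 expr0n/= !mulr0 subr0 mulr0.
Qed.

Local Open Scope ereal_scope.

(** q kap = d - gam cancels the weight in logarithmic variables; only the cutoff remains, and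
    scaling it by e gives the order 1/e. *)
Lemma virtual_extremal_norm d (q gam e : R) : (0 < q)%R -> (0 < e)%R ->
  \int[mun d.+1]_x (`|virtual_extremal ((d.+1%:R - gam) / q) e (enorm x)| `^ q * enorm x `^ (- gam))%:E =
  (2 * radial_const d.+1)%:E * ((e^-1)%:E * \int[mu]_t (quartic_bump t `^ q)%:E).
Proof.
move=> q0 e0; have mb := measurable_quartic_bump.
rewrite (@radial_norm R d q gam _ (measurable_virtual_extremal _ e)).
apply: (congr1 (mule _)).
pose h t : \bar R := (quartic_bump t `^ q)%:E.
have mh : measurable_fun setT h by rewrite /h; meas.
have h0 t : 0 <= h t by rewrite /h; pos.
rewrite -(@integral_pscale R h e e0 mh h0); apply: eq_integral => t _.
rewrite virtual_extremal_expR /h; congr (_%:E).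
have b0 := quartic_bump_ge0 (e * t).
move: (quartic_bump _) b0 => b b0.
rewrite normrM (ger0_norm (expR_ge0 _)) (ger0_norm b0) powRM ?expR_ge0// expR_powR mulrAC -expRD.
rewrite (_ : q * _ + _ = 0)%R ?expR0 ?mul1r//.
by field; rewrite gt_eqF.
Qed.

Lemma virtual_extremal_density d (s p be kap c e l D K a : R) :
  (1 <= p)%R -> (0 <= c)%R -> (0 < e)%R -> (e <= 1)%R -> (0 < l)%R -> (l < 1)%R ->
  Dconst d.+1 s p be kap = D%:E ->
  \int[mu]_t ((`|t| `^ p * expR ((d.+1%:R + be - p * kap + c) * t) +
     `|t| `^ p * expR ((d.+1%:R + be - p * kap - c) * t))%:E * kern d.+1 s p t) = K%:E ->
  radial_density d.+1 s p be (virtual_extremal kap e) a <=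
  (expR (- (p * kap) * a) * (((1 - l) `^ (1 - p) * quartic_bump (e * a) `^ p) * D +
     (l `^ (1 - p) * ((4 * e) `^ p * expR (c - c * (e * `|a|)))) * K))%:E.
Proof.
move=> p1 c0 e0 e1 l0 l1 DE KE.
set A1 := ((1 - l) `^ (1 - p) * _)%R; set A2 := (l `^ (1 - p) * _)%R.
set E := expR (- (p * kap) * a).
have A10 : (0 <= A1)%R by rewrite /A1; pos.
have A20 : (0 <= A2)%R by rewrite /A2 !mulr_ge0 ?powR_ge0 ?expR_ge0.
have E0 : (0 <= E)%R by exact: expR_ge0.
have mk := @measurable_kern R d s p.
have k0 t : 0 <= kern d.+1 s p t by exact: kern_ge0.
rewrite EFinM EFinD (EFinM A1) (EFinM A2) -DE -KE /Dconst.
rewrite -integralTZl; [|by meas|by pos|by pos].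
rewrite -integralTZl; [|by meas|by pos|by pos].
rewrite -integralTD; [|by meas|by pos|by meas|by pos].
rewrite -integralTZl; [|by meas|by pos|by pos].
have mv := measurable_virtual_extremal kap e.
rewrite /radial_density; apply: integralT_le; [by pos|by meas|by meas|].
move=> t; rewrite !muleA -!EFinM -ge0_muleDl ?lee_fin; [|by pos|by pos].
rewrite muleA -EFinD -EFinM; apply: lee_wpmul2r => //; rewrite lee_fin !virtual_extremal_expR.
exact: quartic_bump_density_pointwise.
Qed.

Lemma integral_expR_norm_lty (c : R) : (0 < c)%R -> \int[mu]_t (expR (- c * `|t|))%:E < +oo.
Proof.
move=> c0; apply: (@le_lt_trans _ _ (\int[mu]_t (expR (c * t) * (t <= 0)%R%:R)%:E +
    \int[mu]_t (expR (- c * t) * (0 <= t)%R%:R)%:E)); last first.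
  by apply: lte_add_pinfty; [exact: integral_expR_le_lty|exact: integral_expR_ge_lty].
rewrite -integralTD; side; apply: integralT_le; side.
move=> t; rewrite -EFinD lee_fin; have [t0|t0] := leP 0%R t.
  by rewrite ger0_norm// mulr1 lerDr mulr_ge0 ?expR_ge0.
by rewrite ltr0_norm// mulr0 addr0 (ltW t0) mulr1 mulrNN.
Qed.

Lemma integral_quartic_bump (q : R) : (0 < q)%R ->
  exists2 P : R, (0 < P)%R & \int[mu]_t (quartic_bump t `^ q)%:E = P%:E.
Proof.
move=> q0; have mb := measurable_quartic_bump.
have fin : \int[mu]_t (quartic_bump t `^ q)%:E < +oo.
  apply: (@le_lt_trans _ _ ((expR 1)%:E * \int[mu]_t (expR (- 1 * `|t|))%:E)); last first.
    by rewrite lte_mul_pinfty ?lee_fin ?expR_ge0 ?integral_expR_norm_lty.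
  rewrite -integralTZl; side; apply: integralT_le; side.
  move=> t; rewrite -EFinM lee_fin -expRD.
  have [t1|t1] := leP `|t|%R 1%R.
    apply: (@le_trans _ _ 1%R); last by rewrite -[leLHS]expR0 ler_expR; lra.
    have -> : 1%R = (1 `^ q)%R :> R by rewrite powR1.
    by apply: ge0_ler_powR; rewrite ?nnegrE ?(ltW q0) ?quartic_bump_ge0 ?quartic_bump_le1.
  by rewrite /quartic_bump quartic_bump_out ?(ltW t1)// expr0n powR0 ?gt_eqF ?expR_ge0.
exists (fine (\int[mu]_t (quartic_bump t `^ q)%:E)).
  rewrite fine_gt0// fin andbT.
  (* On [0, 1/2] the bump is at least (3/4)^2 > 1/2. *)
  apply: (@lt_le_trans _ _ (\int[mu]_(t in `[0%R, 2^-1%R]) ((2^-1) `^ q)%:E)).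
    rewrite integral_cst//= lebesgue_measure_itv/= lte_fin invr_gt0 ltr0n/= -EFinB -EFinM lte_fin.
    by rewrite subr0 mulr_gt0 ?powR_gt0 ?invr_gt0.
  rewrite integral_mkcond; apply: integralT_le.
  - by move=> t; rewrite patchE; case: ifP => _ //; rewrite lee_fin powR_ge0.
  - by apply/(measurable_restrictT _ _).1 => //; exact: measurable_cst.
  - by meas.
  move=> t; rewrite patchE mem_setE in_itv/=; case: ifP => [/andP[t0 t1]|_]; last by rewrite lee_fin powR_ge0.
  rewrite lee_fin; apply: ge0_ler_powR; rewrite ?nnegrE ?(ltW q0) ?quartic_bump_ge0 ?invr_ge0//.
  rewrite /quartic_bump max_r; nra.
by rewrite fineK// ge0_fin_numE//; pos.
Qed.

End sharpness.

Section sharpness_theorem.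
Context {R : realType}.
Local Notation mu := (@lebesgue_measure R).
Local Open Scope ereal_scope.

(** Both sides of the assumed inequality carry the factors 2 [radial_const] and 1/e, which are
    divided out. The power q/p <= 1 of main term plus error is split by subadditivity. *)
Lemma sharpness_step d (s p q al be C c e D K P Q : R)
    (gam := (s * q - al - q * be / p)%R) (kap := ((d.+1%:R - gam) / q)%R) :
  (1 <= q)%R -> (q <= p)%R -> (0 < c)%R -> (0 < e)%R -> (e < 1)%R -> (0 <= D)%R -> (0 <= K)%R ->
  Dconst d.+1 s p be kap = D%:E ->
  \int[mu]_t ((`|t| `^ p * expR ((d.+1%:R + be - p * kap + c) * t) +
     `|t| `^ p * expR ((d.+1%:R + be - p * kap - c) * t))%:E * kern d.+1 s p t) = K%:E ->
  \int[mu]_t (quartic_bump t `^ q)%:E = P%:E ->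
  \int[mu]_t (expR (- (c * (q / p)) * `|t|))%:E = Q%:E ->
  C%:E * Rhs d.+1 s p q al be (fun x => virtual_extremal kap e (enorm x)) <=
    Lhs d.+1 s p q al be (fun x => virtual_extremal kap e (enorm x)) ->
  (C * P <= ((1 - e) `^ (1 - p) * D) `^ (q / p) * P +
    (e `^ (1 - p) * ((4 * e) `^ p * (expR c * K))) `^ (q / p) * Q)%R.
Proof.
move=> q1 qp c0 e0 e1 D0 K0 DE KE PE QE.
have q0 : (0 < q)%R by exact: lt_le_trans q1.
have p0 : (0 < p)%R by exact: lt_le_trans qp.
have p1 : (1 <= p)%R by exact: le_trans qp.
have qN : (q != 0)%R by rewrite gt_eqF.
have pN : (p != 0)%R by rewrite gt_eqF.
have r0 : (0 < q / p)%R by rewrite divr_gt0.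
have r1 : (q / p <= 1)%R by rewrite ler_pdivrMr// mul1r.
have mv := measurable_virtual_extremal kap e.
have mu' : measurable_fun setT (fun x : 'rV[R]_d.+1 => virtual_extremal kap e (enorm x)).
  by apply: (measurableT_comp mv); exact: measurable_enorm.
have [cn _] := @radial_law_const R d.+1 isT.
have cc : (0 < 2 * radial_const d.+1 :> R)%R by rewrite mulr_gt0.
have cc0 : 0 <= (2 * radial_const d.+1 : R)%:E by rewrite lee_fin ltW.
set X1 := (_ `^ (q / p))%R; set X2 := (_ `^ (q / p))%R.
have X10 : (0 <= X1)%R by exact: powR_ge0.
have X20 : (0 <= X2)%R by exact: powR_ge0.
rewrite RhsE// LhsE// -/gam (@virtual_extremal_norm R d q gam e q0 e0) PE.
rewrite (@radial_energy R d s p q al be _ mv).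
set I := \int[mu]_a _.
have mb := @measurable_quartic_bump R.
have HI : I <= (e^-1 * (X1 * P + X2 * Q))%:E.
  pose h t : \bar R := (X1 * quartic_bump t `^ q + X2 * expR (- (c * (q / p)) * `|t|))%:E.
  have mh : measurable_fun setT h by rewrite /h; meas.
  have h0 t : 0 <= h t by rewrite /h; pos.
  have -> : (e^-1 * (X1 * P + X2 * Q))%:E = \int[mu]_t h (e * t)%R.
    rewrite (@integral_pscale R h e e0 mh h0) EFinM; apply: (congr1 (mule _)).
    rewrite EFinD (EFinM X1) (EFinM X2) -PE -QE.
    rewrite -integralTZl; [|by meas|by pos|by pos].
    rewrite -integralTZl; [|by meas|by pos|by pos].
    rewrite -integralTD; [|by meas|by pos|by meas|by pos].
    by apply: eq_integral => t _; rewrite /h -!EFinM -EFinD.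
  rewrite /I; apply: integralT_le.
  - by move=> a; apply: mule_ge0; [exact: poweR_ge0|rewrite lee_fin expR_ge0].
  - apply: emeasurable_funM; last by meas.
    apply: (measurableT_comp (@measurable_poweR R (q / p))).
    exact: measurable_radial_density.
  - by apply: (measurableT_comp mh); meas.
  move=> a.
  have H := @virtual_extremal_density R d s p be kap c e e D K a p1 (ltW c0) e0 (ltW e1) e0 e1 DE KE.
  have b0 := quartic_bump_ge0 (e * a).
  rewrite /h; move: H b0; move: (quartic_bump (e * a)) => b H b0.
  set Y1 := (((1 - e) `^ (1 - p) * b `^ p) * D)%R in H.
  set Y2 := (_ * K)%R in H.
  have Y10 : (0 <= Y1)%R by rewrite /Y1 !mulr_ge0 ?powR_ge0.
  have Y20 : (0 <= Y2)%R by rewrite /Y2 !mulr_ge0 ?powR_ge0 ?expR_ge0.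
  apply: (@le_trans _ _ ((expR (- (p * kap) * a) * (Y1 + Y2))%:E `^ (q / p) *
     (expR ((d.+1%:R + al + (be - s * p) * (q / p)) * a))%:E)).
    apply: lee_wpmul2r; first by rewrite lee_fin expR_ge0.
    apply: gt0_ler_poweR; [exact: ltW| | |exact: H].
      by rewrite in_itv/= leey andbT radial_density_ge0.
    by rewrite in_itv/= leey andbT lee_fin mulr_ge0 ?addr_ge0 ?expR_ge0.
  rewrite poweR_EFin -EFinM lee_fin powRM ?expR_ge0 ?addr_ge0// expR_powR mulrAC -expRD.
  (* Scale invariance: with this kap the exponential weights in a cancel, as they do on the
     right-hand side. *)
  have -> : (q / p * (- (p * kap) * a) + (d.+1%:R + al + (be - s * p) * (q / p)) * a = 0)%R.
    by rewrite /kap /gam; field; rewrite pN qN.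
  rewrite expR0 mul1r; apply: (le_trans (powR_subadditive r0 r1 Y10 Y20)).
  rewrite le_eqVlt; apply/orP; left; apply/eqP; congr (_ + _)%R.
    rewrite /Y1 /X1 mulrAC (@powRM _ _ (b `^ p)) ?mulr_ge0 ?powR_ge0// -powRrM.
    by congr (_ * b `^ _)%R; field.
  rewrite /Y2 /X2 normrM (gtr0_norm e0) expRD.
  have -> : (e `^ (1 - p) * ((4 * e) `^ p * (expR c * expR (- (c * (e * `|a|))))) * K =
    (e `^ (1 - p) * ((4 * e) `^ p * (expR c * K))) * expR (- (c * (e * `|a|))))%R by ring.
  rewrite powRM ?expR_ge0 ?mulr_ge0 ?powR_ge0 ?expR_ge0// expR_powR.
  by congr (_ * expR _)%R; ring.
move=> /le_trans/(_ (lee_wpmul2l cc0 HI)).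
rewrite -!EFinM lee_fin mulrCA ler_pM2l// mulrCA ler_pM2l ?invr_gt0//.
Qed.

End sharpness_theorem.

Section sharp_constant.
Context {R : realType}.
Local Notation mu := (@lebesgue_measure R).
Local Open Scope ereal_scope.

Lemma kern_moment2_lty d (s p a c : R) : (0 < s)%R -> (s < 1)%R -> (1 <= p)%R ->
  (0 < a - c)%R -> (a + c < d.+1%:R + s * p)%R -> (0 <= c)%R ->
  \int[mu]_t ((`|t| `^ p * expR ((a + c) * t) + `|t| `^ p * expR ((a - c) * t))%:E *
    kern d.+1 s p t) < +oo.
Proof.
move=> s0 s1 p1 h1 h2 c0; have mk := @measurable_kern R d s p.
have k0 t : 0 <= kern d.+1 s p t by exact: kern_ge0.
rewrite (_ : \int[mu]_t _ = \int[mu]_t ((`|t| `^ p * expR ((a + c) * t))%:E * kern d.+1 s p t) +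
    \int[mu]_t ((`|t| `^ p * expR ((a - c) * t))%:E * kern d.+1 s p t)).
  by apply: lte_add_pinfty; apply: kern_moment_lty => //; lra.
rewrite -integralTD; [|by meas|by pos|by meas|by pos].
by apply: eq_integral => t _; rewrite EFinD ge0_muleDl// lee_fin mulr_ge0 ?powR_ge0 ?expR_ge0.
Qed.

Lemma hardy_sharp d (s p q al be C : R) (U : set 'rV[R]_d.+1)
    (gam := (s * q - al - q * be / p)%R) (kap := ((d.+1%:R - gam) / q)%R) :
  (0 < s)%R -> (s < 1)%R -> (1 <= q)%R -> (q <= p)%R ->
  (0 < d.+1%:R + be - p * kap)%R -> (be - p * kap < s * p)%R ->
  Dconst d.+1 s p be kap < +oo -> ~` [set 0%R] `<=` U ->
  (forall u : 'rV[R]_d.+1 -> R, C1c_on U u ->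
    C%:E * Rhs d.+1 s p q al be u <= Lhs d.+1 s p q al be u) ->
  C%:E <= Dconst d.+1 s p be kap `^ (q / p).
Proof.
move=> s0 s1 q1 qp h1 h2 Dfin U0 H.
have q0 : (0 < q)%R by exact: lt_le_trans q1.
have p1 : (1 <= p)%R by exact: le_trans qp.
have p0 : (0 < p)%R by exact: lt_le_trans p1.
have r0 : (0 < q / p)%R by rewrite divr_gt0.
have k0 t : 0 <= kern d.+1 s p t by exact: kern_ge0.
have real (X : \bar R) : 0 <= X -> X < +oo -> exists2 x : R, (0 <= x)%R & X = x%:E.
  move=> X0 Xy; exists (fine X); first exact: fine_ge0.
  by rewrite fineK// ge0_fin_numE.
have [D D0 DE] := real _ (Dconst_ge0 d s p be kap) Dfin.
set a0 := (d.+1%:R + be - p * kap)%R in h1.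
have h3 : (a0 < d.+1%:R + s * p)%R by rewrite /a0 -addrA ltrD2l.
(* Half the distance from a0 to the ends of ]0, d + sp[, so that the moments with exponents a0 + c
   and a0 - c are finite. *)
pose c := (Num.min a0 (d.+1%:R + s * p - a0) / 2)%R.
have c0 : (0 < c)%R by rewrite divr_gt0// lt_min h1 subr_gt0.
have c1 : (c * 2 <= a0)%R by rewrite divfK// ge_min lexx.
have c2 : (c * 2 <= d.+1%:R + s * p - a0)%R by rewrite divfK// ge_min lexx orbT.
have [K K0 KE] : exists2 K : R, (0 <= K)%R &
    \int[mu]_t ((`|t| `^ p * expR ((a0 + c) * t) + `|t| `^ p * expR ((a0 - c) * t))%:E *
      kern d.+1 s p t) = K%:E.
  apply: real; first by pos.
  by apply: kern_moment2_lty => //; lra.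
have [P P0 PE] := @integral_quartic_bump R q q0.
have [Q Q0 QE] : exists2 Q : R, (0 <= Q)%R & \int[mu]_t (expR (- (c * (q / p)) * `|t|))%:E = Q%:E.
  by apply: real; [pos|apply: integral_expR_norm_lty; rewrite mulr_gt0].
rewrite DE poweR_EFin lee_fin.
apply: (@sharpness_limit R C D (expR c * K) P Q p (q / p)) => //.
  by rewrite mulr_ge0// expR_ge0.
move=> e e0 e1.
apply: (@sharpness_step R d s p q al be C c e D K P Q) => //.
by apply: H; exact: C1c_virtual_extremal.
Qed.

End sharp_constant.

Theorem theorem1 (R : realType) (d : nat) (s p q al be : R) :
  (1 <= d)%N -> 0 < s -> s < 1 -> 1 <= q -> q <= p ->
  al < s * q - (1 - q / p) * d%:R ->
  be < s * p ->
  - d%:R < al ->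
  - d%:R < be ->
  - d%:R < al + q * be / p ->
  s * q - al - q * be / p != d%:R ->
  let U : set 'rV[R]_d :=
    if s * q - al - q * be / p < d%:R then [set: 'rV[R]_d] else ~` [set 0] in
  [/\ (forall u : 'rV[R]_d -> R, C1c_on U u ->
         (Cconst d s p q al be * Rhs d s p q al be u <= Lhs d s p q al be u)%E),
      (Cconst d s p q al be < +oo)%E
    & (forall C : R,
         (forall u : 'rV[R]_d -> R, C1c_on U u ->
            (C%:E * Rhs d s p q al be u <= Lhs d s p q al be u)%E) ->
         (C%:E <= Cconst d s p q al be)%E)].
Proof.
case: d => [//|d] _ s0 s1 q1 qp hal hbe hal' hbe' _ hgam U.
have q0 : 0 < q by exact: lt_le_trans q1.
have p1 : 1 <= p by exact: le_trans qp.
have p0 : 0 < p by exact: lt_le_trans p1.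
have [qN pN] : q != 0 /\ p != 0 by rewrite !gt_eqF.
set n : R := d.+1%:R in hal hal' hbe' hgam *.
pose gam := s * q - al - q * be / p; pose kap := (n - gam) / q.
(* The upper bound on al is the positivity of this exponent. *)
have a0E : n + be - p * kap = p / q * (s * q - (1 - q / p) * n - al).
  by rewrite /kap /gam; field; rewrite pN qN.
have a0 : 0 < n + be - p * kap by rewrite a0E mulr_gt0 ?divr_gt0// subr_gt0.
(* Equivalent to al > -d. *)
have a1 : be - p * kap < s * p.
  rewrite -subr_gt0; have -> : s * p - (be - p * kap) = p / q * (n + al).
    by rewrite /kap /gam; field; rewrite pN qN.
  by rewrite mulr_gt0 ?divr_gt0// -ltrBlDl sub0r.
have Dfin : (Dconst d.+1 s p be kap < +oo)%E.
  by apply: Dconst_lty => //; rewrite -ltrBlDl sub0r.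
have CE : (Cconst d.+1 s p q al be = Dconst d.+1 s p be kap `^ (q / p))%E.
  rewrite (CconstE _ _ _ _ p0 q0).
  have -> : d.+1%:R + al + q * be / p - s * q = n - gam by rewrite /n /gam; ring.
  reflexivity.
have Cfin : (Cconst d.+1 s p q al be < +oo)%E by rewrite CE poweR_lty.
have U0 : ~` [set 0] `<=` U.
  by move=> x x0; rewrite /U; case: (_ < n); [exact: I|exact: x0].
split; [|exact: Cfin|].
- by move=> u uC; apply: hardy_C1c.
- move=> C H; rewrite CE; exact: (@hardy_sharp R d s p q al be C U s0 s1 q1 qp a0 a1 Dfin U0 H).
Qed.
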